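(* Let $\mathcal{G}_7$ be the set of germs $(M,p)\in\mathcal{G}$ such that $p\in LD$, the $LD$ and the $PC$ are regular at $p$, and $m(LD,PC:p)>1$. For generic $(M,p)\in\mathcal{G}_7$ the following hold. (1) $m(LD,PC:p)=2$. (2) For a generic 1-parameter family of surfaces $M_t$ with $M_0=M$, the configuration of the two curves deforms near $p$, for $t\neq 0$ small, as follows: for one sign of $t$ the curves $LD_t$ and $PC_t$ intersect transversally at exactly two points, and for the other sign of $t$ they are disjoint.
   Context: Minkowski space $\mathbb{R}^3_1$ is $\mathbb{R}^3$ with $\langle \mathbf{u},\mathbf{v}\rangle=u_0v_0+u_1v_1-u_2v_2$. The vector product is defined by $\langle \mathbf a\times \mathbf b,\mathbf c\rangle=\det(\mathbf a,\mathbf b,\mathbf c)$. For a smooth regular surface $M\subset\mathbb{R}^3_1$ with local parametrization $\mathbf{x}(u,v)$, put $E=\langle \mathbf{x}_u,\mathbf{x}_u\rangle$, $F=\langle \mathbf{x}_u,\mathbf{x}_v\rangle$, $G=\langle \mathbf{x}_v,\mathbf{x}_v\rangle$, $\bar l=\langle \mathbf{x}_u\times\mathbf{x}_v,\mathbf{x}_{uu}\rangle$, $\bar m=\langle \mathbf{x}_u\times\mathbf{x}_v,\mathbf{x}_{uv}\rangle$, $\bar n=\langle \mathbf{x}_u\times\mathbf{x}_v,\mathbf{x}_{vv}\rangle$, $\delta=F^2-EG$, $\bar K=\bar l\bar n-\bar m^2$. The $LD$ (locus of degeneracy) and $PC$ (parabolic curve) are the zero sets of $\delta$ and $\bar K$.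 A curve is regular at a point if the differential of its defining function is nonzero there. If $\gamma$ is a regular parametrization of the $LD$ near a regular point $p=\gamma(0)$, then $m(LD,PC:p)$ is the order of contact, i.e. the order of vanishing of $\bar K\circ\gamma$ at $0$. Genericity: $\mathcal{G}$ is the set of germs $(M,p)$ of smooth surfaces $M\subset\mathbb{R}^3_1$ at $p\in M$, identified with the set of germs of local parametrizations $(\mathbb{R}^2,0)\to(\mathbb{R}^3_1,p)$, $p\in \mathbb{R}^3_1$, with the Whitney topology, modulo diffeomorphism germs of the source $(\mathbb{R}^2,0)$ (quotient topology). A property holds for generic $(M,p)$ in a subset $\tilde{\mathcal{G}}\subset\mathcal{G}$ if the set of $(M,p)\in\tilde{\mathcal{G}}$ satisfying it is open and dense in $\tilde{\mathcal{G}}$ (induced topology). Families: a 1-parameter family $M_t$, $t\in(\mathbb{R},0)$, with $M_0=M$ is a family of surfaces given, when $M$ is the graph of $f$ over a coordinate plane (Monge form), by the graphs of $f+h(\cdot,\cdot,t)$ with $h$ smooth and $h(\cdot,\cdot,0)=0$; it is generic if $h$ satisfies suitable open and dense conditions. $LD_t$, $PC_t$ denote the corresponding curves of $M_t$; all assertions are local, in a neighbourhood of $p$. *)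

(* Defs.v *)
From HB Require Import structures.
From mathcomp Require Import all_boot all_order all_algebra.
From mathcomp Require Import all_classical all_reals all_analysis.
From mathcomp Require Import ring.

Set Implicit Arguments.
Unset Strict Implicit.
Unset Printing Implicit Defensive.

Import Order.TTheory GRing.Theory Num.Theory.
Import numFieldNormedType.Exports.

Local Open Scope classical_set_scope.
Local Open Scope ring_scope.
Local Open Scope quotient_scope.

Section Smooth.
Context {R : realType}.
Implicit Types V W : normedModType R.

Fixpoint iterD V W (vs : seq V) (f : V -> W) : V -> W :=
  if vs is v :: vs' then iterD vs' ('D_v f) else f.

(* Only used for finite dimensional V, where it is the usual notion: f is
   infinitely differentiable on one neighbourhood of a. *)
Definition smooth_near V W (a : V) (f : V -> W) : Prop :=
  \forall y \near a, forall vs : seq V, differentiable (iterD vs f) y.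

(* The jet of infinite order at 0, as the family of its coordinates. *)
Definition jet V W (f : V -> W) : prod_topology (fun _ : seq V => W) :=
  fun vs => iterD vs f 0.

Definition regular_at V (f : V -> R) (a : V) : Prop :=
  exists v, 'd f a v != 0.

Definition immersive_at V W (f : V -> W) (a : V) : Prop :=
  forall v, 'd f a v = 0 -> v = 0.

Definition transversal_at V (f g : V -> R) (a : V) : Prop :=
  [/\ regular_at f a, regular_at g a
    & forall v, 'd f a v = 0 -> 'd g a v = 0 -> v = 0].

Definition order_eq (g : R -> R) (k : nat) : Prop :=
  (forall i, (i < k)%N -> (g^`(i))%classic 0 = 0) /\ (g^`(k))%classic 0 != 0.

(* This includes the functions vanishing to infinite order. *)
Definition order_gt (g : R -> R) (k : nat) : Prop :=
  forall i, (i <= k)%N -> (g^`(i))%classic 0 = 0.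

End Smooth.

Section SmoothComp.
Context {R : realType}.
Implicit Types V W : normedModType R.

Definition Ck V W (k : nat) (A : set V) (f : V -> W) :=
  forall vs, (size vs <= k)%N -> forall y, A y -> differentiable (iterD vs f) y.

Lemma CkS V W k (A : set V) (f : V -> W) :
  Ck k.+1 A f <->
  (forall y, A y -> differentiable f y) /\ forall v, Ck k A ('D_v f).
Proof.
split=> [H|[H1 H2] [|v vs] //= s]; last exact: H2.
by split=> [|v vs s]; [exact: (H [::])|exact: (H (v :: vs))].
Qed.

Lemma Ck0 V W (A : set V) (f : V -> W) :
  (forall y, A y -> differentiable f y) -> Ck 0 A f.
Proof. by move=> H [|//]. Qed.

Lemma Ck_diff V W k (A : set V) (f : V -> W) :
  Ck k A f -> forall y, A y -> differentiable f y.
Proof. by move=> H; exact: (H [::]). Qed.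

Lemma CkW V W k (A : set V) (f : V -> W) : Ck k.+1 A f -> Ck k A f.
Proof. by move=> H vs s; apply: H; rewrite ltnW. Qed.

Lemma near0_differentiable V W (f : V -> W) a :
  (\forall y \near a, f y = 0) -> differentiable f a.
Proof.
move=> f0; pose L := 'd (cst 0 : V -> W) a.
have L0 : L = (fun=> 0) :> (V -> W) by rewrite /L diff_cst.
have cL : continuous (L : V -> W) by rewrite L0 => x; exact: cst_continuous.
suff E : f \o shift a = cst (f a) + L +o_ 0 id.
  by apply/diff_locallyP; rewrite (diff_unique cL E).
apply/eqaddoP => _/posnumP[e]; near=> h.
rewrite !fctE /= L0 (nbhs_singleton f0) addr0 subr0.
rewrite (_ : f (h + a) = 0) ?normr0 ?mulr_ge0//.
near: h; move: f0; rewrite [X in X -> _](near_shift 0)/=.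
by apply: filterS => y /=; rewrite subr0.
Unshelve. all: by end_near. Qed.

Lemma near_eq_differentiable V W (f g : V -> W) a :
  (\forall y \near a, f y = g y) -> differentiable f a -> differentiable g a.
Proof.
move=> fg df; rewrite -(subrK f g); apply: differentiableD => //.
apply: near0_differentiable; apply: filterS fg => y.
by move=> e; rewrite -[LHS]/(g y - f y) e subrr.
Qed.

Lemma open_near_eq_fun V W (A : set V) (f g : V -> W) y : open A -> A y ->
  (forall z, A z -> f z = g z) -> \forall y \near y, f y = g y.
Proof. by move=> oA Ay H; apply: filterS (open_nbhs_nbhs (conj oA Ay)). Qed.

Lemma Ck_eq V W k (A : set V) (f g : V -> W) : open A ->
  (forall z, A z -> f z = g z) -> Ck k A f -> Ck k A g.
Proof.
move=> oA; elim: k f g => [|k IH] f g fg.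
  move=> /Ck_diff df; apply: Ck0 => y Ay.
  by apply: near_eq_differentiable (df _ Ay); exact: open_near_eq_fun fg.
move=> /CkS[df dDf]; apply/CkS; split=> [y Ay|v].
  by apply: near_eq_differentiable (df _ Ay); exact: open_near_eq_fun fg.
apply: IH (dDf v) => z Az; apply: near_eq_derive.
exact: open_near_eq_fun fg.
Qed.

Lemma CkD V W k (A : set V) (f g : V -> W) : open A ->
  Ck k A f -> Ck k A g -> Ck k A (f + g).
Proof.
move=> oA; elim: k f g => [|k IH] f g.
  by move=> /Ck_diff df /Ck_diff dg; apply: Ck0 => y Ay; apply: differentiableD;
    [exact: df|exact: dg].
move=> /CkS[df dDf] /CkS[dg dDg]; apply/CkS; split=> [y Ay|v].
  by apply: differentiableD; [exact: df|exact: dg].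
apply: (Ck_eq oA _ (IH _ _ (dDf v) (dDg v))) => z Az.
by rewrite deriveD//; apply: diff_derivable; [exact: df|exact: dg].
Qed.

Lemma Ck_cst V W k (A : set V) (w : W) : Ck k A (cst w : V -> W).
Proof.
move=> vs _ y Ay; have -> : iterD vs (cst w : V -> W) = cst (if vs is [::] then w else 0).
  elim: vs w => // v vs IH w /=.
  rewrite (_ : (fun x => _) = cst 0) ?IH; first by case: (vs).
  by apply/funext => x; rewrite derive_cst.
exact: differentiable_cst.
Qed.

Lemma Ck_sum V W k (A : set V) n (f : 'I_n -> V -> W) : open A ->
  (forall i, Ck k A (f i)) -> Ck k A (\sum_i f i).
Proof.
move=> oA H; elim/big_ind: _ => [|g h|i _]; last exact: H.
- exact: Ck_cst.
- exact: CkD.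
Qed.

Lemma scale_bilinear W :
  bilinear_for (GRing.Scale.Law.clone _ _ *:%R _)
    (GRing.Scale.Law.clone _ _ *:%R _) (@GRing.scale R W : R^o -> W -> W).
Proof.
split=> [w|u] a x y /=; first by rewrite scalerDl scalerA.
by rewrite scalerDr !scalerA mulrC.
Qed.

HB.instance Definition _ W := bilinear_isBilinear.Build R R^o W W _ _
  (@GRing.scale R W : R^o -> W -> W) (@scale_bilinear W).

Lemma differentiable_scale V W (k : V -> R) (f : V -> W) y :
  differentiable k y -> differentiable f y -> differentiable (fun z => k z *: f z) y.
Proof.
move=> dk df.
have c : continuous (fun p : R^o * W => p.1 *: p.2) by exact: scale_continuous.
apply: (@differentiable_comp _ _ _ _ (fun z => (k z : R^o, f z)) (fun p : R^o * W => p.1 *: p.2)).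
  exact: differentiable_pair.
exact: (differentiable_bilin (f := @GRing.scale R W : {bilinear R^o -> W -> W})).
Qed.

Lemma derive_scale V W (k : V -> R) (f : V -> W) y v :
  differentiable k y -> differentiable f y ->
  'D_v (fun z => k z *: f z) y = 'D_v k y *: f y + k y *: 'D_v f y.
Proof.
move=> dk df; rewrite !deriveE//; last exact: differentiable_scale.
have c : continuous (fun p : R^o * W => p.1 *: p.2) by exact: scale_continuous.
rewrite (@diff_comp _ _ _ _ (fun z => (k z : R^o, f z)) (fun p : R^o * W => p.1 *: p.2)) /=.
- rewrite (diff_bilin (f := @GRing.scale R W : {bilinear R^o -> W -> W}))//=.
  by rewrite diff_pair//= addrC.
- exact: differentiable_pair.
- exact: (differentiable_bilin (f := @GRing.scale R W : {bilinear R^o -> W -> W})).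
Qed.

Lemma CkZ V W k (A : set V) (c : V -> R) (f : V -> W) : open A ->
  Ck k A c -> Ck k A f -> Ck k A (fun z => c z *: f z).
Proof.
move=> oA; elim: k c f => [|k IH] c f.
  by move=> /Ck_diff dc /Ck_diff df; apply: Ck0 => y Ay;
    apply: differentiable_scale; [exact: dc|exact: df].
move=> c1 f1; move: (c1) (f1) => /CkS[dc dDc] /CkS[df dDf].
apply/CkS; split=> [y Ay|v].
  by apply: differentiable_scale; [exact: dc|exact: df].
apply: (Ck_eq oA _ (CkD oA (IH _ _ (dDc v) (CkW f1)) (IH _ _ (CkW c1) (dDf v)))).
by move=> z Az; rewrite derive_scale//; [exact: dc|exact: df].
Qed.

Lemma Ck_coord V n k (A : set V) (f : V -> 'rV[R]_n) j : open A ->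
  Ck k A f -> Ck k A (fun z => f z 0 j).
Proof.
move=> oA; elim: k f => [|k IH] f.
  move=> /Ck_diff df; apply: Ck0 => y Ay.
  apply: (@differentiable_comp _ _ _ _ f (fun M : 'rV_n => M 0 j)) => //.
    exact: df.
  exact: differentiable_coord.
move=> /CkS[df dDf]; apply/CkS; split=> [y Ay|v].
  apply: (@differentiable_comp _ _ _ _ f (fun M : 'rV_n => M 0 j)) => //.
    exact: df.
  exact: differentiable_coord.
apply: (Ck_eq oA _ (IH _ (dDf v))) => z Az.
by rewrite derive_mx ?mxE//; apply: diff_derivable; exact: df.
Qed.

Lemma Ck_comp V W n k (A : set V) (B : set 'rV[R]_n) (f : 'rV[R]_n -> W)
    (g : V -> 'rV[R]_n) : open A -> (forall y, A y -> B (g y)) ->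
  Ck k A g -> Ck k B f -> Ck k A (f \o g).
Proof.
move=> oA AB; elim: k f => [|k IH] f.
  move=> /Ck_diff dg /Ck_diff df; apply: Ck0 => y Ay.
  by apply: differentiable_comp; [exact: dg|apply: df; exact: AB].
move=> g1 f1; move: (g1) (f1) => /CkS[dg dDg] /CkS[df dDf].
apply/CkS; split=> [y Ay|v].
  by apply: differentiable_comp; [exact: dg|apply: df; exact: AB].
pose F j := fun y => ('D_v g y) 0 j *: ('D_(delta_mx 0 j) f \o g) y.
have CF j : Ck k A (F j).
  by apply: CkZ => //; [exact: Ck_coord|apply: IH => //; exact: CkW].
apply: (Ck_eq oA _ (Ck_sum oA CF)) => y Ay.
have dgy := dg _ Ay; have dfy := df _ (AB _ Ay).
rewrite fct_sumE deriveE; last exact: differentiable_comp.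
rewrite diff_comp//= -[X in _ = 'd f _ X]deriveE// (row_sum_delta ('D_v g y)).
rewrite linear_sum.
by apply: eq_bigr => j _; rewrite linearZ /= /F /= !deriveE.
Qed.

Lemma smooth_near_comp V W n (a : V) (f : 'rV[R]_n -> W) (g : V -> 'rV[R]_n) :
  smooth_near a g -> smooth_near (g a) f -> smooth_near a (f \o g).
Proof.
move=> sg sf.
have cg : {for a, continuous g}.
  exact/differentiable_continuous/(nbhs_singleton sg [::]).
have sfg : \forall y \near a, forall vs, differentiable (iterD vs f) (g y).
  exact: cg sf.
have H : nbhs a [set y | (forall vs, differentiable (iterD vs g) y) /\
    forall vs, differentiable (iterD vs f) (g y)] by near do split.
move: H; rewrite nbhsE => -[A [oA Aa] AP].
apply: filterS (open_nbhs_nbhs (conj oA Aa)) => y Ay vs.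
apply: (@Ck_comp _ _ _ (size vs) A
  [set z | forall vs, differentiable (iterD vs f) z] f g) => //.
- by move=> z /AP[].
- by move=> us _ z /AP[].
Unshelve. all: by end_near. Qed.

Lemma smooth_near_id V (a : V) : smooth_near a (@id V).
Proof.
have did (x : V) : differentiable (@id V) x.
  by apply: (@linear_differentiable _ _ _ idfun) => y; exact: cvg_id.
near=> y; case=> [|v vs]; first exact: did.
rewrite [iterD _ _]/(iterD vs _) (_ : 'D_v id = cst v).
  exact: (@Ck_cst _ _ (size vs) setT).
by apply/funext => x; rewrite derive_id.
Unshelve. all: by end_near. Qed.

End SmoothComp.

Section Surfaces.
Context {R : realType}.
Local Notation plane := 'rV[R]_2.
Local Notation space := 'rV[R]_3.
Implicit Types (a b c : space) (x y : plane -> space).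

Definition mink a b : R :=
  a 0 0 * b 0 0 + a 0 1 * b 0 1 - a 0 2%:R * b 0 2%:R.

Definition mcross a b : space := \row_k
  [:: a 0 1 * b 0 2%:R - a 0 2%:R * b 0 1;
      a 0 2%:R * b 0 0 - a 0 0 * b 0 2%:R;
      a 0 1 * b 0 0 - a 0 0 * b 0 1]`_k.

(* The defining property of the vector product of Minkowski 3-space. *)
Lemma mink_mcross a b c :
  mink (mcross a b) c = \det (\matrix_(i < 3) [:: a; b; c]`_i).
Proof.
rewrite (expand_det_row _ ord0) !big_ord_recl big_ord0 /cofactor.
rewrite !(expand_det_row _ ord0) !big_ord_recl !big_ord0 /cofactor !det_mx11.
rewrite /mink !mxE /=.
have [A ordE] : exists A : space -> nat -> R, forall (v : space) (i : 'I_3), v 0 i = A v i.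
  by exists (fun v n => v 0 (inord n)) => v i; rewrite inord_val.
rewrite !ordE /= /bump /=; ring.
Qed.

Definition eu : plane := delta_mx 0 0.
Definition ev : plane := delta_mx 0 1.

Definition coefE x (q : plane) : R := mink ('D_eu x q) ('D_eu x q).
Definition coefF x (q : plane) : R := mink ('D_eu x q) ('D_ev x q).
Definition coefG x (q : plane) : R := mink ('D_ev x q) ('D_ev x q).

Definition normal_vec x (q : plane) : space := mcross ('D_eu x q) ('D_ev x q).

Definition lbar x (q : plane) : R := mink (normal_vec x q) ('D_eu ('D_eu x) q).
Definition mbar x (q : plane) : R := mink (normal_vec x q) ('D_ev ('D_eu x) q).
Definition nbar x (q : plane) : R := mink (normal_vec x q) ('D_ev ('D_ev x) q).

Definition delta x (q : plane) : R := coefF x q ^+ 2 - coefE x q * coefG x q.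
Definition Kbar x (q : plane) : R := lbar x q * nbar x q - mbar x q ^+ 2.

Definition LD x : set plane := [set q | delta x q = 0].
Definition PC x : set plane := [set q | Kbar x q = 0].

(* Germs at 0 of local parametrizations of regular surfaces; the base point
   x 0 is arbitrary. *)
Definition param_germ : set (plane -> space) :=
  [set x | smooth_near 0 x /\ immersive_at x 0].

Definition diffeo_germ (phi : plane -> plane) : Prop :=
  [/\ phi 0 = 0, smooth_near 0 phi &
      exists psi : plane -> plane, [/\ psi 0 = 0, smooth_near 0 psi,
        \forall u \near (0 : plane), psi (phi u) = u
      & \forall u \near (0 : plane), phi (psi u) = u]].

(* Equality up to a diffeomorphism germ of the source; phi = id identifies
   the parametrizations with the same germ. *)
Definition same_surface x y : Prop :=
  exists2 phi, diffeo_germ phi & \forall u \near (0 : plane), y u = x (phi u).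

Lemma same_surface_refl x : same_surface x x.
Proof.
exists id; last by near=> u.
split=> //; first exact: smooth_near_id.
by exists id; split=> //; [exact: smooth_near_id|near=> u|near=> u].
Unshelve. all: by end_near. Qed.

Lemma smooth0_cvg (phi : plane -> plane) (P : set plane) :
  phi 0 = 0 -> smooth_near 0 phi -> (\forall u \near (0 : plane), P u) ->
  \forall u \near (0 : plane), P (phi u).
Proof.
move=> p0 sp P0.
have c : {for 0, continuous phi}.
  exact/differentiable_continuous/(nbhs_singleton sp [::]).
by apply: c; rewrite p0.
Qed.

Lemma same_surface_sym x y : same_surface x y -> same_surface y x.
Proof.
move=> [phi [p0 sp [psi [q0 sq pq qp]]] xy]; exists psi.
  by split=> //; exists phi.
move: (smooth0_cvg q0 sq xy) qp; apply: filterS2 => u.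
by move=> -> ->.
Qed.

Lemma same_surface_trans x y z :
  same_surface x y -> same_surface y z -> same_surface x z.
Proof.
move=> [phi [p0 sp [psi [q0 sq pq qp]]] xy].
move=> [phi' [p0' sp' [psi' [q0' sq' pq' qp']]] yz].
exists (phi \o phi'); last first.
  by move: yz (smooth0_cvg p0' sp' xy); apply: filterS2 => u -> ->.
split; rewrite /= ?p0'//; first by apply: smooth_near_comp; rewrite ?p0'.
exists (psi' \o psi); split; rewrite /= ?q0//.
- by apply: smooth_near_comp; rewrite ?q0.
- by move: (smooth0_cvg p0' sp' pq) pq'; apply: filterS2 => u /= -> ->.
- by move: (smooth0_cvg q0 sq qp') qp; apply: filterS2 => u /= -> ->.
Qed.

(* On germs at 0 the Whitney topology has the sets of germs whose k-jet at 0
   lies in an open set of jets as a basis; equivalently, it is the coarsest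
   topology for which the coordinates of the jet at 0 are continuous. *)
Definition paramType : Type :=
  initial_topology (fun x : param_germ => jet (set_val x)).
HB.instance Definition _ := Topological.on paramType.

Definition same_surfaceb (x y : paramType) : bool :=
  `[< same_surface (set_val x) (set_val y) >].

Lemma same_surfaceb_equiv : equiv_class_of same_surfaceb.
Proof.
split=> [x|x y|y x z]; rewrite /same_surfaceb.
- exact/asboolP/same_surface_refl.
- by apply/asboolP/asboolP => /same_surface_sym.
- by move=> /asboolP xy /asboolP yz; apply/asboolP; exact: same_surface_trans yz.
Qed.
Canonical same_surface_equiv := EquivRelPack same_surfaceb_equiv.

(* The space of germs (M, p), with the quotient topology. *)
Definition surface_germ : Type :=
  quotient_topology {eq_quot same_surface_equiv}.
HB.instance Definition _ := Topological.on surface_germ.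

Definition surface_of (x : paramType) : surface_germ :=
  \pi_(surface_germ) x.

Definition generic_in (T : topologicalType) (A P : set T) : Prop :=
  (exists2 U, open U & U `&` A = P `&` A) /\ A `<=` closure (P `&` A).

(* At a regular point of the LD, such a curve parametrizes the LD locally. *)
Definition LD_param x (gam : R -> plane) : Prop :=
  [/\ smooth_near 0 gam, gam 0 = 0, gam^`()%classic 0 != 0
    & \forall s \near (0 : R), LD x (gam s)].

Definition contact_eq x (k : nat) : Prop :=
  exists2 gam, LD_param x gam & order_eq (Kbar x \o gam) k.

Definition contact_gt x (k : nat) : Prop :=
  exists2 gam, LD_param x gam & order_gt (Kbar x \o gam) k.

Definition G7 : set surface_germ := [set M |
  forall x : paramType, surface_of x = M ->
    [/\ LD (set_val x) 0, regular_at (delta (set_val x)) 0,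
        PC (set_val x) 0, regular_at (Kbar (set_val x)) 0
      & contact_gt (set_val x) 1]].

(* The graph of f over the coordinate plane omitting the j-th coordinate,
   with the origin of the source at p: the j-th coordinate is p_j + f(u),
   and the two others are those of p translated by u. *)
Definition monge (j : 'I_3) (p : space) (f : plane -> R) : plane -> space :=
  fun u => p + \row_k (if unlift j k is Some i then u 0 i else f u).

(* h (u, t), with t the last coordinate *)
Definition at_time (h : 'rV[R]_(2 + 1) -> R) (t : R) (u : plane) : R :=
  h (row_mx u t%:M).

Definition deformation_germ : set ('rV[R]_(2 + 1) -> R) :=
  [set h | smooth_near 0 h /\ \forall u \near (0 : plane), at_time h 0 u = 0].

Definition deformationType : Type :=
  initial_topology (fun h : deformation_germ => jet (set_val h)).
HB.instance Definition _ := Topological.on deformationType.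

Definition two_zero_transition (X : R -> plane -> space) : Prop :=
  exists sgn : bool, forall W, nbhs (0 : plane) W ->
  exists U : set plane, [/\ nbhs (0 : plane) U, U `<=` W & \forall t \near (0 : R),
    (0 < (-1) ^+ sgn * t ->
       exists q1 q2, [/\ q1 != q2,
         U `&` LD (X t) `&` PC (X t) = [set q1; q2],
         transversal_at (delta (X t)) (Kbar (X t)) q1
       & transversal_at (delta (X t)) (Kbar (X t)) q2]) /\
    ((-1) ^+ sgn * t < 0 -> U `&` LD (X t) `&` PC (X t) = set0)].

Definition contact_is_two (M : surface_germ) : Prop :=
  forall x : paramType, surface_of x = M -> contact_eq (set_val x) 2.

Definition generic_families_split (M : surface_germ) : Prop :=
  forall (x : paramType) j p f, surface_of x = M -> set_val x = monge j p f ->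
  exists O : set deformationType, [/\ open O, dense O &
    forall h, O h ->
      two_zero_transition (fun t => monge j p (f + at_time (set_val h) t))].

End Surfaces.

(* Main.v *)
(* Write {f, g} = f_u g_v - f_v g_u. Along a parametrization of the LD the
   velocity is a multiple of the rotated gradient of delta, so that
   m(LD, PC : p) > 1 means delta = Kbar = {delta, Kbar} = 0 at p, and the contact
   is exactly 2 iff moreover J2 = {delta, {delta, Kbar}} does not vanish. A change
   of parameters multiplies delta and Kbar by powers of its jacobian, hence the
   common zero locus of these four numbers depends only on the germ of the
   surface; it is closed, which gives openness. If J2 = 0, adding eps L^4 N with
   L a suitable linear form and N a constant vector keeps delta and Kbar up to
   order 2 and 1 and moves J2 by a nonzero multiple of eps, which gives density.
   In a family, restrict Kbar_t to LD_t, written as a graph over its tangent line: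
   when J2 <> 0 this is a strictly convex (or concave) function of the abscissa,
   whose minimum crosses 0 as t does as soon as its time derivative (the crossing
   speed) is not 0. This speed depends continuously on h, and adding eps t L^2
   to h changes it by a nonzero multiple of eps. *)
From mathcomp Require Import all_boot all_order all_algebra.
From mathcomp Require Import all_classical all_reals all_analysis.
From mathcomp Require Import ring lra.
Require Import Defs.

Set Implicit Arguments.
Unset Strict Implicit.
Unset Printing Implicit Defensive.

Import Order.TTheory GRing.Theory Num.Theory.
Import numFieldNormedType.Exports.

Local Open Scope classical_set_scope.
Local Open Scope ring_scope.

(** * Smooth functions on an open set *)

(** The exponents come from counting orders. Adding Q N changes delta through the first derivatives
    of Q and Kbar through the second ones, to leading order by the pairing of Hess Q with the second
    fundamental form. For Q = eps L^4 this is eps L^2 times a function, which two brackets with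
    delta turn into a multiple of {delta, L}^2; L^3 would already move {delta, Kbar} and destroy the
    tangency. A deformation must vanish at t = 0, hence the factor t; then L^2 is enough, since a
    single time derivative of Kbar counts. The pairing can be made nonzero because Kbar, being
    quadratic in the second fundamental form, could not be regular at a zero where that form
    vanishes. The vector N must not be tangent, and for graphs it can only be the graph direction.

    The neighbourhood in the transition must not shrink with t. This is why a family is one map on
    space-time, with delta and Kbar computed there by horizontal derivatives: a single box for the
    implicit function then serves all small t. *)

Section SmoothOn.
Context {R : realType}.
Implicit Types V W : normedModType R.

(** A fixed open set makes smoothness stable under differentiation and turns calculus rules into
    identities that can be differentiated again; germs enter through [smooth_nearP]. *)
Definition smooth_on V W (A : set V) (f : V -> W) := forall k, Ck k A f.

Lemma smooth_onE V W (A : set V) (f : V -> W) :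
  smooth_on A f <-> forall vs y, A y -> differentiable (iterD vs f) y.
Proof.
by split=> [H vs y Ay|H k vs _ y Ay]; [exact: (H (size vs) vs)|exact: H].
Qed.

Lemma smooth_nearP V W (a : V) (f : V -> W) :
  smooth_near a f <-> exists A, [/\ open A, A a & smooth_on A f].
Proof.
rewrite /smooth_near /prop_near1 /= (nbhsE a); split=> [[A [oA Aa] AP]|[A [oA Aa AP]]].
  by exists A; split=> //; apply/smooth_onE => vs y /AP.
by exists A => //; move=> y Ay vs; exact: ((smooth_onE A f).1 AP).
Qed.

Lemma smooth_on_sub V W (A B : set V) (f : V -> W) :
  A `<=` B -> smooth_on B f -> smooth_on A f.
Proof. by move=> AB H k vs s y /AB; exact: H. Qed.

Lemma smooth_on_near V W (A : set V) (f : V -> W) a :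
  open A -> A a -> smooth_on A f -> smooth_near a f.
Proof. by move=> oA Aa sf; apply/smooth_nearP; exists A. Qed.

Section OnOpen.
Context V (A : set V).
Hypothesis oA : open A.

Lemma smooth_on_diff W (f : V -> W) y :
  smooth_on A f -> A y -> differentiable f y.
Proof. by move=> /(_ 0%N) /Ck_diff; apply. Qed.

Lemma smooth_on_cont W (f : V -> W) y :
  smooth_on A f -> A y -> {for y, continuous f}.
Proof.
by move=> sf Ay; apply/differentiable_continuous; exact: smooth_on_diff sf Ay.
Qed.

Lemma smooth_on_derive W v (f : V -> W) :
  smooth_on A f -> smooth_on A (fun z => 'D_v f z).
Proof. by move=> sf k; have /CkS[_ ] := sf k.+1; exact. Qed.

Lemma smooth_on_derivable W v (f : V -> W) y :
  smooth_on A f -> A y -> derivable f y v.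
Proof. by move=> sf Ay; apply: diff_derivable; exact: smooth_on_diff sf Ay. Qed.

Lemma smooth_on_eq W (f g : V -> W) :
  (forall z, A z -> f z = g z) -> smooth_on A f -> smooth_on A g.
Proof. by move=> fg sf k; exact: Ck_eq fg (sf k). Qed.

Lemma derive_eq_on W (f g : V -> W) v y :
  (forall z, A z -> f z = g z) -> A y -> 'D_v f y = 'D_v g y.
Proof. by move=> fg Ay; apply: near_eq_derive; exact: open_near_eq_fun fg. Qed.

Lemma smooth_on_cst W (w : W) : smooth_on A (fun=> w).
Proof. by move=> k; exact: Ck_cst. Qed.

Lemma smooth_onD W (f g : V -> W) :
  smooth_on A f -> smooth_on A g -> smooth_on A (fun z => f z + g z).
Proof. by move=> sf sg k; exact: CkD (sf k) (sg k). Qed.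

Lemma smooth_onZ W (c : V -> R) (f : V -> W) :
  smooth_on A c -> smooth_on A f -> smooth_on A (fun z => c z *: f z).
Proof. by move=> sc sf k; exact: CkZ (sc k) (sf k). Qed.

Lemma smooth_onM (f g : V -> R) :
  smooth_on A f -> smooth_on A g -> smooth_on A (fun z => f z * g z).
Proof. by move=> sf sg k; exact: (CkZ oA (sf k) (sg k)). Qed.

Lemma smooth_onN (f : V -> R) : smooth_on A f -> smooth_on A (fun z => - f z).
Proof.
move=> sf; apply: (@smooth_on_eq _ (fun z => (-1) * f z)).
  by move=> z _; rewrite mulN1r.
by apply: smooth_onM sf; exact: smooth_on_cst.
Qed.

Lemma smooth_onB (f g : V -> R) :
  smooth_on A f -> smooth_on A g -> smooth_on A (fun z => f z - g z).
Proof. by move=> sf sg; apply: smooth_onD sf _; exact: smooth_onN. Qed.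

Lemma smooth_onX (f : V -> R) n : smooth_on A f -> smooth_on A (fun z => f z ^+ n).
Proof.
move=> sf; elim: n => [|n IH].
  by under eq_fun do rewrite expr0; exact: smooth_on_cst.
by under eq_fun do rewrite exprS; exact: smooth_onM.
Qed.

Lemma smooth_on_coord n (f : V -> 'rV[R]_n) j :
  smooth_on A f -> smooth_on A (fun z => f z 0 j).
Proof. by move=> sf k; exact: Ck_coord. Qed.

Lemma smooth_on_linear W (f : {linear V -> W}) :
  continuous f -> smooth_on A f.
Proof.
move=> cf [|k]; first by apply: Ck0 => y _; exact: linear_differentiable.
apply/CkS; split=> [y _|v]; first exact: linear_differentiable.
rewrite (_ : 'D_v f = cst (f v)); first exact: Ck_cst.
apply/funext => y; rewrite deriveE ?diff_lin//.
exact: linear_differentiable.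
Qed.

(** Induction on the order: the derivative of 1/f is a product of 1/f, 1/f and a derivative of f, so
    one order of regularity of 1/f gives the next. *)
Lemma smooth_onV (f : V -> R) : (forall z, A z -> f z != 0) ->
  smooth_on A f -> smooth_on A (fun z => (f z)^-1).
Proof.
move=> f0 sf k; elim: k => [|k IH].
  by apply: Ck0 => y Ay; apply: differentiableV; [exact: smooth_on_diff sf Ay|exact: f0].
apply/CkS; split=> [y Ay|v].
  by apply: differentiableV; [exact: smooth_on_diff sf Ay|exact: f0].
apply: (Ck_eq oA (f := fun z => (- (f z)^-1) * ((f z)^-1 * 'D_v f z))).
  move=> z Az; rewrite deriveV; [|exact: f0|exact: smooth_on_derivable sf Az].
  by rewrite /GRing.scale /= mulNr mulrA -expr2 exprVn mulNr.
have IHN : Ck k A (fun z => - (f z)^-1).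
  apply: (Ck_eq oA (f := fun z => (-1) * (f z)^-1)); first by move=> z _; rewrite mulN1r.
  by apply: (CkZ oA _ IH); exact: Ck_cst.
apply: (CkZ oA IHN); apply: (CkZ oA IH).
exact: smooth_on_derive.
Qed.

Lemma smooth_on_comp W n (B : set 'rV[R]_n) (f : 'rV[R]_n -> W) (g : V -> 'rV[R]_n) :
  (forall y, A y -> B (g y)) -> smooth_on A g -> smooth_on B f ->
  smooth_on A (fun z => f (g z)).
Proof. by move=> AB sg sf k; exact: Ck_comp AB (sg k) (sf k). Qed.

Section Rules.
Variables (v y : V).
Hypothesis Ay : A y.

Lemma deriveD_on W (f g : V -> W) : smooth_on A f -> smooth_on A g ->
  'D_v (fun z => f z + g z) y = 'D_v f y + 'D_v g y.
Proof.
move=> sf sg; apply: (@deriveD _ _ _ f g);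
  [exact: smooth_on_derivable sf Ay|exact: smooth_on_derivable sg Ay].
Qed.

Lemma deriveB_on W (f g : V -> W) : smooth_on A f -> smooth_on A g ->
  'D_v (fun z => f z - g z) y = 'D_v f y - 'D_v g y.
Proof.
move=> sf sg; apply: (@deriveB _ _ _ f g);
  [exact: smooth_on_derivable sf Ay|exact: smooth_on_derivable sg Ay].
Qed.

Lemma deriveN_on W (f : V -> W) : smooth_on A f ->
  'D_v (fun z => - f z) y = - 'D_v f y.
Proof. by move=> sf; apply: (@deriveN _ _ _ f); exact: smooth_on_derivable sf Ay. Qed.

Lemma deriveZ_on W (c : V -> R) (f : V -> W) : smooth_on A c -> smooth_on A f ->
  'D_v (fun z => c z *: f z) y = 'D_v c y *: f y + c y *: 'D_v f y.
Proof.
by move=> sc sf; apply: derive_scale; [exact: smooth_on_diff sc Ay|exact: smooth_on_diff sf Ay].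
Qed.

Lemma deriveM_on (f g : V -> R) : smooth_on A f -> smooth_on A g ->
  'D_v (fun z => f z * g z) y = 'D_v f y * g y + f y * 'D_v g y.
Proof. by move=> sf sg; exact: (deriveZ_on sf sg). Qed.

Lemma derive_coord_on n (f : V -> 'rV[R]_n) j : smooth_on A f ->
  'D_v (fun z => f z 0 j) y = 'D_v f y 0 j.
Proof.
by move=> sf; rewrite derive_mx ?mxE//; exact: smooth_on_derivable sf Ay.
Qed.

Lemma derive_comp_on W n (B : set 'rV[R]_n) (f : 'rV[R]_n -> W) (g : V -> 'rV[R]_n) :
  smooth_on A g -> smooth_on B f -> B (g y) ->
  'D_v (fun z => f (g z)) y = 'D_('D_v g y) f (g y).
Proof.
move=> sg sf Bgy; have dg := smooth_on_diff sg Ay.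
have df : differentiable f (g y) by exact: Ck_diff (sf 0%N) _ Bgy.
rewrite [LHS]deriveE; last exact: (differentiable_comp dg df).
by rewrite (diff_comp dg df) /= -!deriveE.
Qed.

End Rules.
End OnOpen.

Lemma deriveDdir V W (f : V -> W) v w y : differentiable f y ->
  'D_(v + w) f y = 'D_v f y + 'D_w f y.
Proof. by move=> df; rewrite !deriveE// linearD. Qed.

Lemma deriveZdir V W (f : V -> W) (c : R) v y : differentiable f y ->
  'D_(c *: v) f y = c *: 'D_v f y.
Proof. by move=> df; rewrite !deriveE// linearZ. Qed.

End SmoothOn.

(** * Symmetry of second derivatives *)

Section Schwarz.
Context {R : realType}.
Implicit Types V W : normedModType R.

Lemma differentiable_eps V W (g : V -> W) y (e : R) : differentiable g y -> 0 < e ->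
  exists2 r, 0 < r & forall k, `|k| < r -> `|g (y + k) - g y - 'D_k g y| <= e * `|k|.
Proof.
move=> dg e0; have /diff_locallyP[_ E] := dg.
have /eqaddoP/(_ e e0) : g \o shift y = cst (g y) + 'd g y +o_ 0 id by exact: E.
move=> /nbhs_norm0P[r /= r0 H]; exists r => // k kr.
rewrite deriveE//; have := H k kr.
by rewrite !fctE /= opprD addrA (addrC k).
Qed.

Lemma is_derive_line V W (f : V -> W) a v (s : R) : derivable f (a + s *: v) v ->
  is_derive s 1 (fun s => f (a + s *: v)) ('D_v f (a + s *: v)).
Proof.
have E : (fun h : R => h^-1 *: (((fun s => f (a + s *: v)) \o shift s) (h *: 1) - f (a + s *: v)))
    = (fun h => h^-1 *: ((f \o shift (a + s *: v)) (h *: v) - f (a + s *: v))).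
  by apply/funext => h /=; rewrite [h *: 1]mulr1 scalerDl addrCA.
move=> d; split; first by rewrite /derivable E.
by rewrite /derive E.
Qed.

(* The two difference quotients coincide. *)
Lemma derive_slice n (W : normedModType R) (Y : 'rV[R]_(n + 1) -> W) (t : R) v u :
  'D_v (fun u : 'rV[R]_n => Y (row_mx u t%:M)) u = 'D_(row_mx v 0) Y (row_mx u t%:M).
Proof.
have E : (fun h : R => h^-1 *: (((fun u : 'rV[R]_n => Y (row_mx u t%:M)) \o shift u) (h *: v)
      - Y (row_mx u t%:M))) =
    (fun h => h^-1 *: ((Y \o shift (row_mx u t%:M)) (h *: row_mx v 0) - Y (row_mx u t%:M))).
  by apply/funext => h /=; rewrite scale_row_mx scaler0 add_row_mx add0r.
by rewrite /derive E.
Qed.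

Section Half.
Variables (V : normedModType R) (A : set V) (f : V -> R) (y v w : V).
Hypotheses (oA : open A) (Ay : A y) (sf : smooth_on A f).

(** The mean value theorem in the direction v reduces the second difference to an increment of
    ['D_v f], which is then expanded to first order at y. Differentiability of ['D_v f] at y is what
    bounds the error. *)
Lemma second_difference : (fun h : R =>
    h ^- 2 * (f (y + h *: v + h *: w) - f (y + h *: v) - f (y + h *: w) + f y))
  @ 0^'+ --> 'D_w ('D_v f) y.
Proof.
set g := 'D_v f; have sg : smooth_on A g by exact: smooth_on_derive.
pose C := `|v| + `|w| + 1.
have C0 : 0 < C by rewrite /C ltr_wpDl// addr_ge0.
have [ro ro0 roA] : exists2 ro, 0 < ro & forall k, `|k| < ro -> A (y + k).
  have /nbhs_normP[ro /= ro0 H] := open_nbhs_nbhs (conj oA Ay).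
  exists ro => // k kr; apply: H => /=.
  by rewrite opprD addrA subrr add0r normrN.
apply/cvgrPdist_le => e e0.
(* Two increments of norm at most [h * C] are expanded, so with this constant the two errors add up
   to [h * e]. *)
have eC0 : 0 < e / (C + C) by rewrite divr_gt0// addr_gt0.
have [r r0 H] := differentiable_eps (smooth_on_diff sg Ay) eC0.
near=> h.
have h0 : 0 < h by [].
have hr : h * C < Num.min r ro.
  rewrite -ltr_pdivlMr//; near: h; apply: nbhs_right_lt.
  by rewrite divr_gt0// lt_min r0.
have bnd (s t : R) : 0 <= s <= h -> 0 <= t <= h -> `|s *: v + t *: w| <= h * C.
  move=> /andP[s0 sh] /andP[t0 th]; rewrite (le_trans (ler_normD _ _))//.
  rewrite !normrZ !ger0_norm// (@le_trans _ _ (h * `|v| + h * `|w|))//.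
    by apply: lerD; exact: ler_wpM2r.
  by rewrite -mulrDr ler_wpM2l ?ltW// /C ltrDl.
have inA s t : 0 <= s <= h -> 0 <= t <= h -> A (y + (s *: v + t *: w)).
  move=> s0 t0; apply: roA; apply: le_lt_trans (bnd _ _ s0 t0) _.
  by move: hr; rewrite lt_min => /andP[].
have dlin s t : 0 <= s <= h -> 0 <= t <= h ->
    is_derive s 1 (fun s => f ((y + t *: w) + s *: v)) (g (y + t *: w + s *: v)).
  move=> s0 t0; apply: is_derive_line; apply: diff_derivable.
  apply: smooth_on_diff sf _; rewrite -addrA [_ + s *: v]addrC; exact: inA.
have h00 : 0 <= h <= h by rewrite lexx ltW.
have z00 : 0 <= (0 : R) <= h by rewrite lexx ltW.
have dk s : 0 <= s <= h -> is_derive s 1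
    (fun s => f ((y + h *: w) + s *: v) - f ((y + 0 *: w) + s *: v))
    (g (y + h *: w + s *: v) - g (y + 0 *: w + s *: v)).
  by move=> s0; apply: is_deriveB; exact: dlin.
have [||s] := MVT h0 (f := fun s => f ((y + h *: w) + s *: v) - f ((y + 0 *: w) + s *: v))
    (df := fun s => g (y + h *: w + s *: v) - g (y + 0 *: w + s *: v)).
- by move=> s; rewrite in_itv/= => /andP[s0 sh]; apply: dk; rewrite !ltW.
- apply: derivable_within_continuous => s.
  by rewrite in_itv/= => /dk[].
rewrite in_itv/= => /andP[s0 sh] E.
have sI : 0 <= s <= h by rewrite !ltW.
rewrite subr0 in E.
have -> : f (y + h *: v + h *: w) - f (y + h *: v) - f (y + h *: w) + f y =
    (g (y + (s *: v + h *: w)) - g (y + s *: v)) * h.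
  rewrite !scale0r !addr0 in E.
  by rewrite [s *: v + h *: w]addrC addrA [y + h *: v + _]addrAC -E; ring.
have norm_lt (k : V) : `|k| <= h * C -> `|k| < r.
  by move=> kh; apply: le_lt_trans kh _; move: hr; rewrite lt_min => /andP[].
have b1 := bnd _ _ sI h00; have b2 := bnd _ _ sI z00.
rewrite scale0r addr0 in b2.
have H1 := H _ (norm_lt _ b1); have H2 := H _ (norm_lt _ b2).
have dgy := smooth_on_diff sg Ay.
have DE : 'D_(s *: v + h *: w) g y = 'D_(s *: v) g y + h * 'D_w g y.
  by rewrite deriveDdir// (deriveZdir h).
set a := g (y + (s *: v + h *: w)) in H1 *; set b := g (y + s *: v) in H2 *.
rewrite DE in H1.
have h2 : h != 0 by rewrite gt_eqF.
have -> : 'D_w g y - h ^- 2 * ((a - b) * h) = h^-1 *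
   ((b - g y - 'D_(s *: v) g y) - (a - g y - ('D_(s *: v) g y + h * 'D_w g y))).
  by move: ('D_(s *: v) g y) ('D_w g y) (g y) => ? ? ?; field.
rewrite normrM gtr0_norm ?invr_gt0// ler_pdivrMl//.
apply: (le_trans (ler_normB _ _)); apply: (le_trans (lerD H2 H1)).
rewrite -mulrDr; have -> : h * e = e / (C + C) * (h * C + h * C).
  by field; rewrite -mulr2n mulrn_eq0 /= gt_eqF.
by apply: ler_wpM2l; [exact: ltW|exact: lerD].
Unshelve. all: by end_near. Qed.

End Half.

(** The second difference is symmetric in v and w, so both mixed derivatives are its limit. *)
Lemma derive_sym V (A : set V) (f : V -> R) y v w : open A -> A y -> smooth_on A f ->
  'D_v ('D_w f) y = 'D_w ('D_v f) y.
Proof.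
move=> oA Ay sf; have H1 := second_difference (v := v) (w := w) oA Ay sf.
have H2 := second_difference (v := w) (w := v) oA Ay sf.
rewrite (_ : (fun h : R => _) = (fun h : R => h ^- 2 *
  (f (y + h *: w + h *: v) - f (y + h *: w) - f (y + h *: v) + f y))) in H1; last first.
  apply/funext => h; rewrite [y + h *: v + h *: w]addrAC; congr (_ * _).
  by rewrite [X in X + f y]addrAC.
exact: cvg_unique H2 H1.
Qed.

End Schwarz.

(** * Implicit functions *)

Section Implicit.
Context {R : realType}.
Implicit Types V W : normedModType R.

Lemma is_derive_eps (psi : R -> R) a l :
  (forall e, 0 < e -> \forall h \near (0 : R), `|psi (a + h) - psi a - l * h| <= e * `|h|) ->
  is_derive a 1 psi l.
Proof.
move=> H.
have E : h^-1 *: ((psi \o shift a) (h *: 1) - psi a) @[h --> (0 : R)^'] --> l.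
  apply/cvgrPdist_le => e e0; near=> h.
  have h0 : h != 0 by near: h; exact: nbhs_dnbhs_neq.
  rewrite /= [h *: 1]mulr1 addrC [h + a]addrC.
  have -> : - (h^-1 *: (psi (a + h) - psi a)) + l =
     - (h^-1 * (psi (a + h) - psi a - l * h)).
    by rewrite /GRing.scale /=; field.
  rewrite normrN normrM normfV mulrC ler_pdivrMr ?normr_gt0//.
  by near: h; apply: nbhs_dnbhs; exact: H.
split; first by apply/cvg_ex; exists l.
exact/cvg_lim.
Unshelve. all: by end_near. Qed.

(** No continuity of psi is assumed: growth of F at rate at least m along e2 bounds the increment of
    psi by that of F along e1, hence by a multiple of h. The first order expansion of F at y can
    then be solved for the increment of psi. *)
Lemma is_derive_implicit V (F : V -> R) y e1 e2 (psi : R -> R) a m :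
  differentiable F y -> F y = 0 -> 0 < m -> 'D_e2 F y != 0 ->
  (\forall h \near (0 : R), m * `|psi (a + h) - psi a| <= `|F (y + h *: e1)|) ->
  (\forall h \near (0 : R), F (y + h *: e1 + (psi (a + h) - psi a) *: e2) = 0) ->
  is_derive a 1 psi (- ('D_e1 F y / 'D_e2 F y)).
Proof.
move=> dF Fy m0 D2 Hm HF.
have small V' (v : V') r : 0 < r -> \forall h \near (0 : R), `|h *: v| < r.
  move=> r0; have : h *: v @[h --> (0 : R)] --> (0 : R) *: v.
    by apply: cvgZr_tmp; exact: cvg_id.
  by rewrite scale0r => /cvgr0Pnorm_lt; exact.
(* Lipschitz constant of psi at a, from the expansion of F along e1 with error constant 1. *)
pose B := (`|'D_e1 F y| + `|e1|) / m.
have B0 : 0 <= B by apply: divr_ge0; [exact: addr_ge0|exact: ltW].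
have lip : \forall h \near (0 : R), `|psi (a + h) - psi a| <= B * `|h|.
  have [r r0 H] := differentiable_eps dF ltr01.
  near=> h.
  have hr : `|h *: e1| < r by near: h; exact: small.
  have := H _ hr; rewrite Fy subr0 mul1r deriveZdir// => H'.
  rewrite /B mulrAC ler_pdivlMr// mulrC.
  apply: (@le_trans _ _ `|F (y + h *: e1)|); first by near: h; exact: Hm.
  rewrite -[F _](subrK (h *: 'D_e1 F y)) (le_trans (ler_normD _ _))// addrC mulrDl.
  apply: lerD; first by rewrite normrZ mulrC.
  by apply: (le_trans H'); rewrite normrZ mulrC.
apply: is_derive_eps => e e0.
pose C := `|e1| + B * `|e2| + 1.
have C0 : 0 < C by rewrite /C ltr_wpDl// addr_ge0// mulr_ge0.
(* The remainder is at most e' times a displacement of norm at most [C * |h|], and is finally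
   divided by ['D_e2 F y]. *)
pose e' := e * `|'D_e2 F y| / C.
have e'0 : 0 < e' by rewrite divr_gt0// mulr_gt0// normr_gt0.
have [r r0 H] := differentiable_eps dF e'0.
near=> h.
have lh : `|psi (a + h) - psi a| <= B * `|h| by near: h.
set k := h *: e1 + (psi (a + h) - psi a) *: e2.
have kC : `|k| <= C * `|h|.
  apply: (le_trans (ler_normD _ _)); rewrite !normrZ /C !mulrDl mul1r.
  rewrite -[leLHS]addr0; apply: lerD => //; apply: lerD; first by rewrite mulrC.
  by rewrite mulrAC ler_wpM2r.
have kr : `|k| < r.
  apply: le_lt_trans kC _; rewrite mulrC -ltr_pdivlMr//.
  rewrite -[h]mulr1; near: h; apply: (small R); exact: divr_gt0.
have := H _ kr.
have -> : F (y + k) = 0 by rewrite /k addrA; near: h.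
rewrite Fy subr0 sub0r deriveDdir// !deriveZdir// => H'.
set p := psi (a + h) - psi a in k kC kr H' lh *.
have -> : p - - ('D_e1 F y / 'D_e2 F y) * h =
    - (- (h *: 'D_e1 F y + p *: 'D_e2 F y)) / 'D_e2 F y.
  by rewrite /GRing.scale /=; move: ('D_e1 F y) ('D_e2 F y) D2 => u v v0; field.
rewrite normrM normfV normrN ler_pdivrMr ?normr_gt0//.
apply: (le_trans H'); apply: (le_trans (ler_wpM2l (ltW e'0) kC)).
by rewrite /e' mulrA divfK ?gt_eqF// mulrAC.
Unshelve. all: by end_near. Qed.

End Implicit.

Section ImplicitBox.
Context {R : realType}.
Variables (V : normedModType R) (N : set V) (F : V -> R) (e1 e2 e3 : V).
Hypotheses (oN : open N) (N0 : N 0) (sF : smooth_on N F).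

(** Abscissa s, ordinate w to be solved for, parameter t. The three directions need be neither
    independent nor a basis, so e3 = 0 is a legitimate choice for a curve without parameter. *)
Definition pt (s w t : R) : V := s *: e1 + w *: e2 + t *: e3.

Lemma pt0 : pt 0 0 0 = 0.
Proof. by rewrite /pt !scale0r !addr0. Qed.

Lemma ptD s w t s' w' t' : pt (s + s') (w + w') (t + t') = pt s w t + pt s' w' t'.
Proof. by rewrite /pt !scalerDl (addrACA (s *: e1)) (addrACA (s *: e1 + _)). Qed.

Lemma pt1 h : pt h 0 0 = h *: e1.
Proof. by rewrite /pt !scale0r !addr0. Qed.

Lemma pt2 h : pt 0 h 0 = h *: e2.
Proof. by rewrite /pt !scale0r add0r addr0. Qed.

Lemma pt3 h : pt 0 0 h = h *: e3.
Proof. by rewrite /pt !scale0r !add0r. Qed.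

Lemma near_pt (P : set V) s w t : nbhs (pt s w t) P ->
  exists2 r, 0 < r & forall s' w' t', `|s' - s| < r -> `|w' - w| < r -> `|t' - t| < r ->
    P (pt s' w' t').
Proof.
move=> /nbhs_normP[d /= d0 H].
pose C := `|e1| + `|e2| + `|e3| + 1.
have C0 : 0 < C by rewrite /C ltr_wpDl// !addr_ge0.
exists (d / C); first exact: divr_gt0.
move=> s' w' t' hs hw ht; apply: H => /=.
rewrite distrC -[s'](subrK s) -[w'](subrK w) -[t'](subrK t) ptD addrK /pt.
set r := d / C in hs hw ht.
have -> : d = r * C by rewrite /r divfK// gt_eqF.
have r0 : 0 < r by exact: divr_gt0.
apply: (@le_lt_trans _ _ (r * (`|e1| + `|e2| + `|e3|))).
  apply: (le_trans (ler_normD _ _)); rewrite [leRHS]mulrDr lerD//.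
    apply: (le_trans (ler_normD _ _)); rewrite [leRHS]mulrDr.
    by rewrite !normrZ; apply: lerD; apply: ler_wpM2r => //; exact: ltW.
  by rewrite !normrZ; apply: ler_wpM2r => //; exact: ltW.
by rewrite ltr_pM2l// /C ltrDl.
Qed.

(** F increases along e2 at rate at least m, half of its rate at 0, near the origin. Opposite signs
    at the two ends of a vertical segment give a zero, monotonicity makes it unique, and the same
    rate m feeds [is_derive_implicit]. One box serves all s and t. *)
Lemma implicit_box : F 0 = 0 -> 0 < 'D_e2 F 0 ->
  exists rho r, [/\ 0 < rho, 0 < r &
    (forall s w t, `|s| < r -> `|w| < rho -> `|t| < r ->
       N (pt s w t) /\ 0 < 'D_e2 F (pt s w t)) /\
    exists phi : R -> R -> R, forall s t, `|s| < r -> `|t| < r ->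
    let p := pt s (phi s t) t in
    [/\ `|phi s t| < rho, F p = 0,
        forall w, `|w| < rho -> F (pt s w t) = 0 -> w = phi s t,
        is_derive s 1 (phi ^~ t) (- ('D_e1 F p / 'D_e2 F p)) &
        is_derive t 1 (phi s) (- ('D_e3 F p / 'D_e2 F p))]].
Proof.
move=> F0 D0; pose m := 'D_e2 F 0 / 2.
have m0 : 0 < m by rewrite divr_gt0.
have [d d0 H] : exists2 r, 0 < r & forall s w t, `|s| < r -> `|w| < r -> `|t| < r ->
    N (pt s w t) /\ m < 'D_e2 F (pt s w t).
  have : nbhs (pt 0 0 0) [set p | N p /\ m < 'D_e2 F p].
    rewrite pt0; near=> p; split; near: p; first exact: open_nbhs_nbhs.
    have /cvgr_gt : {for 0, continuous ('D_e2 F)}.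
      by apply: smooth_on_cont N0 => //; exact: smooth_on_derive.
    by apply; rewrite /m; lra.
  move=> /near_pt[r r0 H]; exists r => // s w t; have := H s w t.
  by rewrite !subr0.
have HN (s w t : R) : `|s| < d -> `|w| < d -> `|t| < d -> N (pt s w t).
  by move=> h1 h2 h3; have [] := H s w t h1 h2 h3.
have HD (s w t : R) : `|s| < d -> `|w| < d -> `|t| < d -> m < 'D_e2 F (pt s w t).
  by move=> h1 h2 h3; have [] := H s w t h1 h2 h3.
have der (s t z : R) : `|s| < d -> `|t| < d -> `|z| < d ->
    is_derive z 1 (fun z => F (pt s z t)) ('D_e2 F (pt s z t)).
  move=> sd td zd.
  have ptE z' : pt s z' t = pt s 0 t + z' *: e2 by rewrite /pt scale0r addr0 addrAC.
  rewrite (_ : (fun z => F (pt s z t)) = (fun z => F (pt s 0 t + z *: e2))); last by apply/funext => z1; rewrite ptE.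
  have := HN s z t sd zd td; rewrite ptE => Np.
  by apply: is_derive_line; exact: smooth_on_derivable sF Np.
have grow (s t w w' : R) : `|s| < d -> `|t| < d -> `|w| < d -> `|w'| < d ->
    m * `|w' - w| <= `|F (pt s w' t) - F (pt s w t)| /\
    (w < w' -> F (pt s w t) < F (pt s w' t)).
  move=> sd td; wlog ww : w w' / w < w'.
    move=> W wd wd'; have [/W W'|ww0|->] : [\/ w < w', w' < w | w = w'] by case: ltgtP => ?; constructor.
      exact: W'.
      split; last by move=> /ltW; rewrite leNgt ww0.
      rewrite (distrC w') (distrC (F (pt s w' t))).
      by have [] := W _ _ ww0 wd' wd.
    by rewrite !subrr !normr0 mulr0 ltxx.
  move=> wd wd'.
  have inb z : z \in `[w, w'] -> `|z| < d.
    rewrite in_itv/= => /andP[h1 h2]; rewrite ltr_norml.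
    by move: wd wd'; rewrite !ltr_norml => /andP[? _] /andP[_ ?]; lra.
  have [||z] := MVT ww (f := fun z => F (pt s z t)) (df := fun z => 'D_e2 F (pt s z t)).
  - by move=> z /subset_itv_oo_cc/inb; exact: der.
  - by apply: derivable_within_continuous => z /inb zd; have [] := der _ _ _ sd td zd.
  move=> /subset_itv_oo_cc/inb zd E.
  have mz : m < 'D_e2 F (pt s z t) by exact: HD.
  have w0 : 0 < w' - w by rewrite subr_gt0.
  rewrite E; split; last first.
    by move=> _; rewrite -subr_gt0 E mulr_gt0// (lt_trans m0).
  rewrite normrM [`|'D_e2 F _|]gtr0_norm ?(lt_trans m0)//.
  by apply: ler_wpM2r => //; exact: ltW.
have growlt (s t w w' : R) : `|s| < d -> `|t| < d -> `|w| < d -> `|w'| < d ->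
    w < w' -> F (pt s w t) < F (pt s w' t).
  by move=> h1 h2 h3 h4; have [] := grow s t w w' h1 h2 h3 h4.
(* Strictly less than d, so that the end points rho and - rho lie where F is known to increase. *)
pose rho := d / 2.
have rho0 : 0 < rho by rewrite divr_gt0.
have rhod : rho < d by rewrite /rho; lra.
have nrho : `|rho| < d by rewrite gtr0_norm.
have nrhoN : `|- rho| < d by rewrite normrN.
have n0 : `|(0 : R)| < d by rewrite normr0.
have Fp : 0 < F (pt 0 rho 0).
  by rewrite -[X in X < _]F0 -[X in F X < _]pt0; apply: growlt.
have Fm : F (pt 0 (- rho) 0) < 0.
  by rewrite -[X in _ < X]F0 -[X in _ < F X]pt0; apply: growlt => //; rewrite oppr_lt0.
have Fc s w t : `|s| < d -> `|w| < d -> `|t| < d -> {for pt s w t, continuous F}.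
  by move=> ? ? ?; apply: smooth_on_cont sF _ => //; exact: HN.
have [rp rp0 Hp] := near_pt (cvgr_gt _ (Fc _ _ _ n0 nrho n0) _ Fp).
have [rm rm0 Hm] := near_pt (cvgr_lt _ (Fc _ _ _ n0 nrhoN n0) _ Fm).
(* Small enough for F to keep its signs at both ends rho and - rho. *)
pose r := Num.min d (Num.min rp rm).
have r0 : 0 < r by rewrite !lt_min d0 rp0.
exists rho, r; split=> //; split.
  move=> s w t; rewrite {1 2}/r !lt_min => /and3P[? ? ?] wr /and3P[? ? ?].
  have wd := lt_trans wr rhod.
  by have [? ?] := H s w t ltac:(done) wd ltac:(done); split=> //; exact: lt_trans m0 _.
(* Stated for every pair so that [choice] gives a total function; outside the box the witness is 0
   and nothing is claimed about it. *)
have ex (st : R * R) : exists w, `|st.1| < r -> `|st.2| < r ->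
    `|w| < rho /\ F (pt st.1 w st.2) = 0.
  case: st => s t /=; have [sr|] := ltP `|s| r; last by exists 0.
  have [tr|] := ltP `|t| r; last by exists 0.
  move: (sr) (tr); rewrite {1 2}/r !lt_min => /and3P[sd sp sm] /and3P[td tp tm].
  have up : 0 < F (pt s rho t) by apply: Hp; rewrite ?subr0// subrr normr0.
  have dn : F (pt s (- rho) t) < 0.
    by apply: Hm; rewrite ?subr0// opprK addNr normr0.
  have rr : - rho <= rho by apply: (@le_trans _ _ 0); rewrite ?oppr_le0 ltW.
  have [||w] := @IVT R (fun w => F (pt s w t)) (- rho) rho 0 rr.
  - apply: derivable_within_continuous => z; rewrite in_itv/= => /andP[z1 z2].
    have zd : `|z| < d.
      by rewrite ltr_norml (lt_le_trans _ z1) ?ltrN2// (le_lt_trans z2).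
    by have [] := der _ _ _ sd td zd.
  - by rewrite (min_idPl _) ?(max_idPr _) ?ltW// (lt_trans dn).
  rewrite in_itv/= => /andP[w1 w2] Fw; exists w => _ _; split=> //.
  rewrite ltr_norml !lt_neqAle w1 w2 !andbT; apply/andP; split; apply/eqP => E.
    by move: dn; rewrite E Fw ltxx.
  by move: up; rewrite -E Fw ltxx.
have [phi0 Hphi] := choice ex.
exists (fun s t => phi0 (s, t)) => s t sr tr /=.
have toD (z : R) : `|z| < r -> `|z| < d by rewrite lt_min => /andP[].
have sd := toD _ sr; have td := toD _ tr.
have [/= pr Fpr] := Hphi (s, t) sr tr.
have pd := lt_trans pr rhod.
have dp : differentiable F (pt s (phi0 (s, t)) t).
  by apply: smooth_on_diff sF _ => //; exact: HN.
have mp : 'D_e2 F (pt s (phi0 (s, t)) t) != 0.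
  by rewrite gt_eqF// (lt_trans m0)//; exact: HD.
have near_lt (z : R) : `|z| < r -> \forall h \near (0 : R), `|z + h| < r.
  move=> zr; near=> h; apply: le_lt_trans (ler_normD _ _) _; rewrite -ltrBrDl.
  by near: h; have := @nbhs0_lt _ R^o (r - `|z|); apply; rewrite subr_gt0.
split=> //.
- move=> w wr Fw; have wd := lt_trans wr rhod.
  have [+ _] := grow s t _ _ sd td pd wd; rewrite Fw Fpr subrr normr0.
  by rewrite pmulr_rle0// normr_le0 subr_eq0 => /eqP.
- apply: (is_derive_implicit dp Fpr m0 mp); near=> h.
    have sh : `|s + h| < r by near: h; exact: near_lt.
    have [/= q1 q2] := Hphi (s + h, t) sh tr.
    have [+ _] := grow _ _ _ _ (toD _ sh) td pd (lt_trans q1 rhod).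
    rewrite q2 sub0r normrN => /le_trans; apply.
    by rewrite -pt1 -ptD !addr0.
  have sh : `|s + h| < r by near: h; exact: near_lt.
  have [/= _ q2] := Hphi (s + h, t) sh tr.
  rewrite -[RHS]q2; congr F.
  by rewrite -pt1 -pt2 -!ptD !addr0 [_ + (_ - _)]addrC subrK.
- apply: (is_derive_implicit dp Fpr m0 mp); near=> h.
    have th : `|t + h| < r by near: h; exact: near_lt.
    have [/= q1 q2] := Hphi (s, t + h) sr th.
    have [+ _] := grow _ _ _ _ sd (toD _ th) pd (lt_trans q1 rhod).
    rewrite q2 sub0r normrN => /le_trans; apply.
    by rewrite -pt3 -ptD !addr0.
  have th : `|t + h| < r by near: h; exact: near_lt.
  have [/= _ q2] := Hphi (s, t + h) sr th.
  rewrite -[RHS]q2; congr F.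
  by rewrite -pt3 -pt2 -!ptD !addr0 [_ + (_ - _)]addrC subrK.
Unshelve. all: by end_near. Qed.

End ImplicitBox.

(** * Convex functions and the fold *)

Section StrictlyConvex.
Context {R : realType}.
Variables (u u1 u2 : R -> R) (r : R).
Hypotheses (du : forall s : R, `|s| < r -> is_derive s 1 u (u1 s))
  (du1 : forall s : R, `|s| < r -> is_derive s 1 u1 (u2 s))
  (u2_gt0 : forall s : R, `|s| < r -> 0 < u2 s).

Let norm_itv (a b s : R) : `|a| < r -> `|b| < r -> s \in `[a, b] -> `|s| < r.
Proof.
rewrite in_itv/= !ltr_norml => /andP[a1 a2] /andP[b1 b2] /andP[s1 s2].
by rewrite (lt_le_trans a1)//= (le_lt_trans s2).
Qed.

Let MVT_norm (f f1 : R -> R) a b : (forall s : R, `|s| < r -> is_derive s 1 f (f1 s)) ->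
  `|a| < r -> `|b| < r -> a < b ->
  exists s, [/\ a < s, s < b, `|s| < r & f b - f a = f1 s * (b - a)].
Proof.
move=> df ar br ab; have [||s] := MVT ab (f := f) (df := f1).
- by move=> s /subset_itv_oo_cc/(norm_itv ar br)/df.
- by apply: derivable_within_continuous => s /(norm_itv ar br)/df[].
move=> sI E; exists s; have sr := norm_itv ar br (subset_itv_oo_cc sI).
by move: sI; rewrite in_itv/= => /andP[].
Qed.

Lemma convex_derive_incr a b : `|a| < r -> `|b| < r -> a < b -> u1 a < u1 b.
Proof.
move=> ar br ab; have [s [_ _ sr E]] := MVT_norm du1 ar br ab.
by rewrite -subr_gt0 E mulr_gt0 ?subr_gt0//; exact: u2_gt0.
Qed.

(** The slope is nonnegative somewhere strictly between a and b, and slopes increase strictly. *)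
Lemma convex_right a b : `|a| < r -> `|b| < r -> a < b -> u a <= u b -> 0 < u1 b.
Proof.
move=> ar br ab uab; have [s [as_ sb sr E]] := MVT_norm du ar br ab.
apply: le_lt_trans (convex_derive_incr sr br sb).
have ba : 0 < b - a by rewrite subr_gt0.
by rewrite -(pmulr_lge0 _ ba) -E subr_ge0.
Qed.

Lemma convex_left a b : `|a| < r -> `|b| < r -> a < b -> u b <= u a -> u1 a < 0.
Proof.
move=> ar br ab uab; have [s [as_ sb sr E]] := MVT_norm du ar br ab.
apply: lt_le_trans (convex_derive_incr ar sr as_) _.
have ba : 0 < b - a by rewrite subr_gt0.
by rewrite -(pmulr_lle0 _ ba) -E subr_le0.
Qed.

Lemma convex_min s : `|s| < r -> u1 0 = 0 -> u 0 <= u s.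
Proof.
move=> sr u10; have r0 : `|(0 : R)| < r by rewrite normr0 (le_lt_trans _ sr).
rewrite leNgt; apply/negP => us.
have [s0|s0|s0] := ltgtP s 0; last by move: us; rewrite s0 ltxx.
- by have := convex_right sr r0 s0 (ltW us); rewrite u10 ltxx.
- by have := convex_left r0 sr s0 (ltW us); rewrite u10 ltxx.
Qed.

Lemma convex_min_lt s : `|s| < r -> u1 0 = 0 -> s != 0 -> u 0 < u s.
Proof.
move=> sr u10 s0; have r0 : `|(0 : R)| < r by rewrite normr0 (le_lt_trans _ sr).
rewrite lt_neqAle convex_min// andbT; apply/eqP => E.
have [s1|s1|s1] := ltgtP s 0; last by move: s0; rewrite s1 eqxx.
- by have := convex_right sr r0 s1; rewrite E lexx u10 ltxx => /(_ isT).
- by have := convex_left r0 sr s1; rewrite E lexx u10 ltxx => /(_ isT).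
Qed.

(** Existence is the intermediate value theorem on each side of 0. As u is negative at 0, zeros on
    the left have negative slope and those on the right positive slope; two zeros on the same side
    would give one of them a slope of the wrong sign. *)
Lemma convex_two_zeros c : 0 < c -> c < r -> u 0 < 0 -> 0 < u c -> 0 < u (- c) ->
  exists s1 s2, [/\ s1 < s2, `|s1| < c, `|s2| < c, u1 s1 != 0 /\ u1 s2 != 0 &
    forall s, `|s| < c -> u s = 0 <-> s = s1 \/ s = s2].
Proof.
move=> c0 cr u0 uc uNc.
have nc : `|c| < r by rewrite gtr0_norm.
have nNc : `|- c| < r by rewrite normrN.
have n0 : `|(0 : R)| < r by rewrite normr0 (lt_trans c0).
have cont a b : `|a| < r -> `|b| < r -> {within `[a, b], continuous u}.
  by move=> ar br; apply: derivable_within_continuous => s /(norm_itv ar br)/du[].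
have [|s2] := @IVT R u 0 c 0 (ltW c0) (cont _ _ n0 nc).
  by rewrite (min_idPl _) ?(max_idPr _) ?ltW// (lt_trans u0).
rewrite in_itv/= => /andP[s20 s2c] us2.
have {}s20 : 0 < s2.
  by rewrite lt_neqAle s20 andbT; apply/eqP => E; move: us2 u0; rewrite -E => ->; rewrite ltxx.
have {}s2c : s2 < c.
  by rewrite lt_neqAle s2c andbT; apply/eqP => E; move: uc; rewrite -E us2 ltxx.
have [||s1] := @IVT R u (- c) 0 0 _ (cont _ _ nNc n0).
- by rewrite oppr_le0 ltW.
- by rewrite (min_idPr _) ?(max_idPl _) ?ltW// (lt_trans u0).
rewrite in_itv/= => /andP[s1c s10] us1.
have {}s10 : s1 < 0.
  by rewrite lt_neqAle s10 andbT; apply/eqP => E; move: us1 u0; rewrite E => ->; rewrite ltxx.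
have {}s1c : - c < s1.
  by rewrite lt_neqAle s1c andbT; apply/eqP => E; move: uNc; rewrite E us1 ltxx.
have s1n : `|s1| < c by rewrite ltr_norml s1c (lt_trans s10).
have s2n : `|s2| < c by rewrite ltr_norml s2c (lt_trans _ s20)// oppr_lt0.
have pos s : `|s| < r -> 0 < s -> u s = 0 -> 0 < u1 s.
  by move=> sr s0 us; apply: (convex_right n0 sr s0); rewrite us ltW.
have neg s : `|s| < r -> s < 0 -> u s = 0 -> u1 s < 0.
  by move=> sr s0 us; apply: (convex_left sr n0 s0); rewrite us ltW.
have s1r := lt_trans s1n cr; have s2r := lt_trans s2n cr.
exists s1, s2; split=> //; first exact: lt_trans s20.
  by split; [rewrite lt_eqF// neg|rewrite gt_eqF// pos].
move=> s sc; have sr := lt_trans sc cr; split=> [us|[]->//].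
have [s0|s0|s0] := ltgtP s 0; last by move: us u0; rewrite s0 => ->; rewrite ltxx.
- left; have [ss|ss|//] := ltgtP s s1.
    have := convex_right sr s1r ss; rewrite us us1 lexx => /(_ isT).
    by rewrite ltNge ltW// neg.
  have := convex_right s1r sr ss; rewrite us us1 lexx => /(_ isT).
  by rewrite ltNge ltW// neg.
- right; have [ss|ss|//] := ltgtP s s2.
    have := convex_left sr s2r ss; rewrite us us2 lexx => /(_ isT).
    by rewrite ltNge ltW// pos.
  have := convex_left s2r sr ss; rewrite us us2 lexx => /(_ isT).
  by rewrite ltNge ltW// pos.
Qed.

End StrictlyConvex.

Section Curve.
Context {R : realType}.
Implicit Types V W : normedModType R.

Lemma is_derive_curve V (H : V -> R) (c : R -> V) (s : R) c' :
  is_derive s 1 c c' -> differentiable H (c s) ->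
  is_derive s 1 (fun s => H (c s)) ('D_c' H (c s)).
Proof.
move=> [dc <-] dH; have dc' : differentiable c s by exact/derivable1_diffP.
have dHc := differentiable_comp dc' dH.
split; first exact: diff_derivable.
by rewrite [LHS]deriveE// (diff_comp dc' dH) /= -!deriveE.
Qed.

(** Lets the chain rule in the first coordinate, [is_derive_pt], also serve for the time
    derivative. *)
Lemma ptC V (e1 e2 e3 : V) s w t : pt e1 e2 e3 s w t = pt e3 e2 e1 t w s.
Proof. by rewrite /pt [RHS]addrC [t *: e3 + w *: e2]addrC addrA. Qed.

Lemma is_derive_ptc V (e1 e2 e3 : V) (phi : R -> R) (s t d : R) :
  is_derive s 1 phi d ->
  is_derive s 1 (fun s => pt e1 e2 e3 s (phi s) t) (e1 + d *: e2).
Proof.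
move=> [dphi <-].
have dp' : differentiable phi s by exact/derivable1_diffP.
have d1 : differentiable (fun s : R => s *: e1) s.
  by apply: differentiable_scale => //; exact: differentiable_cst.
have d2 : differentiable (fun s : R => phi s *: e2) s.
  by apply: differentiable_scale => //; exact: differentiable_cst.
split.
  by apply: diff_derivable; apply: differentiableD; [exact: differentiableD|exact: differentiable_cst].
rewrite [LHS](@deriveD _ _ _ (fun s : R => s *: e1 + phi s *: e2) (cst (t *: e3))).
- rewrite derive_cst addr0 [LHS](@deriveD _ _ _ (fun s : R => s *: e1) (fun s : R => phi s *: e2)).
  + rewrite !derive_scale ?derive_cst ?scaler0 ?addr0 ?derive_id ?scale1r//;
    exact: differentiable_cst.
  + exact: diff_derivable.
  + exact: diff_derivable.
- by apply: diff_derivable; exact: differentiableD.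
- exact: derivable_cst.
Qed.

Lemma is_derive_pt V (H : V -> R) e1 e2 e3 (phi : R -> R) (s t d : R) :
  is_derive s 1 phi d -> differentiable H (pt e1 e2 e3 s (phi s) t) ->
  is_derive s 1 (fun s => H (pt e1 e2 e3 s (phi s) t))
    ('D_e1 H (pt e1 e2 e3 s (phi s) t) + d * 'D_e2 H (pt e1 e2 e3 s (phi s) t)).
Proof.
move=> dphi dH; apply: is_derive_eq (is_derive_curve (is_derive_ptc e1 e2 e3 t dphi) dH) _.
by rewrite deriveDdir// deriveZdir.
Qed.

End Curve.

Section Fold.
Context {R : realType}.
Variables (V : normedModType R) (N : set V) (F : V -> R) (e1 e2 e3 : V).
Hypotheses (oN : open N) (N0 : N 0) (sF : smooth_on N F)
  (D2F : forall p, N p -> 0 < 'D_e2 F p) (F0 : F 0 = 0) (D1F : 'D_e1 F 0 = 0).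
Local Notation pt := (pt e1 e2 e3).
Local Notation J G := (fun p => 'D_e1 F p * 'D_e2 G p - 'D_e2 F p * 'D_e1 G p).
Local Notation T G := ('D_e3 G 0 * 'D_e2 F 0 - 'D_e2 G 0 * 'D_e3 F 0).

(* J vanishes where the zero curves of F and G at time t are tangent, and T is
   the speed at which G grows on the zero set of F, up to a positive factor. *)
Definition fold_split (G : V -> R) (sgn : bool) := forall N', nbhs 0 N' ->
  exists rho r, [/\ 0 < rho, 0 < r &
    (forall s w t, `|s| < r -> `|w| < rho -> `|t| < r -> N' (pt s w t)) /\
    \forall t \near (0 : R),
      (0 < (-1) ^+ sgn * t -> exists s1 w1 s2 w2,
         [/\ s1 < s2, `|s1| < r /\ `|w1| < rho, `|s2| < r /\ `|w2| < rho,
           J G (pt s1 w1 t) != 0 /\ J G (pt s2 w2 t) != 0 &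
           forall s w, `|s| < r -> `|w| < rho ->
             F (pt s w t) = 0 /\ G (pt s w t) = 0 <->
             s = s1 /\ w = w1 \/ s = s2 /\ w = w2]) /\
      ((-1) ^+ sgn * t < 0 -> forall s w, `|s| < r -> `|w| < rho ->
         ~ (F (pt s w t) = 0 /\ G (pt s w t) = 0))].

(** Let g s t be G on the zero set of F, parametrized by [implicit_box]. The hypotheses make g
    strictly convex in s, with minimum 0 at s = 0 when t = 0, and strictly monotone in t. Lowering g
    creates two zeros, raising it removes them all. *)
Lemma fold_split_neg (G : V -> R) : smooth_on N G -> G 0 = 0 -> 'D_e1 G 0 = 0 ->
  'D_e1 (J G) 0 < 0 -> T G != 0 -> fold_split G (0 < T G).
Proof.
move=> sG G0 D1G D1J T0 N' nN'; set sgn := 0 < T G.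
have sD (f : V -> R) v : smooth_on N f -> smooth_on N ('D_v f) by exact: smooth_on_derive.
have D2F0 p : N p -> 'D_e2 F p != 0 by move=> /D2F; rewrite lt0r => /andP[].
have sJ : smooth_on N (J G).
  by apply: smooth_onB => //; apply: smooth_onM => //; exact: sD.
have sV : smooth_on N (fun p => ('D_e2 F p)^-1) by apply: smooth_onV => //; exact: sD.
(* [d F] is the slope in s of the zero set of F. Accordingly [H] and [S] below are the first and
   second s-derivatives of G along that set, and [Q] is its t-derivative. *)
pose d (f : V -> R) p := - ('D_e1 f p / 'D_e2 F p).
have sd : smooth_on N (d F) by apply: smooth_onN => //; apply: smooth_onM => //; exact: sD.
pose H p := 'D_e1 G p + d F p * 'D_e2 G p.
have sH : smooth_on N H.
  by apply: smooth_onD => //; [exact: sD|apply: smooth_onM => //; exact: sD].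
have HJ p : N p -> H p = - J G p * ('D_e2 F p)^-1.
  by move=> /D2F0 h; rewrite /H /d; field.
pose S p := 'D_e1 H p + d F p * 'D_e2 H p.
have sS : smooth_on N S.
  by apply: smooth_onD => //; [exact: sD|apply: smooth_onM => //; exact: sD].
pose Q p := 'D_e3 G p + - ('D_e3 F p / 'D_e2 F p) * 'D_e2 G p.
have sQ : smooth_on N Q.
  exact: (smooth_onD oN (sD _ e3 sG) (smooth_onM oN
    (smooth_onN oN (smooth_onM oN (sD _ e3 sF) sV)) (sD _ e2 sG))).
have S0 : 0 < S 0.
  rewrite /S /d D1F mul0r oppr0 mul0r addr0 (derive_eq_on oN e1 HJ)//.
  rewrite (deriveM_on _ N0)//; last exact: smooth_onN.
  rewrite (deriveN_on _ N0)// D1F D1G mul0r mulr0 subrr oppr0 mul0r addr0.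
  by rewrite mulr_gt0 ?oppr_gt0 ?invr_gt0 ?D2F.
(* With this choice of [sgn], G decreases along the zero set of F when t moves to the side where
   [(-1) ^+ sgn * t] is positive. *)
have Q0 : (-1) ^+ sgn * Q 0 < 0.
  have -> : Q 0 = T G * ('D_e2 F 0)^-1.
    by rewrite /Q; have := D2F0 _ N0; move=> h; field.
  rewrite mulrA pmulr_llt0 ?invr_gt0 ?D2F// /sgn.
  case: (ltP 0 (T G)) => h; first by rewrite expr1 mulN1r oppr_lt0.
  by rewrite expr0 mul1r lt_neqAle T0.
have : nbhs 0 [set p | [/\ N p, N' p, 0 < S p & (-1) ^+ sgn * Q p < 0]].
  near=> p; split; near: p => //; first exact: open_nbhs_nbhs.
    have /cvgr_gt : {for 0, continuous S} by exact: smooth_on_cont sS N0.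
    exact.
  have /cvgr_lt : {for 0, continuous (fun p => (-1) ^+ sgn * Q p)}.
    apply: smooth_on_cont N0 => //.
    by apply: smooth_onM => //; exact: smooth_on_cst.
  exact.
rewrite nbhsE => -[N1 [oN1 N10] N1P].
have N1N p : N1 p -> N p by move=> /N1P[].
have sF1 : smooth_on N1 F by apply: smooth_on_sub sF.
have [rho [r [rho0 r0 [inN [phi Hphi]]]]] :=
  implicit_box e1 e3 oN1 N10 sF1 F0 (D2F N0).
pose P s t := pt s (phi s t) t.
pose g s t := G (P s t).
have inP (s t : R) : `|s| < r -> `|t| < r ->
    [/\ N (P s t), N' (P s t), 0 < S (P s t) & (-1) ^+ sgn * Q (P s t) < 0].
  move=> sr tr; have [phr _ _ _ _] := Hphi _ _ sr tr.
  by apply: N1P; have [] := inN _ _ _ sr phr tr.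
have ds (f : V -> R) (s t : R) : smooth_on N f -> `|s| < r -> `|t| < r ->
    is_derive s 1 (fun s => f (P s t)) ('D_e1 f (P s t) + d F (P s t) * 'D_e2 f (P s t)).
  move=> sf sr tr; have [_ _ _ dphi _] := Hphi _ _ sr tr.
  apply: (is_derive_pt dphi); apply: smooth_on_diff sf _ => //.
  by have [] := inP s t sr tr.
have dg (s t : R) : `|s| < r -> `|t| < r -> is_derive s 1 (g ^~ t) (H (P s t)).
  by move=> sr tr; apply: ds.
have dH (s t : R) : `|s| < r -> `|t| < r -> is_derive s 1 (fun s => H (P s t)) (S (P s t)).
  by move=> sr tr; apply: ds.
have S_gt0 (s t : R) : `|s| < r -> `|t| < r -> 0 < S (P s t).
  by move=> sr tr; have [] := inP s t sr tr.
have dt (s t : R) : `|s| < r -> `|t| < r -> is_derive t 1 (g s) (Q (P s t)).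
  move=> sr tr; have [_ _ _ _ dphi] := Hphi _ _ sr tr.
  rewrite /g /P; under eq_fun do rewrite ptC.
  have dG : differentiable G (pt s (phi s t) t).
    by apply: smooth_on_diff sG _ => //; have [] := inP s t sr tr.
  rewrite ptC in dG; apply: is_derive_eq (is_derive_pt dphi dG) _.
  by rewrite -ptC.
(* The end points c and - c are interior to the first box: there g is positive at time 0, and
   remains so for small t. *)
pose c := r / 2.
have c0 : 0 < c by rewrite divr_gt0.
have cr : c < r by rewrite /c ltr_pdivrMr// ltr_pMr// ltr1n.
have nc : `|c| < r by rewrite gtr0_norm.
have nNc : `|- c| < r by rewrite normrN.
have n0 : `|(0 : R)| < r by rewrite normr0.
have toR (s : R) : `|s| < c -> `|s| < r by move=> /lt_trans; apply.
have phi00 : phi 0 0 = 0.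
  have [_ _ uq _ _] := Hphi 0 0 n0 n0.
  by apply/esym/uq; rewrite ?normr0// pt0.
have g00 : g 0 0 = 0 by rewrite /g /P phi00 pt0.
have H00 : H (P 0 0) = 0.
  by rewrite /P phi00 pt0 HJ// D1F D1G mulr0 mul0r subr0 oppr0 mul0r.
have g_gt s : `|s| < r -> s != 0 -> 0 < g s 0.
  move=> sr s0; rewrite -[X in X < _]g00.
  exact: (convex_min_lt (fun s sr => dg s 0 sr n0) (fun s sr => dH s 0 sr n0) (fun s sr => S_gt0 s 0 sr n0) sr H00 s0).
(* By the mean value theorem in t, this product is t^2 times the negative quantity [(-1) ^+ sgn * Q]
   at an intermediate time. *)
have mono (s t : R) : `|s| < r -> `|t| < r -> t != 0 ->
    (-1) ^+ sgn * t * (g s t - g s 0) < 0.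
  move=> sr tr t0.
  have [z zr ->] : exists2 z, `|z| < r & g s t - g s 0 = Q (P s z) * t.
    have inr (a b z : R) : `|a| < r -> `|b| < r -> z \in `[a, b] -> `|z| < r.
      rewrite in_itv/= !ltr_norml => /andP[a1 a2] /andP[b1 b2] /andP[z1 z2].
      by rewrite (lt_le_trans a1)//= (le_lt_trans z2).
    have cont (a b : R) : `|a| < r -> `|b| < r -> {within `[a, b], continuous (g s)}.
      by move=> ar br; apply: derivable_within_continuous => z /(inr _ _ _ ar br) zr; have [] := dt s z sr zr.
    have [tn|tp|E] := ltgtP t 0; last by rewrite E eqxx in t0.
      have [|z] := MVT tn (f := g s) (df := fun z => Q (P s z)) _ (cont _ _ tr n0).
        by move=> z /subset_itv_oo_cc/(inr _ _ _ tr n0) zr; exact: dt.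
      move=> /subset_itv_oo_cc/(inr _ _ _ tr n0) zr E; exists z => //.
      by rewrite -opprB E sub0r mulrN opprK.
    have [|z] := MVT tp (f := g s) (df := fun z => Q (P s z)) _ (cont _ _ n0 tr).
      by move=> z /subset_itv_oo_cc/(inr _ _ _ n0 tr) zr; exact: dt.
    move=> /subset_itv_oo_cc/(inr _ _ _ n0 tr) zr E; exists z => //.
    by rewrite E subr0.
  have [_ _ _ q] := inP s z sr zr.
  rewrite [Q _ * t]mulrC mulrA -[X in X * _]mulrA -expr2 mulrC mulrCA mulrA.
  by rewrite [X in X < _]mulrC pmulr_rlt0// exprn_even_gt0.
have ginP s w t : `|s| < c -> `|w| < rho -> `|t| < r ->
    F (pt s w t) = 0 /\ G (pt s w t) = 0 <-> w = phi s t /\ g s t = 0.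
  move=> sc wr tr; have [_ Fphi uq _ _] := Hphi _ _ (toR _ sc) tr.
  split=> [[Fp Gp]|[-> gst]]; last by split.
  by have E := uq _ wr Fp; rewrite /g /P -E.
exists rho, c; split=> //; split.
  move=> s w t sc wr tc; have [+ _] := inN _ _ _ (toR _ sc) wr (toR _ tc).
  by move=> /N1P[].
have near_gt s : `|s| < r -> s != 0 -> \forall t \near (0 : R), 0 < g s t.
  move=> sr s0; have gc : {for 0, continuous (g s)}.
    by apply/differentiable_continuous/derivable1_diffP; have [] := dt s 0 sr n0.
  exact: cvgr_gt gc _ (g_gt _ sr s0).
near=> t.
have tr : `|t| < r by near: t; apply: (@nbhs0_lt _ R^o).
split=> [t0|t0].
- have tn0 : t != 0 by apply/eqP => E; move: t0; rewrite E mulr0 ltxx.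
  have gc : 0 < g c t by near: t; apply: near_gt => //; rewrite gt_eqF.
  have gNc : 0 < g (- c) t by near: t; apply: near_gt => //; rewrite oppr_eq0 gt_eqF.
  have g0 : g 0 t < 0.
    by have := mono 0 t n0 tr tn0; rewrite g00 subr0 pmulr_rlt0.
  have [s1 [s2 [s12 s1c s2c [h1 h2] zeros]]] :=
    convex_two_zeros (fun s sr => dg s t sr tr) (fun s sr => dH s t sr tr)
      (fun s sr => S_gt0 s t sr tr) c0 cr g0 gc gNc.
  have phir s : `|s| < c -> `|phi s t| < rho.
    by move=> /toR sr; have [] := Hphi _ _ sr tr.
  have JP s : `|s| < c -> H (P s t) != 0 -> J G (P s t) != 0.
    move=> /toR sr; have [Np _ _ _] := inP s t sr tr.
    by rewrite HJ// => h; apply: contra_neq h => ->; rewrite oppr0 mul0r.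
  exists s1, (phi s1 t), s2, (phi s2 t); split=> //.
  - by split=> //; exact: phir.
  - by split=> //; exact: phir.
  - by split; exact: JP.
  move=> s w sc wr; rewrite (ginP _ _ _ sc wr tr) (zeros _ sc).
  by split=> [[-> [->|->]]|[[-> ->]|[-> ->]]]; [left|right|split=> //; left|split=> //; right].
move=> s w sc wr; rewrite (ginP _ _ _ sc wr tr) => -[_ gst].
have tn0 : t != 0 by apply/eqP => E; move: t0; rewrite E mulr0 ltxx.
have := mono s t (toR _ sc) tr tn0; rewrite gst sub0r mulrN oppr_lt0.
have g0 : 0 <= g s 0.
  rewrite -[X in X <= _]g00; exact: (convex_min (fun s sr => dg s 0 sr n0) (fun s sr => dH s 0 sr n0) (fun s sr => S_gt0 s 0 sr n0) (toR _ sc) H00).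
by rewrite ltNge nmulr_rle0// g0.
Unshelve. all: by end_near. Qed.

(** Replacing G by - G keeps the zero set and reverses the signs of J and T, so the concave case
    follows from the convex one. *)
Lemma fold_splitP (G : V -> R) : smooth_on N G -> G 0 = 0 -> 'D_e1 G 0 = 0 ->
  'D_e1 (J G) 0 != 0 -> T G != 0 -> exists sgn, fold_split G sgn.
Proof.
move=> sG G0 D1G; rewrite neq_lt => /orP[D1J|D1J] T0.
  by exists (0 < T G); exact: fold_split_neg.
pose G' p := - G p.
have DG v p : N p -> 'D_v G' p = - 'D_v G p by move=> Np; exact: (deriveN_on v Np).
have JG p : N p -> J G' p = - J G p by move=> Np; rewrite !DG//; ring.
have sJ : smooth_on N (J G).
  by apply: smooth_onB => //; apply: smooth_onM => //; exact: smooth_on_derive.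
have split' : fold_split G' (0 < T G').
  apply: fold_split_neg; rewrite ?DG//.
  - exact: smooth_onN.
  - by rewrite /G' G0 oppr0.
  - by rewrite D1G oppr0.
  - by rewrite (derive_eq_on oN e1 JG)// (deriveN_on _ N0)// oppr_lt0.
  - by rewrite (_ : _ - _ = - T G) ?oppr_eq0//; ring.
exists (0 < T G') => N' nN'.
(* The box is required to lie in N too, because J changes sign with G only at points of N. *)
have [rho [r [rho0 r0 [inN H]]]] : exists rho r, _ :=
  split' (N `&` N') (filterI (open_nbhs_nbhs (conj oN N0)) nN').
exists rho, r; split=> //; split; first by move=> s w t h1 h2 h3; have [] := inN s w t h1 h2 h3.
move: H (@nbhs0_lt _ R^o r r0); apply: filterS2 => t [pos neg] tr.
have G'0 p : G' p = 0 <-> G p = 0.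
  by rewrite /G'; split=> [/eqP|->]; rewrite ?oppr0// oppr_eq0 => /eqP.
split=> [/pos|/neg] K.
  have [s1 [w1 [s2 [w2 [s12 [s1r w1r] [s2r w2r] [J1 J2] Z]]]]] := K.
  exists s1, w1, s2, w2; split=> //.
    split; rewrite -oppr_eq0 -JG//.
      by have [] := inN _ _ _ s1r w1r tr.
    by have [] := inN _ _ _ s2r w2r tr.
  by move=> s w sr wr; rewrite -Z// G'0.
by move=> s w sr wr [Fp Gp]; apply: (K s w sr wr); split=> //; apply/G'0.
Qed.

End Fold.
(** * Brackets, zero curves and contact *)

Section PlaneBracket.
Context {R : realType}.
Local Notation plane := 'rV[R]_2.
Implicit Types f g h : plane -> R.

Lemma plane_eta (v : plane) : v = v 0 0 *: eu + v 0 1 *: ev.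
Proof.
rewrite {1}(row_sum_delta v) big_ord_recl big_ord1.
by congr (_ + v 0 _ *: delta_mx 0 _); apply/val_inj.
Qed.

Lemma eu0 : (eu : plane) 0 0 = 1. Proof. by rewrite mxE. Qed.
Lemma eu1 : (eu : plane) 0 1 = 0. Proof. by rewrite mxE. Qed.
Lemma ev0 : (ev : plane) 0 0 = 0. Proof. by rewrite mxE. Qed.
Lemma ev1 : (ev : plane) 0 1 = 1. Proof. by rewrite mxE. Qed.

Lemma derive_plane (W : normedModType R) (f : plane -> W) v q : differentiable f q ->
  'D_v f q = v 0 0 *: 'D_eu f q + v 0 1 *: 'D_ev f q.
Proof. by move=> df; rewrite {1}(plane_eta v) deriveDdir// !deriveZdir. Qed.

Definition bracket f g (q : plane) : R :=
  'D_eu f q * 'D_ev g q - 'D_ev f q * 'D_eu g q.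

Lemma smooth_on_bracket (A : set plane) f g : open A ->
  smooth_on A f -> smooth_on A g -> smooth_on A (bracket f g).
Proof.
move=> oA sf sg; apply: smooth_onB => //; apply: smooth_onM => //;
  exact: smooth_on_derive.
Qed.

Lemma regular_atP f q : differentiable f q ->
  regular_at f q <-> 'D_eu f q != 0 \/ 'D_ev f q != 0.
Proof.
move=> df; split=> [[v]|[h|h]]; last 2 first.
- by exists eu; rewrite -deriveE.
- by exists ev; rewrite -deriveE.
rewrite -deriveE// derive_plane// => h.
have [E|?] := eqVneq ('D_eu f q) 0; last by left.
by right; apply: contra_neq h => E'; rewrite E E' !scaler0 addr0.
Qed.

(** Gradient and rotated gradient frozen at the origin: constant directions, along which one can
    differentiate repeatedly. At the origin, differentiating h along [tang f] gives
    [bracket f h 0]. *)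
Definition grad f : plane := 'D_eu f 0 *: eu + 'D_ev f 0 *: ev.
Definition tang f : plane := - 'D_ev f 0 *: eu + 'D_eu f 0 *: ev.

Lemma grad_dir f h q : differentiable h q ->
  'D_(grad f) h q = 'D_eu f 0 * 'D_eu h q + 'D_ev f 0 * 'D_ev h q.
Proof. by move=> dh; rewrite deriveDdir// !deriveZdir. Qed.

Lemma tang_dir f h q : differentiable h q ->
  'D_(tang f) h q = 'D_eu f 0 * 'D_ev h q - 'D_ev f 0 * 'D_eu h q.
Proof. by move=> dh; rewrite deriveDdir// !deriveZdir// addrC /GRing.scale /= mulNr. Qed.

Lemma grad_gt0 f : differentiable f 0 -> regular_at f 0 -> 0 < 'D_(grad f) f 0.
Proof.
move=> df /(regular_atP df) h; rewrite grad_dir//.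
move: ('D_eu f 0) ('D_ev f 0) h => a b h; rewrite -!expr2 lt_neqAle addr_ge0 ?sqr_ge0// andbT.
rewrite eq_sym paddr_eq0 ?sqr_ge0// !sqrf_eq0 negb_and.
by case: h => ->; rewrite ?orbT.
Qed.

(** The curve is a graph over the tangent line, from [implicit_box] with e3 = 0. It satisfies gam' =
    X(gam) with X smooth, which raises its regularity by one order at a time. Its velocity at 0 is
    [tang f], nonzero by regularity. *)
Lemma zero_curve (N : set plane) f : open N -> N 0 -> smooth_on N f -> f 0 = 0 ->
  regular_at f 0 -> exists gam : R -> plane,
  [/\ smooth_near 0 gam, gam 0 = 0, gam^`()%classic 0 != 0 &
    \forall s \near (0 : R), f (gam s) = 0].
Proof.
move=> oN N0 sf f0 rf; have df := smooth_on_diff sf N0.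
have g0 := grad_gt0 df rf.
have : nbhs (0 : plane) [set p | N p /\ 0 < 'D_(grad f) f p].
  near=> p; split; near: p; first exact: open_nbhs_nbhs.
  have /cvgr_gt : {for 0, continuous ('D_(grad f) f)}.
    by apply: smooth_on_cont N0; exact: smooth_on_derive.
  exact.
rewrite nbhsE => -[N1 [oN1 N10] N1P].
have sf1 : smooth_on N1 f by apply: smooth_on_sub sf => p /N1P[].
have [rho [r [rho0 r0 [inN [phi Hphi]]]]] :=
  implicit_box (tang f) 0 oN1 N10 sf1 f0 g0.
have n0 : `|(0 : R)| < r by rewrite normr0.
pose gam s := pt (tang f) (grad f) 0 s (phi s 0) 0.
pose X p : plane := tang f + - ('D_(tang f) f p / 'D_(grad f) f p) *: grad f.
have sX : smooth_on N1 X.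
  apply: smooth_onD => //; first exact: smooth_on_cst.
  apply: smooth_onZ => //; last exact: smooth_on_cst.
  apply: smooth_onN => //; apply: smooth_onM => //; first exact: smooth_on_derive.
  apply: smooth_onV => //; last exact: smooth_on_derive.
  by move=> p /N1P[_]; rewrite lt0r => /andP[].
have dgam (s : R) : `|s| < r -> is_derive s 1 gam (X (gam s)).
  move=> sr; have [_ _ _ dphi _] := Hphi _ _ sr n0; exact: is_derive_ptc.
pose A : set R := [set s | `|s| < r].
have oA : open A.
  rewrite (_ : A = ball (0 : R) r); first exact: ball_open.
  by apply/funext => s; rewrite /A /ball/= sub0r normrN.
have A0 : A 0 by rewrite /A /= normr0.
have gN s : A s -> N1 (gam s).
  by move=> sr; have [phr _ _ _ _] := Hphi _ _ sr n0; have [] := inN _ _ _ sr phr n0.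
have sgam : smooth_on A gam.
  elim=> [|k IH].
    apply: Ck0 => s As; apply/derivable1_diffP.
    by have [] := dgam s As.
  apply/CkS; split=> [s As|v].
    by apply/derivable1_diffP; have [] := dgam s As.
  apply: (Ck_eq oA (f := fun s => v *: X (gam s))) => [s As|].
    have ds : differentiable gam s by apply/derivable1_diffP; have [] := dgam s As.
    rewrite -[v in RHS]mulr1 (deriveZdir _ _ ds); congr (_ *: _).
    by have [_ ->] := dgam s As.
  apply: (CkZ oA); first exact: Ck_cst.
  by apply: (Ck_comp oA gN IH); exact: sX.
have gam0 : gam 0 = 0.
  have [_ _ uq _ _] := Hphi 0 0 n0 n0.
  rewrite /gam -(uq 0) ?normr0 ?pt0//.
exists gam; split=> //.
- exact: smooth_on_near sgam.
- rewrite derive1E; have [_ ->] := dgam 0 n0.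
  have tf : 'D_(tang f) f 0 = 0.
    have z (a b : R) : a * b - b * a = 0 by rewrite mulrC subrr.
    exact: etrans (tang_dir f df) (z _ _).
  rewrite gam0 /X tf mul0r oppr0 scale0r addr0.
  apply: contraTneq g0 => E; rewrite grad_dir//.
  have := congr1 (fun v : plane => v 0 0) E; have := congr1 (fun v : plane => v 0 1) E.
  rewrite !mxE /= !(mulr0, mulr1, addr0, add0r) => -> /eqP.
  by rewrite oppr_eq0 => /eqP ->; rewrite mulr0 addr0 ltxx.
- apply: filterS (open_nbhs_nbhs (conj oA A0)) => s As.
  by have [] := Hphi _ _ As n0.
Unshelve. all: by end_near. Qed.

End PlaneBracket.

Section Contact.
Context {R : realType}.
Local Notation plane := 'rV[R]_2.
Variables (N : set plane) (f : plane -> R) (gam : R -> plane).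
Hypotheses (oN : open N) (N0 : N 0) (sf : smooth_on N f) (rf : regular_at f 0)
  (sgam : smooth_near 0 gam) (gam0 : gam 0 = 0) (dgam0 : gam^`()%classic 0 != 0)
  (fgam : \forall s \near (0 : R), f (gam s) = 0).

(* mu is the factor between the velocity of the curve and the rotated gradient
   of f, which span the same line. *)
Lemma derive_along_zero_curve : exists mu : R -> R,
  [/\ differentiable mu 0, mu 0 != 0 & forall h : plane -> R, smooth_on N h ->
    \forall s \near (0 : R),
      is_derive s (1 : R) (fun s : R => h (gam s)) (mu s * bracket f h (gam s))].
Proof.
have df := smooth_on_diff sf N0.
pose D2 p := 'D_eu f p * 'D_eu f p + 'D_ev f p * 'D_ev f p.
have su := smooth_on_derive eu sf; have sv := smooth_on_derive ev sf.
have sD2 : smooth_on N D2.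
  by apply: smooth_onD => //; apply: smooth_onM.
have D20 : 0 < D2 0 by have := grad_gt0 df rf; rewrite grad_dir.
have : nbhs (0 : plane) [set p | N p /\ 0 < D2 p].
  near=> p; split; near: p; first exact: open_nbhs_nbhs.
  have /cvgr_gt : {for 0, continuous D2} by exact: smooth_on_cont sD2 N0.
  exact.
rewrite nbhsE => -[N1 [oN1 N10] N1P].
have cgam : {for 0, continuous gam}.
  exact/differentiable_continuous/(nbhs_singleton sgam [::]).
have gN1 : \forall s \near (0 : R), N1 (gam s).
  by apply: cgam; rewrite gam0; exact: open_nbhs_nbhs.
have [A [oA A0 AP]] : exists A : set R, [/\ open A, A 0 &
    forall s, A s -> [/\ forall vs, differentiable (iterD vs gam) s, N1 (gam s) & f (gam s) = 0]].
  have : nbhs (0 : R) [set s | [/\ forall vs, differentiable (iterD vs gam) s, N1 (gam s) & f (gam s) = 0]].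
    by near do split.
  by rewrite nbhsE => -[A [oA A0] AP]; exists A.
have sg : smooth_on A gam by apply/smooth_onE => vs y /AP[].
have AN1 s : A s -> N1 (gam s) by move=> /AP[].
pose g1 s : R := 'D_1 gam s 0 0; pose g2 s : R := 'D_1 gam s 0 1.
have sub1 (h : plane -> R) : smooth_on N h -> smooth_on N1 h.
  by apply: smooth_on_sub => p /N1P[].
have scomp (h : plane -> R) : smooth_on N h -> smooth_on A (fun s => h (gam s)).
  by move=> /sub1; exact: smooth_on_comp.
pose mu s := (g2 s * 'D_eu f (gam s) - g1 s * 'D_ev f (gam s)) * (D2 (gam s))^-1.
have sg1 : smooth_on A g1 by apply: smooth_on_coord => //; exact: smooth_on_derive.
have sg2 : smooth_on A g2 by apply: smooth_on_coord => //; exact: smooth_on_derive.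
have smu : smooth_on A mu.
  apply: smooth_onM => //.
    by apply: smooth_onB => //; apply: smooth_onM => //; [exact: (scomp _ su)|exact: (scomp _ sv)].
  apply: smooth_onV => //; last exact: scomp.
  by move=> s /AN1/N1P[_]; rewrite lt0r => /andP[].
have dcomp (h : plane -> R) (s : R) : smooth_on N h -> A s ->
    is_derive s (1 : R) (fun s : R => h (gam s)) (g1 s * 'D_eu h (gam s) + g2 s * 'D_ev h (gam s)).
  move=> sh As; have dh : differentiable h (gam s).
    by apply: smooth_on_diff sh _; have /N1P[] := AN1 _ As.
  have dg : is_derive s 1 gam ('D_1 gam s).
    by apply/derivableP; exact: smooth_on_derivable sg As.
  by apply: is_derive_eq (is_derive_curve dg dh) _; rewrite derive_plane.
have velocity s : A s -> g1 s = - mu s * 'D_ev f (gam s) /\ g2 s = mu s * 'D_eu f (gam s).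
  move=> As; have [_ Ng fg] := AP s As.
  have [_ D2s] := N1P _ Ng.
  have E : g1 s * 'D_eu f (gam s) + g2 s * 'D_ev f (gam s) = 0.
    have [_ <-] := dcomp f s sf As.
    rewrite (derive_eq_on oA (g := fun=> 0) 1 _ As) ?derive_cst//.
    by move=> z /AP[].
  move: E D2s; rewrite /mu /D2; move: (g1 s) (g2 s) ('D_eu f (gam s)) ('D_ev f (gam s)).
  move=> a b c d E; rewrite lt0r => /andP[n0 _].
  split; apply: (mulIf n0).
    have -> : - ((b * c - a * d) * (c * c + d * d)^-1) * d * (c * c + d * d) =
       - ((b * c - a * d) * d) by field.
    have -> : a * (c * c + d * d) = (a * c + b * d) * c - (b * c - a * d) * d by ring.
    by rewrite E mul0r sub0r.
  have -> : (b * c - a * d) * (c * c + d * d)^-1 * c * (c * c + d * d) =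
       (b * c - a * d) * c by field.
  have -> : b * (c * c + d * d) = (a * c + b * d) * d + (b * c - a * d) * c by ring.
  by rewrite E mul0r add0r.
exists mu; split.
- exact: smooth_on_diff smu A0.
- apply: contra_neq dgam0 => mu0; have [E1 E2] := velocity 0 A0.
  rewrite derive1E (plane_eta ('D_1 gam 0)) -/(g1 0) -/(g2 0) E1 E2 mu0.
  by rewrite oppr0 !mul0r !scale0r addr0.
- move=> h sh; apply: filterS (open_nbhs_nbhs (conj oA A0)) => s As.
  apply: is_derive_eq (dcomp h s sh As) _.
  have [-> ->] := velocity s As; rewrite /bracket.
  by move: (mu s) ('D_eu f _) ('D_ev f _) ('D_eu h _) ('D_ev h _) => m a b c d; ring.
Unshelve. all: by end_near. Qed.

(** Along the curve, differentiation is mu times the bracket with f. In the second derivative the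
    term with mu' carries the factor [bracket f g 0], which is why that number is assumed to
    vanish. *)
Lemma contact_derivatives g : smooth_on N g -> exists2 mu : R, mu != 0 &
  (g \o gam)^`()%classic 0 = mu * bracket f g 0 /\
  (bracket f g 0 = 0 -> (g \o gam)^`(2)%classic 0 = mu ^+ 2 * bracket f (bracket f g) 0).
Proof.
move=> sg; have [mu [dmu mu0 H]] := derive_along_zero_curve.
exists (mu 0) => //; have H1 := H g sg.
split; first by rewrite derive1E; have [_ ->] := nbhs_singleton H1; rewrite gam0.
move=> J0; have sJ := smooth_on_bracket oN sf sg.
have [dJ vJ] := nbhs_singleton (H _ sJ).
rewrite derive1nS derive1n1 derive1E.
rewrite (near_eq_derive (g := fun s => mu s * bracket f g (gam s))); last first.
  by apply: filterS H1 => s [_ E]; rewrite derive1E E.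
have dJ' : differentiable (fun s : R => bracket f g (gam s)) 0 by exact/derivable1_diffP.
rewrite (derive_scale (1 : R) dmu dJ') vJ gam0 J0 scaler0 add0r.
by move: (bracket f (bracket f g) 0) => B; rewrite expr2 -mulrA.
Qed.

End Contact.

(** * The LD and the PC *)

(* Unfolding derivatives makes failing unifications diverge. *)
Local Opaque derive diff eu ev.

Section FirstSecondForms.
Context {R : realType}.
Local Notation space := 'rV[R]_3.
Implicit Types a b c : space.

(** The determinant of the rows a, b, c, expanded in coordinates so that it is open to [ring]. *)
Definition triple a b c : R :=
  (a 0 1 * b 0 2%:R - a 0 2%:R * b 0 1) * c 0 0 +
  (a 0 2%:R * b 0 0 - a 0 0 * b 0 2%:R) * c 0 1 -
  (a 0 1 * b 0 0 - a 0 0 * b 0 1) * c 0 2%:R.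

Lemma mink_mcrossE a b c : mink (mcross a b) c = triple a b c.
Proof. by rewrite /mink !mxE. Qed.

Variable V : normedModType R.
Variables e1 e2 : V.
Implicit Type x : V -> space.

(* delta and Kbar along two directions of an arbitrary domain, so that they also
   make sense for a whole family, whose domain contains the time. *)
Definition deltaD x (q : V) : R :=
  mink ('D_e1 x q) ('D_e2 x q) ^+ 2 - mink ('D_e1 x q) ('D_e1 x q) * mink ('D_e2 x q) ('D_e2 x q).

Definition secD x v w (q : V) : R := triple ('D_e1 x q) ('D_e2 x q) ('D_w ('D_v x) q).

Definition KD x (q : V) : R := secD x e1 e1 q * secD x e2 e2 q - secD x e1 e2 q ^+ 2.

Variable A : set V.
Hypothesis oA : open A.

Lemma smooth_on_mink x y : smooth_on A x -> smooth_on A y ->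
  smooth_on A (fun q => mink (x q) (y q)).
Proof.
move=> sx sy; apply: smooth_onB => //; first apply: smooth_onD => //.
all: by apply: smooth_onM => //; exact: smooth_on_coord.
Qed.

Lemma smooth_on_triple x y z : smooth_on A x -> smooth_on A y -> smooth_on A z ->
  smooth_on A (fun q => triple (x q) (y q) (z q)).
Proof.
move=> sx sy sz; apply: smooth_onB => //; first apply: smooth_onD => //.
all: apply: smooth_onM => //; last exact: smooth_on_coord.
all: by apply: smooth_onB => //; apply: smooth_onM => //; exact: smooth_on_coord.
Qed.

Lemma smooth_on_deltaD x : smooth_on A x -> smooth_on A (deltaD x).
Proof.
move=> sx; have s v := smooth_on_derive v sx.
apply: smooth_onB => //; first by apply: smooth_onX => //; exact: smooth_on_mink.
by apply: smooth_onM => //; exact: smooth_on_mink.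
Qed.

Lemma smooth_on_secD x v w : smooth_on A x -> smooth_on A (secD x v w).
Proof.
move=> sx; have s u := smooth_on_derive u sx.
by apply: smooth_on_triple => //; exact: smooth_on_derive.
Qed.

Lemma smooth_on_KD x : smooth_on A x -> smooth_on A (KD x).
Proof.
move=> sx; apply: smooth_onB => //; first by apply: smooth_onM => //; exact: smooth_on_secD.
by apply: smooth_onX => //; exact: smooth_on_secD.
Qed.

Lemma derive_sym_mx n (f : V -> 'rV[R]_n) y v w : A y -> smooth_on A f ->
  'D_v ('D_w f) y = 'D_w ('D_v f) y.
Proof.
move=> Ay sf; apply/rowP => j.
have E u u' : 'D_u' ('D_u f) y 0 j = 'D_u' ('D_u (fun z => f z 0 j)) y.
  rewrite -(derive_coord_on u' Ay j (smooth_on_derive u sf)).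
  apply: (derive_eq_on oA _ _ Ay) => z Az.
  by rewrite (derive_coord_on u Az j sf).
exact: etrans (E w v) (etrans (derive_sym v w oA Ay (smooth_on_coord oA j sf)) (esym (E v w))).
Qed.

End FirstSecondForms.

Section Classical.
Context {R : realType}.
Implicit Type x : 'rV[R]_2 -> 'rV[R]_3.

Lemma deltaE x : delta x = deltaD eu ev x. Proof. by []. Qed.

Lemma KbarE x q : Kbar x q = KD eu ev x q.
Proof.
congr (_ * _ - _ ^+ 2); exact: mink_mcrossE.
Qed.

End Classical.

(** * Behaviour of delta and Kbar under a change of parameters *)

Section ChangeOfParameters.
Context {R : realType}.
Local Notation plane := 'rV[R]_2.
Local Notation space := 'rV[R]_3.

(** The components al and be along U and V drop out of the determinant. This is how the second
    derivatives of the change of parameters disappear. *)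
Lemma triple_tangent (U V P Q S : space) (a b c d al be p q s : R) :
  triple (a *: U + b *: V) (c *: U + d *: V)
    (al *: U + be *: V + (p *: P + q *: Q + s *: S)) =
  (a * d - b * c) * (p * triple U V P + q * triple U V Q + s * triple U V S).
Proof. by rewrite /triple !mxE; ring. Qed.

Lemma mink_comb (U V : space) (a b c d : R) :
  mink (a *: U + b *: V) (c *: U + d *: V) =
  a * c * mink U U + (a * d + b * c) * mink U V + b * d * mink V V.
Proof. by rewrite /mink !mxE; ring. Qed.

Lemma gram_comb (U V : space) (a b c d : R) :
  let U' := a *: U + b *: V in let V' := c *: U + d *: V in
  mink U' V' ^+ 2 - mink U' U' * mink V' V' =
  (a * d - b * c) ^+ 2 * (mink U V ^+ 2 - mink U U * mink V V).
Proof.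
by rewrite /= !mink_comb; move: (mink U U) (mink U V) (mink V V) => E F G; ring.
Qed.

Lemma second_comb (U V P Q S : space) (da db a b c d : R) :
  (da *: U + a *: (c *: P + d *: Q)) + (db *: V + b *: (c *: Q + d *: S)) =
  da *: U + db *: V + ((a * c) *: P + (a * d + b * c) *: Q + (b * d) *: S).
Proof. by apply/rowP => j; rewrite !mxE; ring. Qed.

(** The exponent 4 is 2 + 2: each coefficient carries one jacobian from the normal vector, and the
    congruence of quadratic forms contributes the square of the jacobian. *)
Lemma hessian_comb (s1 s2 s3 P Q S a b c d : R) :
  s1 = (a * d - b * c) * (a * a * P + (a * b + b * a) * Q + b * b * S) ->
  s2 = (a * d - b * c) * (a * c * P + (a * d + b * c) * Q + b * d * S) ->
  s3 = (a * d - b * c) * (c * c * P + (c * d + d * c) * Q + d * d * S) ->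
  s1 * s3 - s2 ^+ 2 = (a * d - b * c) ^+ 4 * (P * S - Q ^+ 2).
Proof. by move=> -> -> ->; ring. Qed.

Variables (A B : set plane) (phi : plane -> plane).
Hypotheses (oA : open A) (oB : open B) (AB : forall q, A q -> B (phi q))
  (sphi : smooth_on A phi).

Let a v q : R := 'D_v phi q 0 0.
Let b v q : R := 'D_v phi q 0 1.
Definition jac q : R := a eu q * b ev q - b eu q * a ev q.

Lemma smooth_on_jac : smooth_on A jac.
Proof.
have s v j : smooth_on A (fun q => 'D_v phi q 0 j).
  by apply: smooth_on_coord => //; exact: smooth_on_derive.
by apply: smooth_onB => //; apply: smooth_onM => //; exact: s.
Qed.

Lemma derive_phi (W : normedModType R) (h : plane -> W) v q : A q -> smooth_on B h ->
  'D_v (fun z => h (phi z)) q = a v q *: 'D_eu h (phi q) + b v q *: 'D_ev h (phi q).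
Proof.
move=> Aq sh; rewrite (derive_comp_on v Aq sphi sh (AB Aq)).
by rewrite derive_plane//; apply: smooth_on_diff sh _; exact: AB.
Qed.

Lemma bracket_phi f g q : A q -> smooth_on B f -> smooth_on B g ->
  bracket (fun z => f (phi z)) (fun z => g (phi z)) q = jac q * bracket f g (phi q).
Proof.
move=> Aq sf sg; rewrite /bracket !derive_phi// /jac.
move: (a eu q) (b eu q) (a ev q) (b ev q) => au bu av bv.
move: ('D_eu f _) ('D_ev f _) ('D_eu g _) ('D_ev g _) => fu fv gu gv.
by rewrite /GRing.scale /=; ring.
Qed.

Variables x y : plane -> space.
Hypotheses (sx : smooth_on B x) (yx : forall q, A q -> y q = x (phi q)).

Let dy v q : A q -> 'D_v y q = a v q *: 'D_eu x (phi q) + b v q *: 'D_ev x (phi q).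
Proof. by move=> Aq; rewrite (derive_eq_on oA v yx Aq) derive_phi. Qed.

Lemma delta_phi q : A q -> delta y q = jac q ^+ 2 * delta x (phi q).
Proof. by move=> Aq; rewrite !deltaE /deltaD !dy// gram_comb. Qed.

Let secD_phi v w q : A q -> secD eu ev y v w q = jac q *
  (a v q * a w q * secD eu ev x eu eu (phi q) +
   (a v q * b w q + b v q * a w q) * secD eu ev x eu ev (phi q) +
   b v q * b w q * secD eu ev x ev ev (phi q)).
Proof.
move=> Aq.
have sa v' : smooth_on A (a v') by apply: smooth_on_coord => //; exact: smooth_on_derive.
have sb v' : smooth_on A (b v') by apply: smooth_on_coord => //; exact: smooth_on_derive.
have sU := smooth_on_derive eu sx; have sV := smooth_on_derive ev sx.
have sUp : smooth_on A (fun q => 'D_eu x (phi q)) by exact: smooth_on_comp sU.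
have sVp : smooth_on A (fun q => 'D_ev x (phi q)) by exact: smooth_on_comp sV.
have sym := derive_sym_mx oB eu ev (AB Aq) sx.
have E1 := etrans (deriveZ_on w Aq (sa v) sUp)
  (congr1 (fun z => _ + _ *: z) (derive_phi w Aq sU)).
have E2 := etrans (deriveZ_on w Aq (sb v) sVp)
  (congr1 (fun z => _ + _ *: z) (etrans (derive_phi w Aq sV)
     (congr1 (fun z => _ *: z + _) sym))).
have E := etrans (derive_eq_on oA w (dy v) Aq) (etrans
  (deriveD_on w Aq (smooth_onZ oA (sa v) sUp) (smooth_onZ oA (sb v) sVp))
  (etrans (congr2 +%R E1 E2) (second_comb _ _ _ _ _ _ _ _ _ _ _))).
have T (u1 u2 v1 v2 z1 z2 : space) : u1 = u2 -> v1 = v2 -> z1 = z2 ->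
    triple u1 v1 z1 = triple u2 v2 z2 by move=> -> -> ->.
exact: etrans (T _ _ _ _ _ _ (dy eu Aq) (dy ev Aq) E) (triple_tangent _ _ _ _ _ _ _ _ _ _ _ _ _ _).
Qed.

Lemma Kbar_phi q : A q -> Kbar y q = jac q ^+ 4 * Kbar x (phi q).
Proof.
move=> Aq; rewrite !KbarE.
exact: (hessian_comb (secD_phi eu eu Aq) (secD_phi eu ev Aq) (secD_phi ev ev Aq)).
Qed.

End ChangeOfParameters.

(** * Brackets of functions multiplied by factors *)

Section BracketRules.
Context {R : realType}.
Local Notation plane := 'rV[R]_2.
Variable A : set plane.
Hypotheses (oA : open A) (A0 : A 0).

Lemma derive_mul_zero (f g : plane -> R) v : smooth_on A f -> smooth_on A g -> f 0 = 0 ->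
  'D_v (fun z => f z * g z) 0 = 'D_v f 0 * g 0.
Proof. by move=> sf sg f0; rewrite (deriveM_on v A0 sf sg) f0 mul0r addr0. Qed.

Lemma bracket_eq_on (f f' g g' : plane -> R) q : (forall z, A z -> f z = f' z) ->
  (forall z, A z -> g z = g' z) -> A q -> bracket f g q = bracket f' g' q.
Proof.
move=> ff' gg' Aq; have E (h h' : plane -> R) := @derive_eq_on _ _ _ oA _ h h'.
exact: (congr2 (fun a b : R => a - b)
  (congr2 *%R (E _ _ _ _ ff' Aq) (E _ _ _ _ gg' Aq))
  (congr2 *%R (E _ _ _ _ ff' Aq) (E _ _ _ _ gg' Aq))).
Qed.

Lemma bracket_mul_zero (f g h : plane -> R) : smooth_on A g -> smooth_on A h -> g 0 = 0 ->
  bracket f (fun z => g z * h z) 0 = h 0 * bracket f g 0.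
Proof.
move=> sg sh g0; rewrite /bracket (derive_mul_zero eu sg sh g0) (derive_mul_zero ev sg sh g0).
by move: ('D_eu f 0) ('D_ev f 0) ('D_eu g 0) ('D_ev g 0) => *; ring.
Qed.

Variables p q al be f g : plane -> R.
Hypotheses (sp : smooth_on A p) (sq : smooth_on A q)
  (sal : smooth_on A al) (sbe : smooth_on A be)
  (fE : forall z, A z -> f z = al z * p z) (gE : forall z, A z -> g z = be z * q z)
  (p0 : p 0 = 0) (q0 : q 0 = 0).

Lemma derive_scaled v : 'D_v f 0 = al 0 * 'D_v p 0.
Proof.
have E z : A z -> f z = p z * al z by move=> Az; rewrite fE// mulrC.
by rewrite (derive_eq_on oA v E A0) (derive_mul_zero v sp sal p0) mulrC.
Qed.

(** [X] and [Y] collect the terms of the Leibniz expansion of {al p, be q} that are divisible by q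
    and by p. *)
Let X z := al z * bracket p be z.
Let Y z := be z * bracket al q z + q z * bracket al be z.

Let bracketE z : A z ->
  bracket f g z = bracket p q z * (al z * be z) + (q z * X z + p z * Y z).
Proof.
move=> Az; rewrite (bracket_eq_on fE gE Az) /bracket /X /Y /bracket.
have Ep v := deriveM_on v Az sal sp; have Eq v := deriveM_on v Az sbe sq.
rewrite (Ep eu) (Ep ev) (Eq eu) (Eq ev).
move: ('D_eu p z) ('D_ev p z) ('D_eu q z) ('D_ev q z) => pu pv qu qv.
move: ('D_eu al z) ('D_ev al z) ('D_eu be z) ('D_ev be z) => au av bu bv.
by move: (p z) (q z) (al z) (be z) => *; ring.
Qed.

Lemma bracket_scaled : bracket f g 0 = al 0 * be 0 * bracket p q 0.
Proof. by rewrite bracketE// p0 q0 !mul0r !addr0 mulrC. Qed.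

(** Of the correction q X + p Y, the part p Y has at 0 a differential proportional to that of p, so
    its bracket with p vanishes there; q X contributes X {p, q}, which vanishes by hypothesis. *)
Lemma bracket2_scaled : bracket p q 0 = 0 ->
  bracket f (bracket f g) 0 = al 0 ^+ 2 * be 0 * bracket p (bracket p q) 0.
Proof.
move=> J0.
have sJ := smooth_on_bracket oA sp sq.
have sX : smooth_on A X by apply: smooth_onM => //; exact: smooth_on_bracket.
have sY : smooth_on A Y.
  exact: (smooth_onD oA (smooth_onM oA sbe (smooth_on_bracket oA sal sq))
    (smooth_onM oA sq (smooth_on_bracket oA sal sbe))).
have sab : smooth_on A (fun z => al z * be z) by exact: smooth_onM.
have D v : 'D_v (bracket f g) 0 =
    'D_v (bracket p q) 0 * (al 0 * be 0) + ('D_v q 0 * X 0 + 'D_v p 0 * Y 0).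
  apply: etrans (derive_eq_on oA v bracketE A0) _.
  apply: etrans (deriveD_on v A0 (smooth_onM oA sJ sab)
    (smooth_onD oA (smooth_onM oA sq sX) (smooth_onM oA sp sY))) _.
  apply: (congr2 +%R); first exact: derive_mul_zero.
  apply: etrans (deriveD_on v A0 (smooth_onM oA sq sX) (smooth_onM oA sp sY)) _.
  by apply: (congr2 +%R); exact: derive_mul_zero.
move: J0; rewrite {1 2 4}/bracket (D eu) (D ev) (derive_scaled eu) (derive_scaled ev).
move: ('D_eu p 0) ('D_ev p 0) ('D_eu q 0) ('D_ev q 0) => pu pv qu qv.
move: ('D_eu (bracket p q) 0) ('D_ev (bracket p q) 0) (X 0) (Y 0) (al 0) (be 0).
move=> Ju Jv x y a b J0.
have -> : a * pu * (Jv * (a * b) + (qv * x + pv * y)) -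
    a * pv * (Ju * (a * b) + (qu * x + pu * y)) =
  a ^+ 2 * b * (pu * Jv - pv * Ju) + a * x * (pu * qv - pv * qu) by ring.
by rewrite J0 mulr0 addr0.
Qed.

End BracketRules.

(** * Invariance of the contact conditions *)

Section Invariance.
Context {R : realType}.
Local Notation plane := 'rV[R]_2.
Local Notation space := 'rV[R]_3.
Implicit Types x y : plane -> space.

Definition contactJ1 x : plane -> R := bracket (delta x) (Kbar x).
Definition contactJ2 x : plane -> R := bracket (delta x) (contactJ1 x).

Lemma smooth_on_delta (A : set plane) x : open A -> smooth_on A x -> smooth_on A (delta x).
Proof. by move=> oA sx; exact: smooth_on_deltaD. Qed.

Lemma smooth_on_Kbar (A : set plane) x : open A -> smooth_on A x -> smooth_on A (Kbar x).
Proof.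
move=> oA sx; apply: (smooth_on_eq oA (f := KD eu ev x)); last exact: smooth_on_KD.
by move=> z _; rewrite KbarE.
Qed.

Lemma det_neq0 (a b c d al be ga de : R) : al * a + be * c = 1 -> al * b + be * d = 0 ->
  ga * a + de * c = 0 -> ga * b + de * d = 1 -> a * d - b * c != 0.
Proof.
move=> h1 h2 h3 h4; apply/eqP => j0.
have : (al * de - be * ga) * (a * d - b * c) =
  (al * a + be * c) * (ga * b + de * d) - (al * b + be * d) * (ga * a + de * c) by ring.
by rewrite j0 h1 h2 h3 h4 !mulr0 subr0 mulr1 => /eqP; rewrite eq_sym oner_eq0.
Qed.

Lemma det_kernel (u v a b c d : R) : a * d - b * c != 0 -> u != 0 \/ v != 0 ->
  a * u + b * v != 0 \/ c * u + d * v != 0.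
Proof.
move=> j0 uv; apply/orP; rewrite -negb_and; apply/negP => /andP[/eqP h1 /eqP h2].
have hu : (a * d - b * c) * u = 0.
  have -> : (a * d - b * c) * u = d * (a * u + b * v) - b * (c * u + d * v) by ring.
  by rewrite h1 h2 !mulr0 subrr.
have hv : (a * d - b * c) * v = 0.
  have -> : (a * d - b * c) * v = a * (c * u + d * v) - c * (a * u + b * v) by ring.
  by rewrite h1 h2 !mulr0 subrr.
move/eqP: hu; move/eqP: hv; rewrite !mulf_eq0 (negbTE j0) /= => /eqP v0 /eqP u0.
by case: uv; rewrite ?u0 ?v0 eqxx.
Qed.

Lemma same_surface_chart x y : smooth_near 0 x -> same_surface x y ->
  exists (phi : plane -> plane) (A B : set plane),
  [/\ open A /\ A 0, open B /\ (forall q, A q -> B (phi q)), phi 0 = 0 /\ jac phi 0 != 0 &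
    [/\ smooth_on A phi, smooth_on B x & forall q, A q -> y q = x (phi q)]].
Proof.
move=> /smooth_nearP[B [oB B0 sx]] [phi [phi0 sphi [psi [psi0 spsi _ pq]]] yx].
have /smooth_nearP[A1 [oA1 A10 sA1]] := sphi.
have /smooth_nearP[A2 [oA2 A20 sA2]] := spsi.
have nB := smooth0_cvg phi0 sphi (open_nbhs_nbhs (conj oB B0)).
have : nbhs (0 : plane) [set q | [/\ A1 q, B (phi q) & y q = x (phi q)]].
  by near=> q; split; near: q; [exact: open_nbhs_nbhs|exact: nB|exact: yx].
rewrite nbhsE => -[A [oA A0] AP].
exists phi, A, B; split=> //; last first.
- split=> //; last by move=> q /AP[].
  by apply: smooth_on_sub sA1 => q /AP[].
- split=> //.
  have dphi : differentiable phi 0 by exact: smooth_on_diff sA1 A10.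
  (* The chain rule for phi o psi = id: the differential of phi has a right inverse, hence a nonzero
     determinant. *)
  have E v : 'D_v psi 0 0 0 *: 'D_eu phi 0 + 'D_v psi 0 0 1 *: 'D_ev phi 0 = v.
    have sA1' : smooth_on A1 phi := sA1.
    have A1psi : A1 (psi 0) by rewrite psi0.
    have := derive_comp_on v A20 sA2 sA1 A1psi.
    rewrite psi0 (derive_plane _ dphi) => <-.
    rewrite -[RHS](derive_id (0 : plane) v); apply: near_eq_derive.
    exact: pq.
  have cE (a b : R) (u v w : plane) j : a *: u + b *: v = w -> a * u 0 j + b * v 0 j = w 0 j.
    by move=> <-; rewrite !mxE.
  exact: (det_neq0 (etrans (cE _ _ _ _ _ 0 (E eu)) eu0) (etrans (cE _ _ _ _ _ 1 (E eu)) eu1)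
    (etrans (cE _ _ _ _ _ 0 (E ev)) ev0) (etrans (cE _ _ _ _ _ 1 (E ev)) ev1)).
- by split=> // q /AP[].
Unshelve. all: by end_near. Qed.

(** The factors jac^2 and jac^4 are handled by the rules for rescaled functions, and the extra
    jacobian of each pulled back bracket by [bracket_mul_zero]. Each number is treated under the
    vanishing of the previous ones, without which it would not be a relative invariant. Implications
    suffice, [same_surface] being symmetric. *)
Lemma same_surface_contact x y : smooth_near 0 x -> same_surface x y ->
  delta x 0 = 0 -> Kbar x 0 = 0 ->
  [/\ delta y 0 = 0, Kbar y 0 = 0, regular_at (delta x) 0 -> regular_at (delta y) 0,
    regular_at (Kbar x) 0 -> regular_at (Kbar y) 0 &
    contactJ1 x 0 = 0 -> contactJ1 y 0 = 0 /\ (contactJ2 x 0 = 0 -> contactJ2 y 0 = 0)].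
Proof.
move=> snx /(same_surface_chart snx)[phi [A [B [[oA A0] [oB AB] [phi0 jac0] [sphi sx yx]]]]] dx0 Kx0.
have B0 : B 0 by have := AB _ A0; rewrite phi0.
have sd := smooth_on_delta oB sx; have sK := smooth_on_Kbar oB sx.
have sJ1 := smooth_on_bracket oB sd sK.
have sjac := smooth_on_jac oA sphi.
have sj2 : smooth_on A (fun z => jac phi z ^+ 2) by exact: smooth_onX.
have sj4 : smooth_on A (fun z => jac phi z ^+ 4) by exact: smooth_onX.
have sdp : smooth_on A (fun z => delta x (phi z)) by exact: smooth_on_comp sd.
have sKp : smooth_on A (fun z => Kbar x (phi z)) by exact: smooth_on_comp sK.
have sJp : smooth_on A (fun z => contactJ1 x (phi z)) by exact: smooth_on_comp sJ1.
have dE z : A z -> delta y z = jac phi z ^+ 2 * delta x (phi z).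
  by move=> Az; exact: (delta_phi oA AB sphi sx yx Az).
have KE z : A z -> Kbar y z = jac phi z ^+ 4 * Kbar x (phi z).
  by move=> Az; exact: (Kbar_phi oA oB AB sphi sx yx Az).
have dp0 : delta x (phi 0) = 0 by rewrite phi0.
have Kp0 : Kbar x (phi 0) = 0 by rewrite phi0.
have J1E z : A z -> bracket (fun z => delta x (phi z)) (fun z => Kbar x (phi z)) z =
    contactJ1 x (phi z) * jac phi z.
  by move=> Az; rewrite mulrC; exact: (bracket_phi AB sphi Az sd sK).
have reg (f g al : plane -> R) : smooth_on B f -> smooth_on A al -> f (phi 0) = 0 ->
    al 0 != 0 -> (forall z, A z -> g z = al z * f (phi z)) ->
    regular_at f 0 -> regular_at g 0.
  move=> sf sal f0 al0 gE.
  have sfp : smooth_on A (fun z => f (phi z)) by exact: smooth_on_comp sf.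
  have sg : smooth_on A g.
    by apply: (smooth_on_eq oA (f := fun z => al z * f (phi z))) => [z /gE ->//|]; exact: smooth_onM.
  move=> /(regular_atP (smooth_on_diff sf B0)) rf.
  apply/(regular_atP (smooth_on_diff sg A0)).
  have Dg v := etrans (derive_scaled oA A0 sfp sal gE f0 v)
    (congr1 (fun w : R => al 0 * w) (derive_phi AB sphi v A0 sf)).
  rewrite phi0 in Dg.
  have mulN0 (w w' : R) : w' = al 0 * w -> w != 0 -> w' != 0 by move=> ->; exact: mulf_neq0.
  by case: (det_kernel jac0 rf) => h; [left|right]; [exact: mulN0 (Dg eu) h|exact: mulN0 (Dg ev) h].
split.
- by rewrite dE// dp0 mulr0.
- by rewrite KE// Kp0 mulr0.
- by apply: reg sd sj2 dp0 _ dE; rewrite expf_neq0.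
- by apply: reg sK sj4 Kp0 _ KE; rewrite expf_neq0.
move=> J10; have Jp0 : contactJ1 x (phi 0) = 0 by rewrite phi0.
have pq0 : bracket (fun z => delta x (phi z)) (fun z => Kbar x (phi z)) 0 = 0.
  by rewrite J1E// Jp0 mul0r.
split.
  by apply: etrans (bracket_scaled oA A0 sdp sKp sj2 sj4 dE KE dp0 Kp0) _; rewrite pq0 mulr0.
move=> J20.
apply: etrans (bracket2_scaled oA A0 sdp sKp sj2 sj4 dE KE dp0 Kp0 pq0) _.
have -> : bracket (fun z => delta x (phi z))
    (bracket (fun z => delta x (phi z)) (fun z => Kbar x (phi z))) 0 = 0; last by rewrite mulr0.
apply: etrans (bracket_eq_on oA (fun z _ => erefl) J1E A0) _.
apply: etrans (bracket_mul_zero A0 _ sJp sjac Jp0) _.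
apply: etrans (congr1 (fun w : R => jac phi 0 * w) (bracket_phi AB sphi A0 sd sJ1)) _.
have -> : bracket (delta x) (contactJ1 x) (phi 0) = 0 by rewrite phi0.
by rewrite !mulr0.
Qed.

End Invariance.

(** * Jets and perturbations *)

Section Flatness.
Context {R : realType}.
Variables (V : normedModType R) (A : set V).
Hypotheses (oA : open A) (A0 : A 0).
Implicit Types f g : V -> R.

Lemma iterD_eq_on (W : normedModType R) vs (f g : V -> W) : (forall z, A z -> f z = g z) ->
  forall z, A z -> iterD vs f z = iterD vs g z.
Proof.
elim: vs f g => [|v vs IH] f g fg //=; apply: IH => z Az.
exact: (derive_eq_on oA v fg Az).
Qed.

Lemma iterD_add (W : normedModType R) vs (f g : V -> W) z : smooth_on A f -> smooth_on A g -> A z ->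
  iterD vs (fun z => f z + g z) z = iterD vs f z + iterD vs g z.
Proof.
move=> + + Az; elim: vs f g => [|v vs IH] f g sf sg //.
rewrite -[LHS]/(iterD vs _ z) -[RHS]/(iterD vs ('D_v f) z + iterD vs ('D_v g) z).
rewrite -(IH ('D_v f) ('D_v g) (smooth_on_derive v sf) (smooth_on_derive v sg)).
by apply: iterD_eq_on Az => y Ay; exact: (deriveD_on v Ay sf sg).
Qed.

(** Vanishing to order at least k. With the strict inequality, orders add up exactly in products
    ([flatM]) and every function is flat to order 0. *)
Definition flat k f := forall vs, (size vs < k)%N -> iterD vs f 0 = 0.

Lemma flat_eq k f g : (forall z, A z -> f z = g z) -> flat k f -> flat k g.
Proof. by move=> fg H vs s; rewrite -(iterD_eq_on vs fg A0) H. Qed.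

Lemma flatW j k f : (j <= k)%N -> flat k f -> flat j f.
Proof. by move=> jk H vs s; apply: H; exact: leq_trans jk. Qed.

Lemma flatD k f g : smooth_on A f -> smooth_on A g -> flat k f -> flat k g ->
  flat k (fun z => f z + g z).
Proof.
by move=> sf sg Hf Hg vs s; rewrite (iterD_add vs sf sg A0) (Hf _ s) (Hg _ s) addr0.
Qed.

Lemma flat_derive k f v : flat k f -> flat k.-1 (fun z => 'D_v f z).
Proof. by case: k => // k H vs s; apply: (H (v :: vs)). Qed.

Lemma flatM i j f g : smooth_on A f -> smooth_on A g -> flat i f -> flat j g ->
  flat (i + j) (fun z => f z * g z).
Proof.
move=> + + + + vs; elim: vs i j f g => [|v vs IH] i j f g sf sg Hf Hg s.
  case: i s Hf => [|i] s Hf; last first.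
    by have f0 : f 0 = 0 := Hf [::] isT; rewrite /= f0 mul0r.
  by have g0 : g 0 = 0 := Hg [::] s; rewrite /= g0 mulr0.
have sf' := smooth_on_derive v sf; have sg' := smooth_on_derive v sg.
rewrite -[LHS]/(iterD vs (fun z => 'D_v (fun z => f z * g z) z) 0).
rewrite (iterD_eq_on vs (fun z Az => deriveM_on v Az sf sg) A0).
rewrite (iterD_add vs (smooth_onM oA sf' sg) (smooth_onM oA sf sg') A0).
have s' : ((size vs).+1 < i + j)%N by [].
(* Truncated predecessors are harmless: if i or j is 0 its predecessor is 0 as well, and the bound
   on the length of [vs] leaves room. *)
rewrite (IH i.-1 j)//; first rewrite add0r (IH i j.-1)//.
- exact: flat_derive.
- by case: (j) s' => [|j']; rewrite ?addn0 ?addnS//; exact: ltnW.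
- exact: flat_derive.
- by case: (i) s' => [|i'] //=; exact: ltnW.
Qed.

(* Equality of the jets of order < k at 0. *)
Definition eqo k f g := [/\ smooth_on A f, smooth_on A g & flat k (fun z => f z - g z)].

Lemma eqo_eq k f g : (forall z, A z -> f z = g z) -> smooth_on A f -> eqo k f g.
Proof.
move=> fg sf; split=> //; first exact: smooth_on_eq fg sf.
move=> vs _; rewrite (iterD_eq_on (g := fun=> 0) vs _ A0); last by move=> z /fg ->; rewrite subrr.
by elim: vs => //= v vs; rewrite (_ : 'D_v _ = fun=> 0)//; apply/funext => z; rewrite derive_cst.
Qed.

Lemma eqo_refl k f : smooth_on A f -> eqo k f f.
Proof. exact: eqo_eq. Qed.

Lemma eqo_flat k f g h : (forall z, A z -> f z = g z + h z) -> smooth_on A g ->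
  smooth_on A h -> flat k h -> eqo k f g.
Proof.
move=> fE sg sh fh; split=> //.
  apply: (smooth_on_eq oA (f := fun z => g z + h z)); last exact: smooth_onD.
  by move=> z /fE.
by apply: flat_eq fh => z /fE ->; rewrite addrAC subrr add0r.
Qed.

Lemma eqoW j k f g : (j <= k)%N -> eqo k f g -> eqo j f g.
Proof. by move=> jk [sf sg H]; split=> //; exact: flatW H. Qed.

Lemma eqo_trans k g f h : eqo k f g -> eqo k g h -> eqo k f h.
Proof.
move=> [sf sg fg] [_ sh gh]; split=> //.
apply: flat_eq (flatD (smooth_onB oA sf sg) (smooth_onB oA sg sh) fg gh) => z _.
by rewrite addrA subrK.
Qed.

Lemma eqoD k f f' g g' : eqo k f f' -> eqo k g g' ->
  eqo k (fun z => f z + g z) (fun z => f' z + g' z).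
Proof.
move=> [sf sf' ff'] [sg sg' gg']; split; [exact: smooth_onD|exact: smooth_onD|].
apply: flat_eq (flatD (smooth_onB oA sf sf') (smooth_onB oA sg sg') ff' gg') => z _.
by rewrite opprD addrACA.
Qed.

Lemma eqoM k f f' g g' : eqo k f f' -> eqo k g g' ->
  eqo k (fun z => f z * g z) (fun z => f' z * g' z).
Proof.
move=> [sf sf' ff'] [sg sg' gg']; split; [exact: smooth_onM|exact: smooth_onM|].
have flat0 h : flat 0 h by [].
have H1 := flatM (smooth_onB oA sf sf') sg' ff' (flat0 g').
have H2 := flatM sf (smooth_onB oA sg sg') (flat0 f) gg'.
rewrite addn0 in H1; rewrite add0n in H2.
apply: flat_eq (flatD _ _ H1 H2) => [z _||]; last 2 first.
- by apply: smooth_onM => //; exact: smooth_onB.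
- by apply: smooth_onM => //; exact: smooth_onB.
by move: (f z) (f' z) (g z) (g' z) => *; ring.
Qed.

Lemma eqoB k f f' g g' : eqo k f f' -> eqo k g g' ->
  eqo k (fun z => f z - g z) (fun z => f' z - g' z).
Proof.
move=> ff' gg'; have m1 : eqo k (fun=> -1) (fun=> -1) by apply: eqo_refl; exact: smooth_on_cst.
have [s1 s2 H] := eqoD ff' (eqoM m1 gg').
split.
- by apply: smooth_on_eq s1 => // z _; rewrite mulN1r.
- by apply: smooth_on_eq s2 => // z _; rewrite mulN1r.
- by apply: flat_eq H => z _; rewrite !mulN1r.
Qed.

Lemma eqoX2 k f f' : eqo k f f' -> eqo k (fun z => f z ^+ 2) (fun z => f' z ^+ 2).
Proof. by move=> H; exact: (eqoM H H). Qed.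

Lemma eqo_derive k f g v : eqo k f g -> eqo k.-1 (fun z => 'D_v f z) (fun z => 'D_v g z).
Proof.
move=> [sf sg H]; split; [exact: smooth_on_derive|exact: smooth_on_derive|].
apply: flat_eq (flat_derive v H) => z Az.
exact: (deriveB_on v Az sf sg).
Qed.

Lemma eqo_val k f g : eqo k.+1 f g -> f 0 = g 0.
Proof. by move=> [_ _ /(_ [::] isT)] /= /eqP; rewrite subr_eq0 => /eqP. Qed.

Lemma eqo_derive_val k f g v : eqo k.+2 f g -> 'D_v f 0 = 'D_v g 0.
Proof. by move=> /(eqo_derive v); exact: eqo_val. Qed.

End Flatness.

(** * Effect on delta and Kbar of a perturbation in a fixed direction *)

Section Perturbation.
Context {R : realType}.
Local Notation space := 'rV[R]_3.
Variables (V : normedModType R) (A : set V) (e1 e2 : V).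
Hypotheses (oA : open A) (A0 : A 0).
Local Notation eqo := (eqo A).

Let eqv k (x y : V -> space) := forall j, eqo k (fun z => x z 0 j) (fun z => y z 0 j).

Let eqo_mink k x x' y y' : eqv k x x' -> eqv k y y' ->
  eqo k (fun z => mink (x z) (y z)) (fun z => mink (x' z) (y' z)).
Proof.
move=> hx hy; apply: eqoB => //; first apply: eqoD => //.
all: by apply: eqoM => //; solve [exact: hx|exact: hy].
Qed.

Let eqo_triple k x x' y y' w w' : eqv k x x' -> eqv k y y' -> eqv k w w' ->
  eqo k (fun z => triple (x z) (y z) (w z)) (fun z => triple (x' z) (y' z) (w' z)).
Proof.
move=> hx hy hw; apply: eqoB => //; first apply: eqoD => //.
all: apply: eqoM => //; try exact: hw.
all: by apply: eqoB => //; apply: eqoM => //; solve [exact: hx|exact: hy].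
Qed.

Variables (x : V -> space) (Q : V -> R) (N : space) (k : nat).
Hypotheses (sx : smooth_on A x) (sQ : smooth_on A Q) (k0 : (0 < k)%N) (fQ : flat k.+2 Q).

Definition perturb z : space := x z + Q z *: N.

Let sN : smooth_on A (fun=> N). Proof. exact: smooth_on_cst. Qed.

Lemma smooth_on_perturb : smooth_on A perturb.
Proof. by apply: smooth_onD => //; exact: smooth_onZ. Qed.

Let derive_addZ (y : V -> space) (P : V -> R) v z : smooth_on A y -> smooth_on A P -> A z ->
  'D_v (fun z => y z + P z *: N) z = 'D_v y z + 'D_v P z *: N.
Proof.
move=> sy sP Az; apply: etrans (deriveD_on v Az sy (smooth_onZ oA sP sN)) _.
congr (_ + _); apply: etrans (deriveZ_on v Az sP sN) _.
by rewrite derive_cst scaler0 addr0.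
Qed.

Let D1 v z : A z -> 'D_v perturb z = 'D_v x z + 'D_v Q z *: N.
Proof. exact: derive_addZ. Qed.

Let D2 v w z : A z -> 'D_w ('D_v perturb) z = 'D_w ('D_v x) z + 'D_w ('D_v Q) z *: N.
Proof.
move=> Az; apply: etrans (derive_eq_on oA w (fun z Az => D1 v Az) Az) _.
by apply: derive_addZ Az; exact: smooth_on_derive.
Qed.

Let eqv_D1 v : eqv k.+1 (fun z => 'D_v perturb z) (fun z => 'D_v x z).
Proof.
move=> j; have sQN : smooth_on A (fun z => 'D_v Q z * N 0 j).
  by apply: smooth_onM => //; [exact: smooth_on_derive|exact: smooth_on_cst].
apply: (eqo_flat oA A0 (h := fun z => 'D_v Q z * N 0 j)) => //.
- by move=> z /(D1 v) ->; rewrite !mxE.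
- by apply: smooth_on_coord => //; exact: smooth_on_derive.
- rewrite -[k.+1]addn0; apply: (flatM oA A0) => //;
    solve [exact: smooth_on_derive|exact: smooth_on_cst|exact: (flat_derive v fQ)].
Qed.

(** Only first derivatives occur in delta, so one order of flatness of Q is lost. *)
Lemma deltaD_perturb : eqo k.+1 (deltaD e1 e2 perturb) (deltaD e1 e2 x).
Proof.
apply: eqoB => //; first by apply: eqoX2 => //; exact: eqo_mink.
by apply: eqoM => //; exact: eqo_mink.
Qed.

Definition normal_comp z : R := triple ('D_e1 x z) ('D_e2 x z) N.

Lemma smooth_on_normal_comp : smooth_on A normal_comp.
Proof. by apply: smooth_on_triple => //; exact: smooth_on_derive. Qed.

Let eqv_cst w : smooth_on A w -> eqv k.+1 w w.
Proof. by move=> sw j; apply: eqo_refl => //; exact: smooth_on_coord. Qed.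

Let flatQ2 v w : flat k (fun z => 'D_w ('D_v Q) z).
Proof. exact: (flat_derive w (flat_derive v fQ)). Qed.

Let sQ2 v w : smooth_on A (fun z => 'D_w ('D_v Q) z).
Proof. by do 2 apply: smooth_on_derive. Qed.

Let triple_add (a b c d : space) (r : R) :
  triple a b (c + r *: d) = triple a b c + r * triple a b d.
Proof. by rewrite /triple !mxE; ring. Qed.

Lemma secD_perturb v w : eqo k.+1 (secD e1 e2 perturb v w)
  (fun z => secD e1 e2 x v w z + 'D_w ('D_v Q) z * normal_comp z).
Proof.
have sd u : smooth_on A (fun z => 'D_u x z) by exact: smooth_on_derive.
have sd2 : smooth_on A (fun z => 'D_w ('D_v x) z) by exact: smooth_on_derive.
have sp u : smooth_on A (fun z => 'D_u perturb z).
  by apply: smooth_on_derive; exact: smooth_on_perturb.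
pose c' z := triple ('D_e1 perturb z) ('D_e2 perturb z) N.
have sc' : smooth_on A c' := smooth_on_triple oA (sp e1) (sp e2) sN.
have E z : A z -> triple ('D_e1 perturb z) ('D_e2 perturb z) ('D_w ('D_v x) z) +
    'D_w ('D_v Q) z * c' z = secD e1 e2 perturb v w z.
  move=> Az; apply: esym; apply: etrans (congr1 (triple _ _) (D2 v w Az)) _.
  exact: triple_add.
have s1 : smooth_on A (fun z => triple ('D_e1 perturb z) ('D_e2 perturb z) ('D_w ('D_v x) z)).
  exact: (smooth_on_triple oA (sp e1) (sp e2) sd2).
apply: (eqo_trans oA A0 (g := fun z =>
    triple ('D_e1 perturb z) ('D_e2 perturb z) ('D_w ('D_v x) z) + 'D_w ('D_v Q) z * c' z)).
  apply: (eqo_eq oA A0) => [z Az|]; first exact: esym (E z Az).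
  exact: (smooth_on_secD e1 e2 oA v w smooth_on_perturb).
apply: (eqoD oA A0); first exact: (eqo_triple (eqv_D1 e1) (eqv_D1 e2) (eqv_cst sd2)).
have [_ sc H] : eqo k.+1 c' normal_comp.
  exact: (eqo_triple (eqv_D1 e1) (eqv_D1 e2) (eqv_cst sN)).
split; [exact: smooth_onM|exact: smooth_onM|].
have H' := flatM oA A0 (sQ2 v w) (smooth_onB oA sc' sc) (flatQ2 v w) H.
have {}H' := flatW (leq_addl k k.+1) H'.
by apply: (flat_eq oA A0 _ H') => z _; rewrite mulrBr.
Qed.

(** The correction is the polarized determinant of the second form and Hess Q. Terms quadratic in
    Hess Q have order 2k, which is at least k + 1 because k is positive. *)
Lemma KD_perturb : eqo k.+1 (KD e1 e2 perturb) (fun z => KD e1 e2 x z + normal_comp z *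
  (secD e1 e2 x e1 e1 z * 'D_e2 ('D_e2 Q) z + secD e1 e2 x e2 e2 z * 'D_e1 ('D_e1 Q) z -
   2%:R * (secD e1 e2 x e1 e2 z * 'D_e2 ('D_e1 Q) z))).
Proof.
pose s v w z := secD e1 e2 x v w z; pose q v w z := 'D_w ('D_v Q) z.
have ss v w : smooth_on A (s v w) by exact: smooth_on_secD.
have sc := smooth_on_normal_comp; have s2 : smooth_on A (fun=> 2%:R : R) by exact: smooth_on_cst.
have sqq v w v' w' : smooth_on A (fun z => q v w z * q v' w' z).
  exact: (smooth_onM oA (sQ2 v w) (sQ2 v' w')).
have ssq v w v' w' : smooth_on A (fun z => s v w z * q v' w' z).
  exact: (smooth_onM oA (ss v w) (sQ2 v' w')).
have sc2 : smooth_on A (fun z => normal_comp z * normal_comp z) by exact: smooth_onM.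
have S v w := secD_perturb v w.
apply: (eqo_trans oA A0 (eqoB oA A0 (eqoM oA A0 (S e1 e1) (S e2 e2)) (eqoX2 oA A0 (S e1 e2)))).
apply: (eqo_flat oA A0 (h := fun z => (normal_comp z * normal_comp z) *
   (q e1 e1 z * q e2 e2 z - q e1 e2 z * q e1 e2 z))).
- move=> z _; rewrite /KD -/(s e1 e1 z) -/(s e1 e2 z) -/(s e2 e2 z).
  rewrite -/(q e1 e1 z) -/(q e1 e2 z) -/(q e2 e2 z).
  by move: (s e1 e1 z) (s e1 e2 z) (s e2 e2 z) (q e1 e1 z) (q e1 e2 z) (q e2 e2 z) (normal_comp z) => *; ring.
- exact: (smooth_onD oA (smooth_on_KD e1 e2 oA sx) (smooth_onM oA sc (smooth_onB oA
    (smooth_onD oA (ssq e1 e1 e2 e2) (ssq e2 e2 e1 e1)) (smooth_onM oA s2 (ssq e1 e2 e1 e2))))).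
- exact: (smooth_onM oA sc2 (smooth_onB oA (sqq e1 e1 e2 e2) (sqq e1 e2 e1 e2))).
- have qq v w v' w' : flat k.+1 (fun z => q v w z * q v' w' z).
    have kk : (k.+1 <= k + k)%N by rewrite -addn1 leq_add2l.
    exact: (flatW kk (flatM oA A0 (sQ2 v w) (sQ2 v' w') (flatQ2 v w) (flatQ2 v' w'))).
  have m1 : smooth_on A (fun=> -1 : R) by exact: smooth_on_cst.
  have f0 (f : V -> R) : flat 0 f by [].
  have H := flatM oA A0 m1 (sqq e1 e2 e1 e2) (f0 _) (qq e1 e2 e1 e2).
  have H1 := flatD oA A0 (sqq e1 e1 e2 e2) (smooth_onM oA m1 (sqq e1 e2 e1 e2)) (qq e1 e1 e2 e2) H.
  have sB := smooth_onB oA (sqq e1 e1 e2 e2) (sqq e1 e2 e1 e2).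
  have H2 : flat k.+1 (fun z => q e1 e1 z * q e2 e2 z - q e1 e2 z * q e1 e2 z).
    by apply: (flat_eq oA A0 _ H1) => z _; rewrite mulN1r.
  exact: (flatM oA A0 sc2 sB (f0 _) H2).
Qed.

End Perturbation.

Section MonomialPerturbation.
Context {R : realType}.
Local Notation space := 'rV[R]_3.

(** For L with coefficients (a, b), the kernel of L is spanned by (b, - a). The two conditions say
    that this direction is not killed by the linear form (u, v) and is not isotropic for the
    quadratic form, that is, neither tangent to the LD nor asymptotic in the application to
    surfaces. *)
Lemma isotropic_choice (u v s11 s12 s22 : R) : u != 0 \/ v != 0 ->
  [\/ s11 != 0, s12 != 0 | s22 != 0] -> exists a b : R,
  u * b - v * a != 0 /\ s11 * (b * b) + s22 * (a * a) - 2%:R * (s12 * (a * b)) != 0.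
Proof.
move=> uv s; apply: contrapT => H.
have {}H a b : u * b - v * a = 0 \/ s11 * (b * b) + s22 * (a * a) - 2%:R * (s12 * (a * b)) = 0.
  have [/eqP|h] := boolP (u * b - v * a == 0); first by left.
  have [/eqP|h'] := boolP (s11 * (b * b) + s22 * (a * a) - 2%:R * (s12 * (a * b)) == 0); first by right.
  by case: H; exists a, b.
have : (u = 0 /\ v = 0) \/ [/\ s11 = 0, s12 = 0 & s22 = 0].
  (* Four pairwise independent directions: either the linear form vanishes on two of them, or the
     quadratic form on three, and that form is then zero. *)
  have [h1|h1] := H 1 0; have [h2|h2] := H 0 1; have [h3|h3] := H 1 1; have [h4|h4] := H 1 (-1);
    clear H uv s; solve [left; split; lra|right; split; lra].
case=> [[u0 v0]|[s1 s2 s3]].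
  by case: uv; rewrite ?u0 ?v0 eqxx.
by case: s; rewrite ?s1 ?s2 ?s3 eqxx.
Qed.

Variables (V : normedModType R) (A : set V) (e1 e2 : V).
Hypotheses (oA : open A) (A0 : A 0).

Lemma deriveXS_on (f : V -> R) n v y : smooth_on A f -> A y ->
  'D_v (fun z => f z ^+ n.+1) y = n.+1%:R * f y ^+ n * 'D_v f y.
Proof.
move=> sf Ay; elim: n => [|n IH].
  rewrite expr0 mulr1 mulr1n mul1r.
  by apply: (derive_eq_on oA v _ Ay) => z _; rewrite expr1.
have sn := smooth_onX oA n.+1 sf.
have E z : A z -> f z ^+ n.+2 = f z * f z ^+ n.+1 by move=> _; rewrite exprS.
apply: etrans (derive_eq_on oA v E Ay) _; apply: etrans (deriveM_on v Ay sf sn) _.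
rewrite IH; move: ('D_v f y) (f y) => d a; rewrite [in LHS]exprS [in RHS]exprS -(natr1 n.+1).
by ring.
Qed.

Lemma flatX (f : V -> R) n : smooth_on A f -> flat 1 f -> flat n (fun z => f z ^+ n).
Proof.
move=> sf f1; elim: n => [|n IH]; first by [].
have sn := smooth_onX oA n sf.
by apply: (flat_eq oA A0 _ (flatM oA A0 sf sn f1 IH)) => z _; rewrite exprS.
Qed.

Variables (x : V -> space) (T L : V -> R) (l : V -> R) (N : space) (j m : nat).
Hypotheses (sx : smooth_on A x) (sT : smooth_on A T) (sL : smooth_on A L)
  (T1 : forall z, A z -> 'D_e1 T z = 0) (T2 : forall z, A z -> 'D_e2 T z = 0)
  (fT : flat j T) (L0 : L 0 = 0) (DL : forall v z, A z -> 'D_v L z = l v)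
  (jm : (0 < j + m)%N).

(** Covers both perturbations: T constant with m = 2 for surfaces, T a multiple of time with m = 0
    for families. T is constant along e1 and e2, so differentiating twice along them only lowers the
    power of L. *)
Definition monomial z : R := T z * L z ^+ m.+2.

Lemma smooth_on_monomial : smooth_on A monomial.
Proof. by apply: smooth_onM => //; exact: smooth_onX. Qed.

Let derive_TX n v z : v = e1 \/ v = e2 -> A z ->
  'D_v (fun z => T z * L z ^+ n.+1) z = (n.+1%:R * l v) * (T z * L z ^+ n).
Proof.
move=> ve Az; have sn := smooth_onX oA n.+1 sL.
have Tv : 'D_v T z = 0 by case: ve => ->; [exact: T1|exact: T2].
apply: etrans (deriveM_on v Az sT sn) _; rewrite (deriveXS_on n v sL Az) Tv (DL v Az).
by move: (L z ^+ n) (T z) (L z ^+ n.+1) => *; ring.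
Qed.

Let derive2 v w z : v = e1 \/ v = e2 -> w = e1 \/ w = e2 -> A z ->
  'D_w ('D_v monomial) z = (m.+2%:R * m.+1%:R * (l v * l w)) * (T z * L z ^+ m).
Proof.
move=> ve we Az.
apply: etrans (derive_eq_on oA w (fun z Az => derive_TX m.+1 ve Az) Az) _.
have sTX : smooth_on A (fun z => T z * L z ^+ m.+1).
  by apply: smooth_onM => //; exact: smooth_onX.
have sc : smooth_on A (fun=> m.+2%:R * l v) by exact: smooth_on_cst.
apply: etrans (deriveM_on w Az sc sTX) _; rewrite derive_cst mul0r add0r (derive_TX m we Az).
by move: (T z * L z ^+ m) => *; ring.
Qed.

Let flat_monomial : flat (j + m).+2 monomial.
Proof.
have f1 : flat 1 L by case.
rewrite -!addnS; apply: (flatM oA A0 sT _ fT); first exact: smooth_onX.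
exact: flatX.
Qed.

(** The factor of T L^m in the leading change of Kbar: the second form on the kernel direction of L,
    times the component of N across the tangent plane and the constant from differentiating the
    power twice. *)
Definition hess_form z : R := m.+2%:R * m.+1%:R * normal_comp e1 e2 x N z *
  (secD e1 e2 x e1 e1 z * (l e2 * l e2) + secD e1 e2 x e2 e2 z * (l e1 * l e1) -
   2%:R * (secD e1 e2 x e1 e2 z * (l e1 * l e2))).

Lemma smooth_on_hess_form : smooth_on A hess_form.
Proof.
have sc (c : R) : smooth_on A (fun=> c) by exact: smooth_on_cst.
have ss v w c : smooth_on A (fun z => secD e1 e2 x v w z * c).
  exact: (smooth_onM oA (smooth_on_secD e1 e2 oA v w sx) (sc c)).
exact: (smooth_onM oA (smooth_onM oA (sc _) (smooth_on_normal_comp e1 e2 oA N sx))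
  (smooth_onB oA (smooth_onD oA (ss _ _ _) (ss _ _ _)) (smooth_onM oA (sc _) (ss _ _ _)))).
Qed.

Lemma deltaD_monomial :
  eqo A (j + m).+1 (deltaD e1 e2 (perturb x monomial N)) (deltaD e1 e2 x).
Proof. exact: (deltaD_perturb e1 e2 oA A0 N sx smooth_on_monomial flat_monomial). Qed.

Lemma KD_monomial : eqo A (j + m).+1 (KD e1 e2 (perturb x monomial N))
  (fun z => KD e1 e2 x z + hess_form z * (T z * L z ^+ m)).
Proof.
have H := KD_perturb e1 e2 oA A0 N sx smooth_on_monomial jm flat_monomial.
apply: (eqo_trans oA A0 H); apply: (eqo_eq oA A0) => [z Az|]; last by case: H.
have i1 : e1 = e1 \/ e1 = e2 by left. have i2 : e2 = e1 \/ e2 = e2 by right.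
rewrite (derive2 i2 i2 Az) (derive2 i1 i1 Az) (derive2 i1 i2 Az) /hess_form.
congr (_ + _).
move: (secD e1 e2 x e1 e1 z) (secD e1 e2 x e2 e2 z) (secD e1 e2 x e1 e2 z) (T z * L z ^+ m).
by move: (normal_comp e1 e2 x N z) (l e1) (l e2) => *; ring.
Qed.

End MonomialPerturbation.

(** * Continuous dependence on jets *)

Section JetContinuity.
Context {R : realType}.
Local Notation space := 'rV[R]_3.
Implicit Types V W : normedModType R.

Lemma smooth_near2 V W W' (f : V -> W) (g : V -> W') a : smooth_near a f -> smooth_near a g ->
  exists A, [/\ open A, A a, smooth_on A f & smooth_on A g].
Proof.
move=> /smooth_nearP[A [oA Aa sf]] /smooth_nearP[B [oB Ba sg]].
exists (A `&` B); split=> //; first exact: openI.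
- by apply: smooth_on_sub sf => z [].
- by apply: smooth_on_sub sg => z [].
Qed.

Variable S : topologicalType.

(** Continuity for the jet topology, for maps not yet packaged as germs. S is arbitrary so that the
    same rules apply to the spaces of germs themselves, where they give openness, and to
    one-parameter perturbations with S the real line, where they give density. *)
Definition jet_continuous V W (Phi : S -> V -> W) :=
  (forall s, smooth_near 0 (Phi s)) /\
  forall vs, continuous (fun s => iterD vs (Phi s) 0).

Section Rules.
Variable V : normedModType R.
Implicit Types Phi Psi : S -> V -> R.

Lemma jet_continuous_cst W (f : V -> W) : smooth_near 0 f -> jet_continuous (fun=> f).
Proof. by move=> sf; split=> // vs; exact: cst_continuous. Qed.

Lemma jet_continuous_val W (Phi : S -> V -> W) :
  jet_continuous Phi -> continuous (fun s => Phi s 0).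
Proof. by move=> [_ /(_ [::])]. Qed.

Lemma jet_continuous_derive W (Phi : S -> V -> W) v : jet_continuous Phi ->
  jet_continuous (fun s z => 'D_v (Phi s) z).
Proof.
move=> [sPhi cPhi]; split=> [s|vs]; last exact: (cPhi (v :: vs)).
have /smooth_nearP[A [oA A0 sA]] := sPhi s.
exact: smooth_on_near oA A0 (smooth_on_derive v sA).
Qed.

Lemma jet_continuousD W (Phi Psi : S -> V -> W) : jet_continuous Phi -> jet_continuous Psi ->
  jet_continuous (fun s z => Phi s z + Psi s z).
Proof.
move=> [sPhi cPhi] [sPsi cPsi]; split=> [s|vs].
  have [A [oA A0 sf sg]] := smooth_near2 (sPhi s) (sPsi s).
  exact: smooth_on_near oA A0 (smooth_onD oA sf sg).
rewrite (_ : (fun s => _) = fun s => iterD vs (Phi s) 0 + iterD vs (Psi s) 0).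
  by move=> s; apply: cvgD; [exact: cPhi|exact: cPsi].
apply/funext => s; have [A [oA A0 sf sg]] := smooth_near2 (sPhi s) (sPsi s).
exact: (iterD_add oA vs sf sg A0).
Qed.

Lemma jet_continuousM Phi Psi : jet_continuous Phi -> jet_continuous Psi ->
  jet_continuous (fun s z => Phi s z * Psi s z).
Proof.
move=> hPhi hPsi; split=> [s|vs].
  have [A [oA A0 sf sg]] := smooth_near2 (hPhi.1 s) (hPsi.1 s).
  exact: smooth_on_near oA A0 (smooth_onM oA sf sg).
elim: vs Phi Psi hPhi hPsi => [|v vs IH] Phi Psi hPhi hPsi.
  by move=> s; apply: cvgM; [exact: (hPhi.2 [::])|exact: (hPsi.2 [::])].
have hPhi' := jet_continuous_derive v hPhi; have hPsi' := jet_continuous_derive v hPsi.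
rewrite (_ : (fun s => _) = fun s => iterD vs (fun z => 'D_v (Phi s) z * Psi s z) 0 +
    iterD vs (fun z => Phi s z * 'D_v (Psi s) z) 0).
  by move=> s; apply: cvgD; [exact: IH hPhi' hPsi s|exact: IH hPhi hPsi' s].
apply/funext => s; have [A [oA A0 sf sg]] := smooth_near2 (hPhi.1 s) (hPsi.1 s).
have sf' := smooth_on_derive v sf; have sg' := smooth_on_derive v sg.
rewrite -(iterD_add oA vs (smooth_onM oA sf' sg) (smooth_onM oA sf sg') A0).
rewrite -[LHS]/(iterD vs (fun z => 'D_v (fun z => Phi s z * Psi s z) z) 0).
exact: (iterD_eq_on oA vs (fun z Az => deriveM_on v Az sf sg) A0).
Qed.

Lemma jet_continuousB Phi Psi : jet_continuous Phi -> jet_continuous Psi ->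
  jet_continuous (fun s z => Phi s z - Psi s z).
Proof.
move=> hPhi hPsi.
have m1 : smooth_near 0 (fun _ : V => -1 : R).
  by apply: (smooth_on_near (A := setT) openT) => //; exact: smooth_on_cst.
have := jet_continuousD hPhi (jet_continuousM (jet_continuous_cst m1) hPsi).
have -> // : (fun s z => Phi s z + -1 * Psi s z) = (fun s z => Phi s z - Psi s z).
by apply/funext => s; apply/funext => z; rewrite mulN1r.
Qed.

Lemma jet_continuous_scale Phi W (N : W) : jet_continuous Phi ->
  jet_continuous (fun s z => Phi s z *: N).
Proof.
move=> hPhi; have sN (A : set V) : smooth_on A (fun=> N : W) by exact: smooth_on_cst.
split=> [s|vs].
  have /smooth_nearP[A [oA A0 sf]] := hPhi.1 s.
  exact: smooth_on_near oA A0 (smooth_onZ oA sf (sN A)).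
rewrite (_ : (fun s => _) = fun s => iterD vs (Phi s) 0 *: N).
  by move=> s; apply: cvgZr_tmp; exact: hPhi.2.
apply/funext => s; have /smooth_nearP[A [oA A0 sf]] := hPhi.1 s.
elim: vs (Phi s) sf => [|v vs IH] f sf //.
rewrite -[LHS]/(iterD vs (fun z => 'D_v (fun z => f z *: N) z) 0).
apply: etrans (IH ('D_v f) (smooth_on_derive v sf)).
apply: (iterD_eq_on oA vs _ A0) => z Az; apply: etrans (deriveZ_on v Az sf (sN A)) _.
by rewrite derive_cst scaler0 addr0.
Qed.

Lemma jet_continuous_coord n (Phi : S -> V -> 'rV[R]_n) j : jet_continuous Phi ->
  jet_continuous (fun s z => Phi s z 0 j).
Proof.
move=> hPhi; split=> [s|vs].
  have /smooth_nearP[A [oA A0 sf]] := hPhi.1 s.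
  exact: smooth_on_near oA A0 (smooth_on_coord oA _ sf).
rewrite (_ : (fun s => _) = fun s => iterD vs (Phi s) 0 0 j).
  move=> s; apply: (@continuous_comp _ _ _ (fun s => iterD vs (Phi s) 0) (fun M : 'rV[R]_n => M 0 j)).
    exact: hPhi.2.
  exact: coord_continuous.
apply/funext => s; have /smooth_nearP[A [oA A0 sf]] := hPhi.1 s.
elim: vs (Phi s) sf => [|v vs IH] f sf //.
rewrite -[LHS]/(iterD vs (fun z => 'D_v (fun z => f z 0 j) z) 0).
apply: etrans (IH ('D_v f) (smooth_on_derive v sf)).
by apply: (iterD_eq_on oA vs _ A0) => z Az; exact: (derive_coord_on v Az j sf).
Qed.

Variable X : S -> V -> space.
Hypothesis hX : jet_continuous X.
Variables e1 e2 : V.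

Let jc_mink (Y Z : S -> V -> space) : jet_continuous Y -> jet_continuous Z ->
  jet_continuous (fun s z => mink (Y s z) (Z s z)).
Proof.
move=> hY hZ; have m j : jet_continuous (fun s z => Y s z 0 j * Z s z 0 j).
  by apply: jet_continuousM; exact: jet_continuous_coord.
exact: (jet_continuousB (jet_continuousD (m _) (m _)) (m _)).
Qed.

Let jc_triple (Y Z W : S -> V -> space) : jet_continuous Y -> jet_continuous Z ->
  jet_continuous W -> jet_continuous (fun s z => triple (Y s z) (Z s z) (W s z)).
Proof.
move=> hY hZ hW.
have m i j k : jet_continuous (fun s z => (Y s z 0 i * Z s z 0 j - Y s z 0 j * Z s z 0 i) * W s z 0 k).
  apply: jet_continuousM; last exact: jet_continuous_coord.
  by apply: jet_continuousB; apply: jet_continuousM; exact: jet_continuous_coord.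
exact: (jet_continuousB (jet_continuousD (m _ _ _) (m _ _ _)) (m _ _ _)).
Qed.

Lemma jet_continuous_deltaD : jet_continuous (fun s z => deltaD e1 e2 (X s) z).
Proof.
have d v := jet_continuous_derive v hX.
have m v w := jc_mink (d v) (d w).
exact: (jet_continuousB (jet_continuousM (m e1 e2) (m e1 e2)) (jet_continuousM (m e1 e1) (m e2 e2))).
Qed.

Lemma jet_continuous_KD : jet_continuous (fun s z => KD e1 e2 (X s) z).
Proof.
have d v := jet_continuous_derive v hX; have d2 v w := jet_continuous_derive w (d v).
have t v w := jc_triple (d e1) (d e2) (d2 v w).
exact: (jet_continuousB (jet_continuousM (t e1 e1) (t e2 e2)) (jet_continuousM (t e1 e2) (t e1 e2))).
Qed.

End Rules.

Lemma jet_continuous_bracket (f g : S -> 'rV[R]_2 -> R) : jet_continuous f -> jet_continuous g ->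
  jet_continuous (fun s z => bracket (f s) (g s) z).
Proof.
move=> hf hg; have df v := jet_continuous_derive v hf; have dg v := jet_continuous_derive v hg.
exact: (jet_continuousB (jet_continuousM (df eu) (dg ev)) (jet_continuousM (df ev) (dg eu))).
Qed.

End JetContinuity.

Section ParamContinuity.
Context {R : realType}.

Lemma jet_continuous_param : jet_continuous (fun x : @paramType R => set_val x).
Proof.
split=> [x|vs]; first by have [] := set_valP x.
have c : continuous (fun x : @paramType R => jet (set_val x)) by exact: initial_continuous.
have p : continuous (fun f : prod_topology (fun _ : seq 'rV[R]_2 => 'rV[R]_3) => f vs).
  exact: proj_continuous.
by move=> x; exact: (continuous_comp (c x) (p _)).
Qed.

Lemma jet_continuous_deformation : jet_continuous (fun h : @deformationType R => set_val h).
Proof.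
split=> [x|vs]; first by have [] := set_valP x.
have c : continuous (fun x : @deformationType R => jet (set_val x)) by exact: initial_continuous.
have p : continuous (fun f : prod_topology (fun _ : seq 'rV[R]_(2 + 1) => R) => f vs).
  exact: proj_continuous.
by move=> x; exact: (continuous_comp (c x) (p _)).
Qed.

End ParamContinuity.

(** * Contact conditions on surface germs *)

Section ContactConditions.
Local Open Scope quotient_scope.
Context {R : realType}.
Local Notation plane := 'rV[R]_2.
Local Notation space := 'rV[R]_3.
Implicit Types x : plane -> space.

(** Valid for every parametrization of the LD, so that the order of contact does not depend on the
    one chosen in [contact_eq] and [contact_gt]. *)
Lemma contact_orders x gam : smooth_near 0 x -> LD_param x gam -> regular_at (delta x) 0 ->
  exists2 mu : R, mu != 0 & [/\ (Kbar x \o gam) 0 = Kbar x 0,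
   (Kbar x \o gam)^`()%classic 0 = mu * contactJ1 x 0 &
   contactJ1 x 0 = 0 -> (Kbar x \o gam)^`(2)%classic 0 = mu ^+ 2 * contactJ2 x 0].
Proof.
move=> /smooth_nearP[A [oA A0 sx]] [sgam gam0 dgam0 LDg] rd.
have [mu mu0 [h1 h2]] := contact_derivatives oA A0 (smooth_on_delta oA sx) rd sgam gam0 dgam0
  LDg (smooth_on_Kbar oA sx).
exists mu; first exact: mu0.
by split; [exact: (congr1 (Kbar x) gam0)|exact: h1|exact: h2].
Qed.

Lemma KbarF x : Kbar x = KD eu ev x.
Proof. by apply/funext => q; exact: KbarE. Qed.

Lemma jet_continuous_delta : jet_continuous (fun (x : @paramType R) z => delta (set_val x) z).
Proof. exact: (jet_continuous_deltaD (@jet_continuous_param R) eu ev). Qed.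

Lemma jet_continuous_Kbar : jet_continuous (fun (x : @paramType R) z => Kbar (set_val x) z).
Proof.
have -> : (fun (x : @paramType R) z => Kbar (set_val x) z) =
    (fun (x : @paramType R) z => KD eu ev (set_val x) z).
  by apply/funext => x; apply/funext => z; exact: KbarE.
exact: (jet_continuous_KD (@jet_continuous_param R) eu ev).
Qed.

Lemma jet_continuous_J1 : jet_continuous (fun (x : @paramType R) z => contactJ1 (set_val x) z).
Proof. exact: (jet_continuous_bracket jet_continuous_delta jet_continuous_Kbar). Qed.

Lemma jet_continuous_J2 : jet_continuous (fun (x : @paramType R) z => contactJ2 (set_val x) z).
Proof. exact: (jet_continuous_bracket jet_continuous_delta jet_continuous_J1). Qed.

Local Opaque delta Kbar contactJ1 contactJ2.

Lemma exists_LD_param x : smooth_near 0 x -> delta x 0 = 0 -> regular_at (delta x) 0 ->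
  exists gam, LD_param x gam.
Proof.
move=> /smooth_nearP[A [oA A0 sx]] d0 rd.
by have [gam [? ? ? ?]] := zero_curve oA A0 (smooth_on_delta oA sx) d0 rd; exists gam.
Qed.

Lemma contact_gt1P x : smooth_near 0 x -> delta x 0 = 0 -> regular_at (delta x) 0 ->
  contact_gt x 1 <-> Kbar x 0 = 0 /\ contactJ1 x 0 = 0.
Proof.
move=> sx d0 rd; split=> [[gam LDg H]|[K0 J0]].
  have [mu mu0 [h0 h1 _]] := contact_orders sx LDg rd.
  split; first exact: etrans (esym h0) (H 0%N isT).
  have := H 1%N isT; rewrite derive1n1 h1 => /eqP.
  by rewrite mulf_eq0 (negbTE mu0) => /eqP.
have [gam LDg] := exists_LD_param sx d0 rd; exists gam; first exact: LDg.
have [mu mu0 [h0 h1 _]] := contact_orders sx LDg rd.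
by case=> [|[|//]] _; [rewrite derive1n0 h0|rewrite derive1n1 h1 J0 mulr0].
Qed.

Lemma contact_eq2P x : smooth_near 0 x -> delta x 0 = 0 -> regular_at (delta x) 0 ->
  contact_eq x 2 <-> [/\ Kbar x 0 = 0, contactJ1 x 0 = 0 & contactJ2 x 0 != 0].
Proof.
move=> sx d0 rd; split=> [[gam LDg [H H2]]|[K0 J0 J2]].
  have [mu mu0 [h0 h1 h2]] := contact_orders sx LDg rd.
  have J0 : contactJ1 x 0 = 0.
    have := H 1%N isT; rewrite derive1n1 h1 => /eqP.
    by rewrite mulf_eq0 (negbTE mu0) => /eqP.
  split; [exact: etrans (esym h0) (H 0%N isT)|exact: J0|].
  by move: H2; rewrite (h2 J0) mulf_eq0 negb_or => /andP[].
have [gam LDg] := exists_LD_param sx d0 rd; exists gam; first exact: LDg.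
have [mu mu0 [h0 h1 h2]] := contact_orders sx LDg rd; split.
  by case=> [|[|//]] _; [rewrite derive1n0 h0|rewrite derive1n1 h1 J0 mulr0].
by rewrite (h2 J0); apply: mulf_neq0; [exact: expf_neq0|exact: J2].
Qed.

Definition tangency x := [/\ delta x 0 = 0, regular_at (delta x) 0, Kbar x 0 = 0,
  regular_at (Kbar x) 0 & contactJ1 x 0 = 0].

(** Only vanishing conditions, so that the complement is open among all germs. On [G7] the first
    three hold and the fourth is the negation of exact contact 2. *)
Definition degenerate x :=
  [/\ delta x 0 = 0, Kbar x 0 = 0, contactJ1 x 0 = 0 & contactJ2 x 0 = 0].

Lemma surface_ofP (x y : @paramType R) :
  surface_of x = surface_of y <-> same_surface (set_val x) (set_val y).
Proof.
rewrite -[surface_of x]/(\pi_({eq_quot (@same_surface_equiv R)}) x).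
rewrite -[surface_of y]/(\pi_({eq_quot (@same_surface_equiv R)}) y).
split=> [/(@eqmodP _ (@same_surface_equiv R))/asboolP//|xy].
by apply/(@eqmodP _ (@same_surface_equiv R))/asboolP.
Qed.

Lemma surface_of_surj (M : @surface_germ R) : exists x : @paramType R, surface_of x = M.
Proof. by exists (repr M); rewrite /surface_of reprK. Qed.

Lemma param_smooth (x : @paramType R) : smooth_near 0 (set_val x).
Proof. by have [] := set_valP x. Qed.

Lemma degenerate_same (x y : @paramType R) : surface_of x = surface_of y ->
  degenerate (set_val x) -> degenerate (set_val y).
Proof.
move=> /surface_ofP xy [d0 K0 J1 J2].
have [? ? _ _ /(_ J1) [? /(_ J2)]] := same_surface_contact (param_smooth x) xy d0 K0.
by split.
Qed.

Lemma tangency_same (x y : @paramType R) : surface_of x = surface_of y ->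
  tangency (set_val x) -> tangency (set_val y).
Proof.
move=> /surface_ofP xy [d0 rd K0 rK J1].
have [? ? /(_ rd)? /(_ rK)? /(_ J1) [? _]] := same_surface_contact (param_smooth x) xy d0 K0.
by split.
Qed.

Lemma G7P (x : @paramType R) : G7 (surface_of x) <-> tangency (set_val x).
Proof.
split=> [/(_ x erefl)[d0 rd K0 rK c]|tx y yx].
  have [_ J1] := (contact_gt1P (param_smooth x) d0 rd).1 c.
  by split; [exact: d0|exact: rd|exact: K0|exact: rK|exact: J1].
have [d0 rd K0 rK J1] := tangency_same (esym yx) tx.
split; [exact: d0|exact: rd|exact: K0|exact: rK|].
exact: ((contact_gt1P (param_smooth y) d0 rd).2 (conj K0 J1)).
Qed.

Lemma contact_is_twoP (x : @paramType R) : tangency (set_val x) ->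
  contact_is_two (surface_of x) <-> contactJ2 (set_val x) 0 != 0.
Proof.
move=> tx; split=> [/(_ x erefl)|J2 y yx].
  have [d0 rd _ _ _] := tx.
  by move=> /(contact_eq2P (param_smooth x) d0 rd)[].
have [d0 rd K0 rK J1] := tangency_same (esym yx) tx.
apply/(contact_eq2P (param_smooth y) d0 rd); split; [exact: K0|exact: J1|].
apply/eqP => J2y; have : degenerate (set_val y) by split.
by move=> /(degenerate_same yx)[_ _ _ /eqP]; rewrite (negbTE J2).
Qed.

Definition nondegenerate_surfaces : set (@surface_germ R) :=
  [set M | forall x : @paramType R, surface_of x = M -> ~ degenerate (set_val x)].

(** In the quotient topology openness is tested on parametrizations. By invariance one
    representative decides, and nondegeneracy is the union of four conditions, each the nonvanishing
    of a continuous function of the jet. *)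
Lemma open_nondegenerate : open nondegenerate_surfaces.
Proof.
have E : surface_of @^-1` nondegenerate_surfaces =
    [set x : @paramType R | delta (set_val x) 0 != 0] `|` [set x : @paramType R | Kbar (set_val x) 0 != 0] `|`
    [set x : @paramType R | contactJ1 (set_val x) 0 != 0] `|` [set x : @paramType R | contactJ2 (set_val x) 0 != 0].
  apply/seteqP; split=> x /=.
    move=> /(_ x erefl) nd.
    have [h1|h1] := eqVneq (delta (set_val x) 0) 0; last by do 3 left.
    have [h2|h2] := eqVneq (Kbar (set_val x) 0) 0; last by do 2 left; right.
    have [h3|h3] := eqVneq (contactJ1 (set_val x) 0) 0; last by left; right.
    have [h4|h4] := eqVneq (contactJ2 (set_val x) 0) 0; last by right.
    by case: nd.
  move=> H y yx /(degenerate_same yx)[h1 h2 h3 h4].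
  by move: H; rewrite h1 h2 h3 h4 eqxx => -[[[]|]|].
have op (f : @paramType R -> plane -> R) : jet_continuous f -> open [set x : @paramType R | f x 0 != 0].
  move=> /jet_continuous_val cf.
  rewrite (_ : [set _ | _] = (fun x : @paramType R => f x 0) @^-1` [set r : R | r != 0])//.
  by apply: open_comp => [x _|]; [exact: cf|exact: open_neq].
have : open (surface_of @^-1` nondegenerate_surfaces).
  rewrite E; apply: openU; last exact: op jet_continuous_J2.
  apply: openU; last exact: op jet_continuous_J1.
  by apply: openU; [exact: op jet_continuous_delta|exact: op jet_continuous_Kbar].
exact.
Qed.

End ContactConditions.

(** * The quartic perturbation of a surface *)

Section Density.
Context {R : realType}.
Local Notation plane := 'rV[R]_2.
Local Notation space := 'rV[R]_3.

Section CoordinateFunctions.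
Variables (n : nat) (A : set 'rV[R]_n).
Hypothesis oA : open A.

Lemma smooth_on_coord_id j : smooth_on A (fun z : 'rV[R]_n => z 0 j).
Proof.
apply: (smooth_on_coord oA (f := idfun)); apply: smooth_on_linear => //.
by move=> z; exact: cvg_id.
Qed.

Lemma derive_coord_id (v z : 'rV[R]_n) j : A z -> 'D_v (fun z : 'rV[R]_n => z 0 j) z = v 0 j.
Proof.
have sid : smooth_on A (@idfun 'rV[R]_n).
  by apply: smooth_on_linear => // y; exact: cvg_id.
by move=> Az; apply: etrans (derive_coord_on v Az j sid) _; rewrite derive_id.
Qed.

End CoordinateFunctions.

Local Opaque delta Kbar.

Section Quartic.
Variables (A : set plane) (x : plane -> space) (N : space) (a b eps : R).
Hypotheses (oA : open A) (A0 : A 0) (sx : smooth_on A x).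

Definition lin_form (z : plane) : R := a * z 0 0 + b * z 0 1.

Lemma smooth_on_lin_form : smooth_on A lin_form.
Proof.
have sc (c : R) : smooth_on A (fun=> c) by exact: smooth_on_cst.
have s := smooth_on_coord_id oA.
exact: (smooth_onD oA (smooth_onM oA (sc a) (s 0)) (smooth_onM oA (sc b) (s 1))).
Qed.

Lemma derive_lin_form v z : A z -> 'D_v lin_form z = lin_form v.
Proof.
move=> Az; have sc (c : R) : smooth_on A (fun=> c) by exact: smooth_on_cst.
have s := smooth_on_coord_id oA.
apply: etrans (deriveD_on v Az (smooth_onM oA (sc a) (s 0)) (smooth_onM oA (sc b) (s 1))) _.
apply: (congr2 +%R).
  apply: etrans (deriveM_on v Az (sc a) (s 0)) _.
  by rewrite derive_cst mul0r add0r (derive_coord_id v 0 Az).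
apply: etrans (deriveM_on v Az (sc b) (s 1)) _.
by rewrite derive_cst mul0r add0r (derive_coord_id v 1 Az).
Qed.

Lemma lin_form0 : lin_form 0 = 0.
Proof. by rewrite /lin_form !mxE !mulr0 addr0. Qed.

Lemma eqo_bracket k (f f' g g' : plane -> R) : eqo A k.+1 f f' -> eqo A k.+1 g g' ->
  eqo A k (bracket f g) (bracket f' g').
Proof.
move=> hf hg; have df v := eqo_derive oA A0 v hf; have dg v := eqo_derive oA A0 v hg.
exact: (eqoB oA A0 (eqoM oA A0 (df eu) (dg ev)) (eqoM oA A0 (df ev) (dg eu))).
Qed.

Lemma bracketDr (f g h : plane -> R) z : A z -> smooth_on A g -> smooth_on A h ->
  bracket f (fun z => g z + h z) z = bracket f g z + bracket f h z.
Proof.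
move=> Az sg sh; rewrite /bracket.
have E v := deriveD_on v Az sg sh; rewrite (E eu) (E ev).
move: ('D_eu f z) ('D_ev f z) ('D_eu g z) ('D_ev g z) => *.
by move: ('D_eu h z) ('D_ev h z) => *; ring.
Qed.

Lemma bracketMr (f g h : plane -> R) z : A z -> smooth_on A g -> smooth_on A h ->
  bracket f (fun z => g z * h z) z = bracket f g z * h z + g z * bracket f h z.
Proof.
move=> Az sg sh; rewrite /bracket.
have E v := deriveM_on v Az sg sh; rewrite (E eu) (E ev).
move: ('D_eu f z) ('D_ev f z) ('D_eu g z) ('D_ev g z) (g z) (h z) => *.
by move: ('D_eu h z) ('D_ev h z) => *; ring.
Qed.

Definition quartic (z : plane) : R := eps * lin_form z ^+ 4.

Local Notation P := (hess_form eu ev x lin_form N 2).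
Local Notation L := lin_form.

Let sT : smooth_on A (fun _ : plane => eps). Proof. exact: smooth_on_cst. Qed.

Let eqo_delta : eqo A 3 (delta (perturb x quartic N)) (delta x).
Proof.
rewrite !deltaE.
exact: (@deltaD_monomial _ _ _ eu ev oA A0 x (fun=> eps) L N 0 2 sx sT smooth_on_lin_form
  (fun vs s => False_ind _ (notF s)) lin_form0).
Qed.

Let eqo_Kbar : eqo A 3 (Kbar (perturb x quartic N)) (fun z => Kbar x z + P z * (eps * L z ^+ 2)).
Proof.
have D0 v (z : plane) : A z -> 'D_v (fun _ : plane => eps) z = 0 by rewrite derive_cst.
rewrite !KbarF.
exact: (@KD_monomial _ _ _ eu ev oA A0 x (fun=> eps) L L N 0 2 sx sT smooth_on_lin_form
  (D0 eu) (D0 ev) (fun vs s => False_ind _ (notF s)) lin_form0 derive_lin_form isT).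
Qed.

Let sL := smooth_on_lin_form.
Let sP : smooth_on A P. Proof. exact: smooth_on_hess_form. Qed.
Let sLP : smooth_on A (fun z => P z * (eps * L z)).
Proof. exact: (smooth_onM oA sP (smooth_onM oA sT sL)). Qed.
Let sh : smooth_on A (fun z => L z * (P z * (eps * L z))).
Proof. exact: (smooth_onM oA sL sLP). Qed.
Let sd := smooth_on_delta oA sx.
Let sK := smooth_on_Kbar oA sx.

(** One factor L is split off so that the bracket with delta of the correction again appears as a
    multiple of L, namely L S. *)
Let hE z : Kbar x z + P z * (eps * L z ^+ 2) = Kbar x z + L z * (P z * (eps * L z)).
Proof. by move: (Kbar x z) (P z) (L z) => *; ring. Qed.

Let S z := 2%:R * (P z * eps) * bracket (delta x) L z + (L z * eps) * bracket (delta x) P z.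

Let bracket_h z : A z -> bracket (delta x) (fun z => Kbar x z + L z * (P z * (eps * L z))) z =
  contactJ1 x z + L z * S z.
Proof.
move=> Az; apply: etrans (bracketDr _ Az sK sh) _; congr (_ + _).
apply: etrans (bracketMr _ Az sL sLP) _; rewrite (bracketMr _ Az sP (smooth_onM oA sT sL)).
rewrite (bracketMr _ Az sT sL).
have -> : bracket (delta x) (fun=> eps) z = 0.
  have c v : 'D_v (fun _ : plane => eps) z = 0 by exact: derive_cst.
  apply: etrans (congr2 (fun p q : R => 'D_eu (delta x) z * p - 'D_ev (delta x) z * q) (c ev) (c eu)) _.
  have z0 (p q : R) : p * 0 - q * 0 = 0 by rewrite !mulr0 subrr.
  exact: z0.
rewrite /S; move: (bracket (delta x) L z) (bracket (delta x) P z) (L z) (P z) => *; ring.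
Qed.

Let eqo_J1 : eqo A 2 (contactJ1 (perturb x quartic N)) (fun z => contactJ1 x z + L z * S z).
Proof.
have K3 := eqo_trans oA A0 eqo_Kbar (eqo_eq oA A0 3 (fun z _ => hE z) _).
have H : eqo A 2 (contactJ1 (perturb x quartic N))
    (bracket (delta x) (fun z => Kbar x z + L z * (P z * (eps * L z)))).
  by apply: eqo_bracket eqo_delta (K3 _); case: eqo_Kbar.
by apply: (eqo_trans oA A0 H); apply: (eqo_eq oA A0 2 bracket_h); case: H.
Qed.

Lemma tangency_perturb : tangency x -> tangency (perturb x quartic N).
Proof.
move=> [d0 rd K0 rK J1].
have [sd' _ _] := eqo_delta; have [sK' sKh _] := eqo_Kbar.
have reg (f g : plane -> R) : smooth_on A f -> smooth_on A g ->
    (forall v, 'D_v g 0 = 'D_v f 0) -> regular_at f 0 -> regular_at g 0.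
  move=> sf sg E /(regular_atP (smooth_on_diff sf A0)) h.
  by apply/(regular_atP (smooth_on_diff sg A0)); rewrite (E eu) (E ev).
have f0 : L 0 * (P 0 * (eps * L 0)) = 0 by rewrite lin_form0 mul0r.
split.
- by rewrite (eqo_val eqo_delta).
- apply: reg sd sd' _ rd => v; exact: (eqo_derive_val oA A0 v eqo_delta).
- by rewrite (eqo_val eqo_Kbar) hE K0 f0 addr0.
- apply: reg sK sK' _ rK => v; apply: etrans (eqo_derive_val oA A0 v eqo_Kbar) _.
  apply: etrans (derive_eq_on oA v (fun z _ => hE z) A0) _.
  apply: etrans (deriveD_on v A0 sK sh) _.
  have z0 (p q r s : R) : p + (q * (r * (eps * 0)) + 0 * s) = p by ring.
  apply: etrans (congr1 (fun r => _ + r) (deriveM_on v A0 sL sLP)) _.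
  by rewrite lin_form0; exact: z0.
- by rewrite (eqo_val eqo_J1) J1 lin_form0 mul0r addr0.
Qed.

(** Each bracket with delta must fall on one of the two factors L of the correction eps P L^2, since
    any factor L left over vanishes at 0. The two orders of doing so give the coefficient 2. *)
Lemma contactJ2_perturb : contactJ2 (perturb x quartic N) 0 =
  contactJ2 x 0 + 2%:R * (P 0 * eps) * bracket (delta x) L 0 ^+ 2.
Proof.
have sB (g : plane -> R) : smooth_on A g -> smooth_on A (bracket (delta x) g).
  by move=> sg; exact: smooth_on_bracket oA sd sg.
have s2 : smooth_on A (fun=> 2%:R : R) by exact: smooth_on_cst.
have sS : smooth_on A S.
  exact: (smooth_onD oA (smooth_onM oA (smooth_onM oA s2 (smooth_onM oA sP sT)) (sB _ sL))
    (smooth_onM oA (smooth_onM oA sL sT) (sB _ sP))).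
have H := eqo_val (eqo_bracket (eqoW (isT : 2 <= 3)%N eqo_delta) eqo_J1).
apply: etrans H _; apply: etrans (bracketDr _ A0 (sB _ sK) (smooth_onM oA sL sS)) _.
apply: (congr2 +%R); first exact: erefl.
apply: etrans (bracketMr _ A0 sL sS) _; rewrite /S lin_form0.
by move: (bracket (delta x) L 0) (P 0) => *; ring.
Qed.

End Quartic.

End Density.

(** * Approximation along continuous curves of germs *)

Section FamiliesOfGerms.
Context {R : realType}.
Local Notation plane := 'rV[R]_2.
Local Notation space := 'rV[R]_3.

Lemma continuous_prod (S : topologicalType) (I : Type) (K : I -> topologicalType)
    (g : S -> prod_topology K) :
  (forall i, continuous (fun s => g s i : K i)) -> continuous g.
Proof.
move=> H s; apply/cvg_sup => i.
exact: (@continuous_comp_initial _ S (K i) (fun f : prod_topology K => f i) g (H i) s).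
Qed.

Lemma continuous_to_param (S : topologicalType) (F : S -> @paramType R) :
  jet_continuous (fun s => set_val (F s)) -> continuous F.
Proof.
move=> [_ H]; apply: continuous_comp_initial.
by apply: continuous_prod => vs; exact: H.
Qed.

Lemma continuous_to_deformation (S : topologicalType) (F : S -> @deformationType R) :
  jet_continuous (fun s => set_val (F s)) -> continuous F.
Proof.
move=> [_ H]; apply: continuous_comp_initial.
by apply: continuous_prod => vs; exact: H.
Qed.

Lemma jet_continuous_const (V : normedModType R) : jet_continuous (fun (s : R) (_ : V) => s).
Proof.
split=> [s|vs]; first by apply: (smooth_on_near (A := setT) openT) => //; exact: smooth_on_cst.
case: vs => [|v vs]; first by move=> s; exact: cvg_id.
have -> : (fun s : R => iterD (v :: vs) (fun _ : V => s) 0) = fun=> 0.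
  apply/funext => s; rewrite [LHS]/(iterD vs (fun z => 'D_v (fun _ : V => s) z) 0).
  have -> : (fun z => 'D_v (fun _ : V => s) z) = (fun=> 0).
    by apply/funext => z; exact: derive_cst.
  elim: vs => // w vs IH; rewrite [LHS]/(iterD vs (fun z => 'D_w (fun _ : V => 0 : R) z) 0).
  have -> : (fun z => 'D_w (fun _ : V => 0 : R) z) = (fun=> 0).
    by apply/funext => z; exact: derive_cst.
  exact: IH.
exact: cst_continuous.
Qed.

Lemma near_zero_neq (T : topologicalType) (F : R -> T) (B : set T) :
  continuous F -> nbhs (F 0) B -> exists2 s, s != 0 & B (F s).
Proof.
move=> cF nB; have /nbhs_norm0P[r /= r0 H] := cF 0 B nB.
exists (r / 2); first by rewrite gt_eqF// divr_gt0.
by apply: H => /=; rewrite gtr0_norm ?divr_gt0//; lra.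
Qed.

(** The preimage of an open set of surface germs is open, so approximating one parametrization
    approximates the surface. *)
Lemma closure_surface (P : set (@surface_germ R)) (x : @paramType R) :
  (forall B, nbhs x B -> exists2 y, B y & P (surface_of y)) -> closure P (surface_of x).
Proof.
move=> H B; rewrite nbhsE => -[B' [oB' B'x] B'B].
have oP : open (surface_of @^-1` B') by exact: oB'.
have [y B'y Py] := H _ (open_nbhs_nbhs (conj oP B'x)).
by exists (surface_of y); split=> //; exact: B'B.
Qed.

End FamiliesOfGerms.

Section SurfacePerturbation.
Context {R : realType}.
Local Notation plane := 'rV[R]_2.
Local Notation space := 'rV[R]_3.

(** Kbar is quadratic in the coefficients of the second form, so its differential vanishes wherever
    all of them do. *)
Lemma second_form_neq0 (x : plane -> space) : smooth_near 0 x -> Kbar x 0 = 0 ->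
  regular_at (Kbar x) 0 ->
  [\/ secD eu ev x eu eu 0 != 0, secD eu ev x eu ev 0 != 0 | secD eu ev x ev ev 0 != 0].
Proof.
move=> /smooth_nearP[A [oA A0 sx]] K0 rK.
have sK := smooth_on_Kbar oA sx.
have ss v w := smooth_on_secD eu ev oA v w sx.
have DK v : secD eu ev x eu eu 0 = 0 -> secD eu ev x eu ev 0 = 0 -> secD eu ev x ev ev 0 = 0 ->
    'D_v (Kbar x) 0 = 0.
  move=> h1 h2 h3; rewrite KbarF.
  apply: etrans (deriveB_on v A0 (smooth_onM oA (ss _ _) (ss _ _)) (smooth_onX oA 2 (ss _ _))) _.
  rewrite -[RHS](subrr 0); apply: (congr2 (fun a b : R => a - b)).
    apply: etrans (deriveM_on v A0 (ss _ _) (ss _ _)) _.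
    apply: etrans (congr2 (fun a b : R => _ * a + b * _) h3 h1) _.
    have z0 (p q : R) : p * 0 + 0 * q = 0 by rewrite mulr0 mul0r addr0.
    exact: z0.
  apply: etrans (deriveM_on v A0 (ss _ _) (ss _ _)) _.
  apply: etrans (congr2 (fun a b : R => _ * a + b * _) h2 h2) _.
  have z0 (p q : R) : p * 0 + 0 * q = 0 by rewrite mulr0 mul0r addr0.
  exact: z0.
have or3 (p q r : R) : (p = 0 -> q = 0 -> r = 0 -> False) -> [\/ p != 0, q != 0 | r != 0].
  move=> H; have [p0|] := eqVneq p 0; last by constructor.
  have [q0|] := eqVneq q 0; last by constructor.
  by have [r0|] := eqVneq r 0; [case: H|constructor].
apply: or3 => h1 h2 h3; have := (regular_atP (smooth_on_diff sK A0)).1 rK.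
by rewrite (DK eu h1 h2 h3) (DK ev h1 h2 h3) eqxx; case.
Qed.

(** The quartic and its differential vanish at 0, so the differential of the parametrization there
    is unchanged and stays injective. *)
Lemma quartic_param (x : @paramType R) (N : space) (a b eps : R) :
  param_germ (perturb (set_val x) (quartic a b eps) N).
Proof.
have /smooth_nearP[A [oA A0 sx]] := param_smooth x.
have sL := smooth_on_lin_form a b oA.
have sc : smooth_on A (fun=> eps) by exact: smooth_on_cst.
have sN : smooth_on A (fun=> N) by exact: smooth_on_cst.
have sQ : smooth_on A (quartic a b eps) by exact: (smooth_onM oA sc (smooth_onX oA 4 sL)).
have sp := smooth_on_perturb oA N sx sQ.
split; first exact: smooth_on_near oA A0 sp.
have [_ imm] := set_valP x => v.
rewrite -(deriveE v (smooth_on_diff sp A0)) => Dv; apply: imm.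
rewrite -(deriveE v (smooth_on_diff sx A0)) -[RHS]Dv.
apply: esym; apply: etrans (deriveD_on v A0 sx (smooth_onZ oA sQ sN)) _.
apply: etrans (congr1 (fun u => _ + u) (deriveZ_on v A0 sQ sN)) _.
have Q0 : quartic a b eps 0 = 0 by rewrite /quartic lin_form0 expr0n mulr0.
have DQ : 'D_v (quartic a b eps) 0 = 0.
  apply: etrans (deriveM_on v A0 sc (smooth_onX oA 4 sL)) _.
  apply: etrans (congr2 (fun p q : R => p * _ + _ * q)
    (derive_cst eps 0 v) (deriveXS_on oA 3 v sL A0)) _.
  have z0 (p q r : R) : 0 * p + r * (4%:R * 0 ^+ 3 * q) = 0 by ring.
  by rewrite lin_form0; exact: z0.
rewrite Q0 DQ.
have z0 (p q r : space) : p + (0 *: q + 0 *: r) = p by rewrite !scale0r !addr0.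
exact: z0.
Qed.

End SurfacePerturbation.

Section DenseContact.
Context {R : realType}.
Local Notation plane := 'rV[R]_2.
Local Notation space := 'rV[R]_3.

Lemma lin_form_eu (a b : R) : lin_form a b eu = a.
Proof. by rewrite /lin_form eu0 eu1 mulr1 mulr0 addr0. Qed.

Lemma lin_form_ev (a b : R) : lin_form a b ev = b.
Proof. by rewrite /lin_form ev0 ev1 mulr1 mulr0 add0r. Qed.

Definition quartic_family (x : @paramType R) (N : space) (a b eps : R) : @paramType R :=
  SigSub (mem_set (quartic_param x N a b eps)).

Lemma quartic_familyE x N a b eps :
  set_val (quartic_family x N a b eps) = perturb (set_val x) (quartic a b eps) N.
Proof. by []. Qed.

Lemma quartic_family0 x N a b : quartic_family x N a b 0 = x.
Proof.
apply: val_inj; apply/funext => z.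
have z0 (p : space) (r : R) : p + (0 * r) *: N = p by rewrite mul0r scale0r addr0.
exact: z0.
Qed.

Lemma continuous_quartic_family x N a b : continuous (quartic_family x N a b).
Proof.
apply: continuous_to_param.
have sL : smooth_near 0 (fun z : plane => lin_form a b z ^+ 4).
  apply: (smooth_on_near (A := setT) openT) => //.
  exact: (smooth_onX openT 4 (smooth_on_lin_form a b openT)).
have H := jet_continuous_scale N (jet_continuousM (@jet_continuous_const R plane)
  (jet_continuous_cst R sL)).
exact: (jet_continuousD (jet_continuous_cst R (param_smooth x)) H).
Qed.

Lemma tangency_dense (x : @paramType R) (B : set (@paramType R)) : tangency (set_val x) -> nbhs x B ->
  exists2 y, B y & tangency (set_val y) /\ contactJ2 (set_val y) 0 != 0.
Proof.
move=> tx nB; have [J20|J2] := EM (contactJ2 (set_val x) 0 = 0); last first.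
  exists x; first exact: nbhs_singleton nB.
  by split; [exact: tx|exact/eqP/J2].
have [d0 rd K0 rK J1] := tx.
have /smooth_nearP[A [oA A0 sx]] := param_smooth x.
have sd := smooth_on_delta oA sx.
have s3 := second_form_neq0 (param_smooth x) K0 rK.
have [v [w s0]] : exists v w, secD eu ev (set_val x) v w 0 != 0.
  by case: s3 => h; [exists eu, eu|exists eu, ev|exists ev, ev]; exact: h.
have rd' := (regular_atP (smooth_on_diff sd A0)).1 rd.
have [a [b [ab1 ab2]]] := isotropic_choice rd' s3.
(* A second derivative with nonzero second form coefficient: its component across the tangent plane
   is precisely that coefficient. *)
pose N := 'D_w ('D_v (set_val x)) 0.
have nB' : nbhs (quartic_family x N a b 0) B by rewrite quartic_family0.
have [eps eps0 Beps] := near_zero_neq (@continuous_quartic_family x N a b) nB'.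
exists (quartic_family x N a b eps); first exact: Beps.
rewrite quartic_familyE; split; first exact: tangency_perturb oA A0 sx tx.
rewrite (contactJ2_perturb N a b eps oA A0 sx) J20 add0r.
have br : bracket (delta (set_val x)) (lin_form a b) 0 != 0.
  have E : bracket (delta (set_val x)) (lin_form a b) 0 =
      'D_eu (delta (set_val x)) 0 * b - 'D_ev (delta (set_val x)) 0 * a.
    apply: etrans (congr2 (fun p q : R => 'D_eu (delta (set_val x)) 0 * p - 'D_ev (delta (set_val x)) 0 * q)
      (derive_lin_form a b oA ev A0) (derive_lin_form a b oA eu A0)) _.
    by rewrite lin_form_eu lin_form_ev.
  by rewrite E.
apply: mulf_neq0; last exact: expf_neq0.
apply: mulf_neq0; first by rewrite pnatr_eq0.
apply: mulf_neq0; last exact: eps0.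
rewrite /hess_form lin_form_eu lin_form_ev.
apply: mulf_neq0; last exact: ab2.
apply: mulf_neq0; last exact: s0.
by apply: mulf_neq0; rewrite pnatr_eq0.
Qed.

End DenseContact.

(** * Families of surfaces *)

Section Slices.
Context {R : realType}.
Local Notation plane := 'rV[R]_2.
Local Notation spacetime := 'rV[R]_(2 + 1).
Local Notation space := 'rV[R]_3.

Definition horiz (v : plane) : spacetime := row_mx v 0.
Definition vert : spacetime := row_mx 0 1%:M.
Definition slice W (Y : spacetime -> W) (t : R) (u : plane) : W := Y (row_mx u t%:M).

Lemma horizE v : horiz v = v 0 0 *: horiz eu + v 0 1 *: horiz ev.
Proof. by rewrite /horiz !scale_row_mx !scaler0 add_row_mx addr0 -plane_eta. Qed.

Lemma horizD v w : horiz (v + w) = horiz v + horiz w.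
Proof. by rewrite /horiz add_row_mx addr0. Qed.

Lemma horizZ (c : R) v : horiz (c *: v) = c *: horiz v.
Proof. by rewrite /horiz scale_row_mx scaler0. Qed.

Lemma row_mx_time (u : plane) t : row_mx u t%:M = horiz u + t *: vert.
Proof. by rewrite /horiz /vert scale_row_mx add_row_mx scaler0 addr0 add0r scale_scalar_mx mulr1. Qed.

Lemma row_mx_time0 (u : plane) : row_mx u 0%:M = horiz u.
Proof. by rewrite row_mx_time scale0r addr0. Qed.

Lemma horiz0 : horiz 0 = 0.
Proof. by rewrite /horiz row_mx0. Qed.

Lemma pt_spacetime (a b : plane) (s w t : R) :
  pt (horiz a) (horiz b) vert s w t = row_mx (s *: a + w *: b) t%:M.
Proof. by rewrite /pt -!horizZ -horizD -row_mx_time. Qed.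

Lemma lsubmx_slice (u : plane) t : lsubmx (row_mx u (t%:M : 'M[R]_1)) = u.
Proof. exact: row_mxKl. Qed.

Lemma derive_slice_fun (W : normedModType R) (Y : spacetime -> W) t v :
  'D_v (slice Y t) = slice ('D_(horiz v) Y) t.
Proof. by apply/funext => u; exact: derive_slice. Qed.

Lemma derive_slice2 (W : normedModType R) (Y : spacetime -> W) t v w u :
  'D_w ('D_v (slice Y t)) u = 'D_(horiz w) ('D_(horiz v) Y) (row_mx u t%:M).
Proof. by rewrite derive_slice_fun; exact: derive_slice. Qed.

Lemma deltaD_slice (Y : spacetime -> space) t u :
  delta (slice Y t) u = deltaD (horiz eu) (horiz ev) Y (row_mx u t%:M).
Proof.
have E v := derive_slice Y t v u.
have T (a a' b b' : space) : a = a' -> b = b' -> mink a b ^+ 2 - mink a a * mink b b =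
    mink a' b' ^+ 2 - mink a' a' * mink b' b' by move=> -> ->.
exact: T (E eu) (E ev).
Qed.

Lemma secD_slice (Y : spacetime -> space) t v w u :
  secD eu ev (slice Y t) v w u = secD (horiz eu) (horiz ev) Y (horiz v) (horiz w) (row_mx u t%:M).
Proof.
have T (a a' b b' c c' : space) : a = a' -> b = b' -> c = c' -> triple a b c = triple a' b' c'.
  by move=> -> -> ->.
exact: T (derive_slice Y t eu u) (derive_slice Y t ev u) (derive_slice2 Y t v w u).
Qed.

Lemma Kbar_slice (Y : spacetime -> space) t u :
  Kbar (slice Y t) u = KD (horiz eu) (horiz ev) Y (row_mx u t%:M).
Proof.
rewrite KbarE.
exact: (congr2 (fun a b : R => a - b) (congr2 *%R (secD_slice Y t eu eu u) (secD_slice Y t ev ev u))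
  (congr1 (fun a : R => a ^+ 2) (secD_slice Y t eu ev u))).
Qed.

Lemma differentiable_slice (W : normedModType R) (F : spacetime -> W) t u :
  differentiable F (row_mx u t%:M) -> differentiable (slice F t) u.
Proof.
move=> dF; apply: (@differentiable_comp _ _ _ _ (fun u : plane => row_mx u t%:M : spacetime) F) => //.
have -> : (fun u : plane => row_mx u t%:M : spacetime) =
    (fun u : plane => u 0 0 *: horiz eu + u 0 1 *: horiz ev + t *: vert).
  by apply/funext => v; rewrite row_mx_time horizE.
have d j (v : spacetime) : differentiable (fun u : plane => u 0 j *: v) u.
  by apply: differentiable_scale; [exact: differentiable_coord|exact: differentiable_cst].
apply: (@differentiableD _ _ _ (fun u : plane => u 0 0 *: horiz eu + u 0 1 *: horiz ev) (cst (t *: vert))).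
  exact: (@differentiableD _ _ _ (fun u : plane => u 0 0 *: horiz eu) (fun u : plane => u 0 1 *: horiz ev)).
exact: differentiable_cst.
Qed.

(** The factor is the determinant of the frame ([tang f], [grad f]) in the standard basis, which
    turns the jacobian in the frame used for the fold into the bracket. *)
Lemma tang_grad_bracket (f g h : plane -> R) q : differentiable g q -> differentiable h q ->
  'D_(tang f) g q * 'D_(grad f) h q - 'D_(grad f) g q * 'D_(tang f) h q =
  - ('D_eu f 0 ^+ 2 + 'D_ev f 0 ^+ 2) * bracket g h q.
Proof.
move=> dg dh.
have alg (a b p m r s : R) : (a * m - b * p) * (a * r + b * s) - (a * p + b * m) * (a * s - b * r) =
    - (a ^+ 2 + b ^+ 2) * (p * s - m * r) by ring.
exact: etrans (congr2 (fun a b : R => a - b) (congr2 *%R (tang_dir f dg) (grad_dir f dh))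
  (congr2 *%R (grad_dir f dg) (tang_dir f dh))) (alg _ _ _ _ _ _).
Qed.

Lemma transversal_bracket (f g : plane -> R) q : differentiable f q -> differentiable g q ->
  bracket f g q != 0 -> transversal_at f g q.
Proof.
move=> df dg; have Df v := etrans (esym (deriveE v df)) (derive_plane v df).
have Dg v := etrans (esym (deriveE v dg)) (derive_plane v dg).
have alg (a b c d p r : R) : a * d - b * c != 0 -> p * a + r * b = 0 -> p * c + r * d = 0 ->
    p = 0 /\ r = 0.
  move=> n0 h1 h2; split; apply: (mulfI n0); rewrite mulr0.
    have -> : (a * d - b * c) * p = d * (p * a + r * b) - b * (p * c + r * d) by ring.
    by rewrite h1 h2 !mulr0 subrr.
  have -> : (a * d - b * c) * r = a * (p * c + r * d) - c * (p * a + r * b) by ring.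
  by rewrite h1 h2 !mulr0 subrr.
have nz (a b c d : R) : a * d - b * c != 0 -> (a != 0 \/ b != 0) /\ (c != 0 \/ d != 0).
  move=> n0; split; apply/orP; rewrite -negb_and; apply: contraNN n0 => /andP[/eqP-> /eqP->].
    by rewrite !mul0r subrr.
  by rewrite !mulr0 subrr.
move=> J; have [rf rg] := nz _ _ _ _ J; split.
- exact/(regular_atP df).
- exact/(regular_atP dg).
move=> v fv gv; have [v0 v1] := alg _ _ _ _ _ _ J (etrans (esym (Df v)) fv) (etrans (esym (Dg v)) gv).
by rewrite (plane_eta v) v0 v1 !scale0r addr0.
Qed.

End Slices.

Section SurfaceFamilies.
Context {R : realType}.
Local Notation plane := 'rV[R]_2.
Local Notation spacetime := 'rV[R]_(2 + 1).
Local Notation space := 'rV[R]_3.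

Local Opaque delta Kbar.

Lemma smooth_lsubmx (W : normedModType R) (x : plane -> W) : smooth_near 0 x ->
  smooth_near 0 (fun z : spacetime => x (lsubmx z)).
Proof.
move=> sx.
have E z : lsubmx z = z 0 (lshift 1 0) *: eu + z 0 (lshift 1 1) *: ev :> plane.
  by rewrite (plane_eta (lsubmx z)) !mxE.
have sl : smooth_near 0 (fun z : spacetime => lsubmx z : plane).
  apply: (smooth_on_near (A := setT) openT) => //.
  have sc v : smooth_on setT (fun _ : spacetime => v : plane) by exact: smooth_on_cst.
  have s j : smooth_on setT (fun z : spacetime => z 0 j) by exact: smooth_on_coord_id openT _.
  apply: (smooth_on_eq openT (fun z _ => esym (E z))).
  exact: (smooth_onD openT (smooth_onZ openT (s _) (sc _)) (smooth_onZ openT (s _) (sc _))).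
have l0 : lsubmx (0 : spacetime) = 0 :> plane by rewrite linear0.
by apply: (smooth_near_comp (f := x) sl); rewrite l0.
Qed.

Lemma slice_eq_on (A : set plane) (x y : plane -> space) u : open A -> A u ->
  (forall z, A z -> x z = y z) -> delta x u = delta y u /\ Kbar x u = Kbar y u /\
  forall v w, secD eu ev x v w u = secD eu ev y v w u.
Proof.
move=> oA Au xy; have E v z (Az : A z) := derive_eq_on oA v xy Az.
have E2 v w := derive_eq_on oA w (E v) Au.
have T (a a' b b' : space) : a = a' -> b = b' -> mink a b ^+ 2 - mink a a * mink b b =
    mink a' b' ^+ 2 - mink a' a' * mink b' b' by move=> -> ->.
have T3 (a a' b b' c c' : space) : a = a' -> b = b' -> c = c' -> triple a b c = triple a' b' c'.
  by move=> -> -> ->.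
have S v w : secD eu ev x v w u = secD eu ev y v w u.
  exact: T3 (E eu u Au) (E ev u Au) (E2 v w).
split; first by rewrite !deltaE; exact: T (E eu u Au) (E ev u Au).
split; last exact: S.
rewrite !KbarE.
exact: (congr2 (fun a b : R => a - b) (congr2 *%R (S eu eu) (S ev ev))
  (congr1 (fun a : R => a ^+ 2) (S eu ev))).
Qed.

(** A horizontal derivative at time 0 sees only the restriction to time 0. The whole two-dimensional
    analysis of x thus transfers to space-time. *)
Lemma derive_horiz (A : set plane) (f : spacetime -> R) (g : plane -> R) : open A ->
  (forall u, A u -> f (horiz u) = g u) ->
  forall v u, A u -> 'D_(horiz v) f (horiz u) = 'D_v g u.
Proof.
move=> oA fg v u Au; rewrite -[X in 'D_(horiz v) f X]row_mx_time0.
apply: etrans (esym (derive_slice f 0 v u)) _.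
by apply: (derive_eq_on oA v _ Au) => z /fg <-; rewrite row_mx_time0.
Qed.

Section OneFamily.
Variables (x : plane -> space) (Y : spacetime -> space).
Hypotheses (snx : smooth_near 0 x) (snY : smooth_near 0 Y)
  (Y0 : \forall u \near (0 : plane), slice Y 0 u = x u)
  (tx : tangency x) (J2 : contactJ2 x 0 != 0).

Local Notation F := (deltaD (horiz eu) (horiz ev) Y).
Local Notation G := (KD (horiz eu) (horiz ev) Y).
Local Notation e1 := (horiz (tang (delta x))).
Local Notation e2 := (horiz (grad (delta x))).

(* Up to a nonzero factor, the time derivative of Kbar along the LD, at the
   point of tangency. *)
Definition crossing_speed : R := 'D_vert G 0 * 'D_e2 F 0 - 'D_e2 G 0 * 'D_vert F 0.

Lemma family_chart : exists (A : set plane) (N : set spacetime),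
  [/\ open A /\ A 0, open N /\ N 0, smooth_on A x, smooth_on N Y &
  forall u, A u -> N (horiz u) /\ slice Y 0 u = x u].
Proof.
have /smooth_nearP[B [oB B0 sx]] := snx; have /smooth_nearP[N [oN N0 sY]] := snY.
have ch : {for 0, continuous (slice (@id spacetime) 0)}.
  apply: differentiable_continuous; apply: differentiable_slice.
  by apply: (@linear_differentiable _ _ _ idfun) => y; exact: cvg_id.
have nN : \forall u \near (0 : plane), N (row_mx u 0%:M).
  by apply: ch; rewrite /slice row_mx_time0 horiz0; exact: open_nbhs_nbhs.
have : nbhs (0 : plane) [set u | [/\ B u, N (row_mx u 0%:M) & slice Y 0 u = x u]].
  by near=> u; split; near: u; [exact: open_nbhs_nbhs|exact: nN|exact: Y0].
rewrite nbhsE => -[A [oA A0] AP]; exists A, N; split=> //.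
  by apply: smooth_on_sub sx => u /AP[].
by move=> u /AP[_ + ?]; rewrite row_mx_time0.
Unshelve. all: by end_near. Qed.

Lemma family_fold : crossing_speed != 0 -> exists N1 : set spacetime,
  [/\ open N1 /\ N1 0, smooth_on N1 F, smooth_on N1 G & exists sgn, fold_split F e1 e2 vert G sgn].
Proof.
move=> T0; have [A [N [[oA A0] [oN N0] sx sY AN]]] := family_chart.
have [d0 rd K0 rK J1] := tx.
have sd := smooth_on_delta oA sx; have sK := smooth_on_Kbar oA sx.
have sF := smooth_on_deltaD (horiz eu) (horiz ev) oN sY.
have sG := smooth_on_KD (horiz eu) (horiz ev) oN sY.
have FE u (Au : A u) : F (horiz u) = delta x u.
  rewrite -[horiz u]row_mx_time0 -deltaD_slice.
  by have [] := slice_eq_on oA Au (fun z Az => (AN z Az).2).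
have GE u (Au : A u) : G (horiz u) = Kbar x u.
  rewrite -[horiz u]row_mx_time0 -Kbar_slice.
  by have [_ []] := slice_eq_on oA Au (fun z Az => (AN z Az).2).
have DF := derive_horiz oA FE; have DG := derive_horiz oA GE.
have h0 := @horiz0 R.
have gd := grad_gt0 (smooth_on_diff sd A0) rd.
have D20 : 'D_e2 F 0 = 'D_(grad (delta x)) (delta x) 0 by rewrite -[in LHS]h0; exact: DF.
have : nbhs (0 : spacetime) [set p | N p /\ 0 < 'D_e2 F p].
  have /cvgr_gt H : {for 0, continuous ('D_e2 F)}.
    by apply: smooth_on_cont N0; exact: smooth_on_derive.
  have {}H : \forall p \near (0 : spacetime), 0 < 'D_e2 F p by apply: H; rewrite D20.
  exact: filterI (open_nbhs_nbhs (conj oN N0)) H.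
rewrite nbhsE => -[N1 [oN1 N10] N1P].
have N1N p : N1 p -> N p by move=> /N1P[].
have sF1 : smooth_on N1 F by exact: smooth_on_sub sF.
have sG1 : smooth_on N1 G by exact: smooth_on_sub sG.
exists N1; split; [exact: (conj oN1 N10)|exact: sF1|exact: sG1|].
have D2F p : N1 p -> 0 < 'D_e2 F p by move=> /N1P[].
have F0 : F 0 = 0 by rewrite -[X in F X]h0 FE.
have G0 : G 0 = 0 by rewrite -[X in G X]h0 GE.
have ddx := smooth_on_diff sd A0; have dKx := smooth_on_diff sK A0.
have D1F : 'D_e1 F 0 = 0.
  rewrite -[X in 'D_e1 F X]h0; apply: etrans (DF _ _ A0) _.
  apply: etrans (tang_dir (delta x) ddx) _.
  have z (a b : R) : a * b - b * a = 0 by ring.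
  exact: z.
have D1G : 'D_e1 G 0 = 0.
  rewrite -[X in 'D_e1 G X]h0; apply: etrans (DG _ _ A0) _.
  exact: etrans (tang_dir (delta x) dKx) J1.
pose c := - ('D_eu (delta x) 0 ^+ 2 + 'D_ev (delta x) 0 ^+ 2).
have c0 : c != 0.
  have E : 'D_(grad (delta x)) (delta x) 0 = - c.
    apply: etrans (grad_dir (delta x) ddx) _.
    by rewrite /c; move: ('D_eu (delta x) 0) ('D_ev (delta x) 0) => a b; ring.
  by rewrite -oppr_eq0 -E gt_eqF.
(* At time 0 this jacobian is c times [contactJ1 x], and differentiating that along [tang (delta x)]
   at 0 is taking its bracket with delta, which gives c times [contactJ2 x 0]. *)
have DJ : 'D_e1 (fun p => 'D_e1 F p * 'D_e2 G p - 'D_e2 F p * 'D_e1 G p) 0 != 0.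
  have JE u (Au : A u) : 'D_e1 F (horiz u) * 'D_e2 G (horiz u) - 'D_e2 F (horiz u) * 'D_e1 G (horiz u) =
      c * contactJ1 x u.
    apply: etrans (congr2 (fun a b : R => a - b) (congr2 *%R (DF _ u Au) (DG _ u Au))
      (congr2 *%R (DF _ u Au) (DG _ u Au))) _.
    exact: (tang_grad_bracket (delta x) (smooth_on_diff sd Au) (smooth_on_diff sK Au)).
  have sJ : smooth_on A (contactJ1 x) by exact: smooth_on_bracket.
  have sc : smooth_on A (fun=> c) by exact: smooth_on_cst.
  have E : 'D_e1 (fun p => 'D_e1 F p * 'D_e2 G p - 'D_e2 F p * 'D_e1 G p) 0 = c * contactJ2 x 0.
    rewrite -[X in 'D_e1 _ X]h0; apply: etrans (derive_horiz oA JE (tang (delta x)) A0) _.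
    apply: etrans (deriveM_on (tang (delta x)) A0 sc sJ) _.
    apply: etrans (congr2 (fun a b : R => a * _ + c * b) (derive_cst c 0 (tang (delta x)))
      (tang_dir (delta x) (smooth_on_diff sJ A0))) _.
    by rewrite mul0r add0r.
  by rewrite E; apply: mulf_neq0; [exact: c0|exact: J2].
exact: (fold_splitP oN1 N10 sF1 D2F F0 D1F sG1 G0 D1G DJ T0).
Qed.

End OneFamily.

End SurfaceFamilies.

(** * From the fold in space-time to the two plane curves *)

Section Transition.
Context {R : realType}.
Local Notation plane := 'rV[R]_2.
Local Notation spacetime := 'rV[R]_(2 + 1).
Local Notation space := 'rV[R]_3.

Local Opaque delta Kbar.

(** The vectors a and b are orthogonal with squared norm D, hence the dual coordinates s and w. They
    turn the box of [fold_split] into a neighbourhood in the plane. *)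
Lemma tang_grad_coord (p q : R) : 0 < p ^+ 2 + q ^+ 2 ->
  let D := p ^+ 2 + q ^+ 2 in let a : plane := - q *: eu + p *: ev in
  let b : plane := p *: eu + q *: ev in
  let s := lin_form (- q / D) (p / D) in let w := lin_form (p / D) (q / D) in
  (forall u, u = s u *: a + w u *: b) /\
  (forall x y, s (x *: a + y *: b) = x /\ w (x *: a + y *: b) = y).
Proof.
move=> D0 D a b s w; have Dn : D != 0 by rewrite gt_eqF.
have C (x y : R) j : (x *: eu + y *: ev : plane) 0 j = if j == 0 then x else y.
  by rewrite !mxE /=; case: j => -[|[|//]] i; rewrite /= !(mulr0, mulr1, add0r, addr0).
split=> [u|x y].
  apply/rowP => j; have -> : (s u *: a + w u *: b) 0 j = s u * a 0 j + w u * b 0 j by rewrite !mxE.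
  rewrite /a /b !C /s /w /lin_form /D.
  have Dn' := Dn; rewrite /D in Dn'.
  case: j => -[|[|//]] i /=; [rewrite (_ : Ordinal i = 0)|rewrite (_ : Ordinal i = 1)]; try exact: val_inj.
    by move: (u 0 0) (u 0 1) => *; field.
  by move: (u 0 0) (u 0 1) => *; field.
have E j : (x *: a + y *: b) 0 j = x * a 0 j + y * b 0 j by rewrite !mxE.
rewrite /s /w /lin_form !E /a /b !C /= /D.
have Dn' := Dn; rewrite /D in Dn'.
by split; field.
Qed.

Variables (x : plane -> space) (Y : spacetime -> space).
Hypotheses (snx : smooth_near 0 x) (snY : smooth_near 0 Y)
  (Y0 : \forall u \near (0 : plane), slice Y 0 u = x u)
  (tx : tangency x) (J2 : contactJ2 x 0 != 0).

Lemma family_transition : crossing_speed x Y != 0 -> two_zero_transition (slice Y).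
Proof.
move=> T0; have [N1 [[oN1 N10] sF sG [sgn split_]]] := family_fold snx snY Y0 tx J2 T0.
have [d0 rd _ _ _] := tx; have /smooth_nearP[A [oA A0 sx]] := snx.
have ddx := smooth_on_diff (smooth_on_delta oA sx) A0.
have D0 : 0 < 'D_eu (delta x) 0 ^+ 2 + 'D_ev (delta x) 0 ^+ 2.
  by have := grad_gt0 ddx rd; rewrite (grad_dir (delta x) ddx).
have [decomp coords] := tang_grad_coord D0.
set D := _ + _ in D0 decomp coords.
set s := lin_form _ _ in decomp coords; set w := lin_form _ _ in decomp coords.
rewrite -/(tang (delta x)) -/(grad (delta x)) in decomp coords.
set tg := tang (delta x) in decomp coords; set gr := grad (delta x) in decomp coords.
exists sgn => W nW.
have cl : {for 0, continuous (fun z : spacetime => lsubmx z : plane)}.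
  have /smooth_nearP[B [oB B0 sB]] := smooth_lsubmx (smooth_near_id (0 : plane)).
  exact: smooth_on_cont sB B0.
(* N1 is kept so that delta and Kbar are differentiable at every point of the box, as transversality
   requires. *)
have nW' : nbhs (0 : spacetime) [set z | N1 z /\ W (lsubmx z)].
  apply: filterI (open_nbhs_nbhs (conj oN1 N10)) _.
  by apply: cl; rewrite linear0.
have [rho [r [rho0 r0 [inN H]]]] := split_ _ nW'.
exists [set u | `|s u| < r /\ `|w u| < rho].
have E (u : plane) t : row_mx u t%:M = pt (horiz tg) (horiz gr) vert (s u) (w u) t.
  by rewrite pt_spacetime -decomp.
have LDE t u : delta (slice Y t) u = deltaD (horiz eu) (horiz ev) Y (pt (horiz tg) (horiz gr) vert (s u) (w u) t).
  by rewrite deltaD_slice E.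
have PCE t u : Kbar (slice Y t) u = KD (horiz eu) (horiz ev) Y (pt (horiz tg) (horiz gr) vert (s u) (w u) t).
  by rewrite Kbar_slice E.
split.
- have sl (a b : R) : {for (0 : plane), continuous (lin_form a b)}.
    have sab := smooth_on_lin_form a b (@openT plane).
    exact: (smooth_on_cont sab (I : [set: plane] 0)).
  have near_small a b e : 0 < e -> \forall u \near (0 : plane), `|lin_form a b u| < e.
    move=> e0; have c : lin_form a b u @[u --> (0 : plane)] --> (0 : R).
      by rewrite -[X in _ --> X](lin_form0 a b); exact: sl.
    by move: c => /cvgr0Pnorm_lt; exact.
  exact: filterI (near_small _ _ _ r0) (near_small _ _ _ rho0).
(* Membership in W does not involve the time, so it can be read off at time 0. *)
- move=> u [sr wr]; have [_] := inN _ _ 0 sr wr ltac:(by rewrite normr0).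
  by rewrite -E lsubmx_slice.
move: H (@nbhs0_lt _ R^o r r0); apply: filterS2 => t [pos neg] tr.
split=> [/pos|/neg] K; last first.
  apply/seteqP; split=> // u [[[sr wr] LDu] PCu].
  by apply: (K (s u) (w u) sr wr); split; [rewrite -LDE|rewrite -PCE].
have [s1 [w1 [s2 [w2 [s12 [s1r w1r] [s2r w2r] [Jq1 Jq2] Z]]]]] := K.
have tr_at s' w' : `|s'| < r -> `|w'| < rho ->
    'D_(horiz tg) (deltaD (horiz eu) (horiz ev) Y) (pt (horiz tg) (horiz gr) vert s' w' t) *
    'D_(horiz gr) (KD (horiz eu) (horiz ev) Y) (pt (horiz tg) (horiz gr) vert s' w' t) -
    'D_(horiz gr) (deltaD (horiz eu) (horiz ev) Y) (pt (horiz tg) (horiz gr) vert s' w' t) *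
    'D_(horiz tg) (KD (horiz eu) (horiz ev) Y) (pt (horiz tg) (horiz gr) vert s' w' t) != 0 ->
    transversal_at (delta (slice Y t)) (Kbar (slice Y t)) (s' *: tg + w' *: gr).
  move=> sr wr; have [N1p _] := inN _ _ _ sr wr tr; move: N1p.
  rewrite pt_spacetime; set q := _ + _ => N1q.
  have -> : delta (slice Y t) = slice (deltaD (horiz eu) (horiz ev) Y) t.
    by apply/funext => u; exact: deltaD_slice.
  have -> : Kbar (slice Y t) = slice (KD (horiz eu) (horiz ev) Y) t.
    by apply/funext => u; exact: Kbar_slice.
  have dF := differentiable_slice (smooth_on_diff sF N1q).
  have dG := differentiable_slice (smooth_on_diff sG N1q).
  have eF v : 'D_v (slice (deltaD (horiz eu) (horiz ev) Y) t) q =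
      'D_(horiz v) (deltaD (horiz eu) (horiz ev) Y) (row_mx q t%:M) :> R by exact: derive_slice.
  have eG v : 'D_v (slice (KD (horiz eu) (horiz ev) Y) t) q =
      'D_(horiz v) (KD (horiz eu) (horiz ev) Y) (row_mx q t%:M) :> R by exact: derive_slice.
  have J := etrans (esym (tang_grad_bracket (delta x) dF dG)) (congr2 (fun a b : R => a - b)
    (congr2 *%R (eF tg) (eG gr)) (congr2 *%R (eF gr) (eG tg))).
  rewrite -J mulf_eq0 negb_or => /andP[_]; exact: (transversal_bracket dF dG).
exists (s1 *: tg + w1 *: gr), (s2 *: tg + w2 *: gr).
have [sq1 wq1] := coords s1 w1; have [sq2 wq2] := coords s2 w2.
split.
- by apply/eqP => /(congr1 s); rewrite sq1 sq2 => e; move: s12; rewrite e ltxx.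
- apply/seteqP; split=> u.
    move=> [[[sr wr] LDu] PCu].
    have /Z : `|s u| < r by []. 
    move=> /(_ _ wr)[+ _]; rewrite -LDE -PCE => /(_ (conj LDu PCu))[[e1 e2]|[e1 e2]].
      by left; rewrite /= (decomp u) e1 e2.
    by right; rewrite /= (decomp u) e1 e2.
  have mem s' w' u' : u' = s' *: tg + w' *: gr -> s u' = s' -> w u' = w' -> `|s'| < r -> `|w'| < rho ->
      (s' = s1 /\ w' = w1 \/ s' = s2 /\ w' = w2) ->
      ([set u | `|s u| < r /\ `|w u| < rho] `&` LD (slice Y t) `&` PC (slice Y t)) u'.
    move=> _ su wu sr wr /(Z _ _ sr wr)[Fu Gu].
    split; [split; [by rewrite /= su wu|]|].
      by rewrite /LD /= LDE su wu.
    by rewrite /PC /= PCE su wu.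
  move=> [->|->]; first by apply: (mem s1 w1) => //; left.
  by apply: (mem s2 w2) => //; right.
- exact: (tr_at s1 w1 s1r w1r Jq1).
- exact: (tr_at s2 w2 s2r w2r Jq2).
Qed.

End Transition.

(** * Deformations that change the crossing speed *)

Section GenericFamilies.
Context {R : realType}.
Local Notation plane := 'rV[R]_2.
Local Notation spacetime := 'rV[R]_(2 + 1).
Local Notation space := 'rV[R]_3.

Local Opaque delta Kbar.

Lemma monge_add (j : 'I_3) (p : space) (f g : plane -> R) u :
  monge j p (f + g) u = monge j p f u + g u *: delta_mx 0 j.
Proof.
apply/rowP => k; rewrite /monge !mxE; case: unliftP => [i ->|->].
  by rewrite eqxx /= eq_sym (negbTE (neq_lift _ _)) mulr0 addr0.
by rewrite !eqxx mulr1 addrA.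
Qed.

(** Every coordinate other than the j-th is affine in Monge form. *)
Lemma monge_second_derive (j : 'I_3) (p : space) (f : plane -> R) (v w : plane) :
  smooth_near 0 (monge j p f) -> exists r : R,
  'D_w ('D_v (monge j p f)) 0 = r *: delta_mx 0 j.
Proof.
move=> /smooth_nearP[A [oA A0 sx]]; set x := monge j p f in sx *.
exists ('D_w ('D_v x) 0 0 j); apply/rowP => k.
have E : 'D_w ('D_v x) 0 0 k = 'D_w ('D_v (fun z => x z 0 k)) 0.
  apply: etrans (esym (derive_coord_on w A0 k (smooth_on_derive v sx))) _.
  apply: (derive_eq_on oA w _ A0) => z Az.
  by rewrite (derive_coord_on v Az k sx).
have zero (r s : R) : r = 0 -> s = 0 -> r = s by move=> -> ->.
have [i ki|kj] := unliftP j k; last first.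
  have one (M : space) (r : R) : (r *: (delta_mx 0 j : space)) 0 k = r by rewrite kj !mxE !eqxx mulr1.
  by apply: esym; apply: etrans (one 0 _) _; rewrite kj.
have off (r : R) : (r *: (delta_mx 0 j : space)) 0 k = 0.
  by rewrite ki !mxE eqxx /= eq_sym (negbTE (neq_lift _ _)) mulr0.
apply: zero (off _); apply: etrans E _.
have xk : (fun z => x z 0 k) = (fun z : plane => p 0 k + z 0 i).
  by apply/funext => z; rewrite /x /monge !mxE ki liftK.
have Dx z (Az : A z) : 'D_v (fun z => x z 0 k) z = (fun _ : plane => v 0 i) z.
  rewrite xk; have sc : smooth_on A (fun _ : plane => p 0 k) by exact: smooth_on_cst.
  apply: etrans (deriveD_on v Az sc (smooth_on_coord_id oA i)) _.
  by apply: etrans (congr2 +%R (derive_cst (p 0 k) z v) (derive_coord_id v i Az)) _; rewrite add0r.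
by apply: etrans (derive_eq_on oA w Dx A0) _; exact: (derive_cst (v 0 i) 0 w).
Qed.

Lemma triple_scale (a b c : space) (r : R) : triple a b (r *: c) = r * triple a b c.
Proof. by rewrite /triple !mxE; ring. Qed.

Section LinearForms.
Variables (a b : R).

Definition horiz_form (z : spacetime) : R := a * z 0 (lshift 1 0) + b * z 0 (lshift 1 1).
Definition time_coord (z : spacetime) : R := z 0 (rshift 2 0).

Lemma horiz_form_horiz v : horiz_form (horiz v) = lin_form a b v.
Proof. by rewrite /horiz_form /horiz !row_mxEl. Qed.

Lemma time_coord_horiz v : time_coord (horiz v) = 0.
Proof. by rewrite /time_coord /horiz row_mxEr mxE. Qed.

Lemma time_coord_vert : time_coord vert = 1.
Proof. by rewrite /time_coord /vert row_mxEr mxE eqxx. Qed.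

Variable A : set spacetime.
Hypothesis oA : open A.

Lemma smooth_on_horiz_form : smooth_on A horiz_form.
Proof.
have sc (c : R) : smooth_on A (fun=> c) by exact: smooth_on_cst.
have s := smooth_on_coord_id oA.
exact: (smooth_onD oA (smooth_onM oA (sc a) (s _)) (smooth_onM oA (sc b) (s _))).
Qed.

Lemma derive_horiz_form v z : A z -> 'D_v horiz_form z = horiz_form v.
Proof.
move=> Az; have sc (c : R) : smooth_on A (fun=> c) by exact: smooth_on_cst.
have s := smooth_on_coord_id oA.
have M (c : R) j : 'D_v (fun z : spacetime => c * z 0 j) z = c * v 0 j.
  apply: etrans (deriveM_on v Az (sc c) (s j)) _.
  by rewrite derive_cst mul0r add0r (derive_coord_id v j Az).
apply: etrans (deriveD_on v Az (smooth_onM oA (sc a) (s _)) (smooth_onM oA (sc b) (s _))) _.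
by apply: (congr2 +%R); exact: M.
Qed.

Lemma horiz_form0 : horiz_form 0 = 0.
Proof. by rewrite /horiz_form !mxE !mulr0 addr0. Qed.

End LinearForms.

(** eps t L^2, the exponent 2 being that of [monomial] for m = 0. The factor t makes it vanish at
    time 0, as a deformation must. *)
Definition time_term (a b eps : R) : spacetime -> R :=
  monomial (fun z => eps * time_coord z) (horiz_form a b) 0.

(** The Monge family seen as one map on space-time. It is affine in h, so adding a term to h is a
    perturbation in the direction of the j-th axis. *)
Definition family (x : plane -> space) (j : 'I_3) (h : spacetime -> R) (z : spacetime) : space :=
  x (lsubmx z) + h z *: delta_mx 0 j.

Lemma smooth_near_time_term a b eps : smooth_near 0 (time_term a b eps).
Proof.
apply: (smooth_on_near (A := setT) openT) => //.
have sc : smooth_on setT (fun _ : spacetime => eps) by exact: smooth_on_cst.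
exact: (smooth_on_monomial openT 0 (smooth_onM openT sc (smooth_on_coord_id openT _))
  (smooth_on_horiz_form a b openT)).
Qed.

(** Here T has order 1 and m = 0, so first derivatives at 0 are controlled. Those of delta do not
    change, and Kbar gains P T, whose differential at 0 is P(0) times that of T and hence sees only
    the vertical direction. *)
Lemma crossing_speed_time_term (x : plane -> space) (Y : spacetime -> space) (N : space) (a b eps : R) :
  smooth_near 0 x -> smooth_near 0 Y -> (\forall u \near (0 : plane), slice Y 0 u = x u) ->
  crossing_speed x (perturb Y (time_term a b eps) N) = crossing_speed x Y +
  eps * (2%:R * triple ('D_eu x 0) ('D_ev x 0) N *
    (secD eu ev x eu eu 0 * (b * b) + secD eu ev x ev ev 0 * (a * a) -
     2%:R * (secD eu ev x eu ev 0 * (a * b)))) * 'D_(grad (delta x)) (delta x) 0.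
Proof.
move=> snx snY Y0; have [A [B [[oA A0] [oB B0] sx sY AB]]] := family_chart snx snY Y0.
pose T (z : spacetime) := eps * time_coord z; pose L := horiz_form a b.
have sc : smooth_on B (fun _ : spacetime => eps) by exact: smooth_on_cst.
have st : smooth_on B time_coord := smooth_on_coord_id oB _.
have sT : smooth_on B T by exact: (smooth_onM oB sc st).
have sL : smooth_on B L := smooth_on_horiz_form a b oB.
have DT v z : B z -> 'D_v T z = eps * time_coord v.
  move=> Bz; apply: etrans (deriveM_on v Bz sc st) _.
  by rewrite derive_cst mul0r add0r (derive_coord_id v _ Bz).
have T0 v z : B z -> 'D_(horiz v) T z = 0.
  by move=> Bz; rewrite (DT _ _ Bz) time_coord_horiz mulr0.
have TE : T 0 = 0 by rewrite /T /time_coord mxE mulr0.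
have fT : flat 1 T by case.
have hF := deltaD_monomial (horiz eu) (horiz ev) oB B0 N 0 sY sT sL fT (horiz_form0 a b).
have hG := KD_monomial oB B0 N (m := 0) sY sT sL (T0 eu) (T0 ev) fT (horiz_form0 a b)
  (derive_horiz_form a b oB) isT.
pose P := hess_form (horiz eu) (horiz ev) Y L N 0.
have sP : smooth_on B P := smooth_on_hess_form (horiz eu) (horiz ev) oB L N 0 sY.
have sG := smooth_on_KD (horiz eu) (horiz ev) oB sY.
have DG v : 'D_v (KD (horiz eu) (horiz ev) (perturb Y (time_term a b eps) N)) 0 =
    'D_v (KD (horiz eu) (horiz ev) Y) 0 + P 0 * (eps * time_coord v).
  apply: etrans (eqo_derive_val oB B0 v hG) _.
  have E z (Bz : B z) : KD (horiz eu) (horiz ev) Y z + P z * (T z * L z ^+ 0) =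
      KD (horiz eu) (horiz ev) Y z + T z * P z.
    by rewrite expr0 mulr1 [P z * _]mulrC.
  apply: etrans (derive_eq_on oB v E B0) _.
  apply: etrans (deriveD_on v B0 sG (smooth_onM oB sT sP)) _; apply: congr1.
  apply: etrans (deriveM_on v B0 sT sP) _.
  have z0 (p q r : R) : p = eps * time_coord v -> p * q + 0 * r = q * (eps * time_coord v).
    by move=> ->; rewrite mul0r addr0 mulrC.
  by rewrite TE; apply: z0; exact: DT.
have DF v : 'D_v (deltaD (horiz eu) (horiz ev) (perturb Y (time_term a b eps) N)) 0 =
    'D_v (deltaD (horiz eu) (horiz ev) Y) 0 := eqo_derive_val oB B0 v hF.
have xY u (Au : A u) := slice_eq_on oA Au (fun z Az => (AB z Az).2).
have FE u (Au : A u) : deltaD (horiz eu) (horiz ev) Y (horiz u) = delta x u.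
  by rewrite -[horiz u]row_mx_time0 -deltaD_slice; have [] := xY u Au.
have D2F : 'D_(horiz (grad (delta x))) (deltaD (horiz eu) (horiz ev) Y) 0 =
    'D_(grad (delta x)) (delta x) 0.
  by rewrite -[in LHS](@horiz0 R); exact: (derive_horiz oA FE (grad (delta x)) A0).
have sE v w : secD (horiz eu) (horiz ev) Y (horiz v) (horiz w) 0 = secD eu ev x v w 0.
  have [_ [_ S]] := xY 0 A0; apply: etrans (S v w); apply: esym.
  by apply: etrans (secD_slice Y 0 v w 0) _; rewrite row_mx_time0 horiz0.
have DE v : 'D_(horiz v) Y 0 = 'D_v x 0.
  apply: etrans (derive_eq_on oA v (fun z Az => (AB z Az).2) A0).
  by apply: esym; apply: etrans (derive_slice Y 0 v 0) _; rewrite row_mx_time0 horiz0.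
have PE : P 0 = 2%:R * triple ('D_eu x 0) ('D_ev x 0) N *
    (secD eu ev x eu eu 0 * (b * b) + secD eu ev x ev ev 0 * (a * a) -
     2%:R * (secD eu ev x eu ev 0 * (a * b))).
  have T3 (u1 u2 v1 v2 : space) (s1 s2 s3 r1 r2 r3 l1 l2 : R) : u1 = u2 -> v1 = v2 ->
      s1 = r1 -> s2 = r2 -> s3 = r3 -> l1 = a -> l2 = b ->
      2%:R * 1%:R * triple u1 v1 N * (s1 * (l2 * l2) + s2 * (l1 * l1) - 2%:R * (s3 * (l1 * l2))) =
      2%:R * triple u2 v2 N * (r1 * (b * b) + r2 * (a * a) - 2%:R * (r3 * (a * b))).
    by move=> -> -> -> -> -> -> ->; rewrite mulr1.
  have l1 : L (horiz eu) = a by rewrite /L horiz_form_horiz lin_form_eu.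
  have l2 : L (horiz ev) = b by rewrite /L horiz_form_horiz lin_form_ev.
  exact: (T3 _ _ _ _ _ _ _ _ _ _ _ _ (DE eu) (DE ev) (sE eu eu) (sE ev ev) (sE eu ev) l1 l2).
rewrite /crossing_speed -PE.
have alg (g1 g2 f1 f2 g1' g2' f1' f2' p d : R) : g1' = g1 + p * (eps * 1) -> g2' = g2 + p * (eps * 0) ->
    f1' = f1 -> f2' = f2 -> f2 = d -> g1' * f2' - g2' * f1' = g1 * f2 - g2 * f1 + eps * p * d.
  by move=> -> -> -> -> ->; ring.
apply: alg (DF _) (DF _) D2F.
  by rewrite -time_coord_vert; exact: DG.
by rewrite -(time_coord_horiz (grad (delta x))); exact: DG.
Qed.

End GenericFamilies.

Section SplittingFamilies.
Context {R : realType}.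
Local Notation plane := 'rV[R]_2.
Local Notation spacetime := 'rV[R]_(2 + 1).
Local Notation space := 'rV[R]_3.

Local Opaque delta Kbar.

Variables (x : @paramType R) (j : 'I_3) (p : space) (f : plane -> R).
Hypotheses (xE : set_val x = monge j p f) (tx : tangency (set_val x))
  (J2 : contactJ2 (set_val x) 0 != 0).

Let fam (h : @deformationType R) : spacetime -> space := family (set_val x) j (set_val h).

Lemma smooth_deformation (h : @deformationType R) : smooth_near 0 (set_val h).
Proof. by have [] := set_valP h. Qed.

Lemma jet_continuous_family : jet_continuous fam.
Proof.
exact: (jet_continuousD (jet_continuous_cst _ (smooth_lsubmx (param_smooth x)))
  (jet_continuous_scale _ (@jet_continuous_deformation R))).
Qed.

Lemma slice_family (h : @deformationType R) t :
  slice (fam h) t = monge j p (f + at_time (set_val h) t).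
Proof.
apply/funext => u; rewrite monge_add -xE.
by rewrite /slice /fam /family row_mxKl.
Qed.

Lemma slice_family0 (h : @deformationType R) :
  \forall u \near (0 : plane), slice (fam h) 0 u = set_val x u.
Proof.
have [_] := set_valP h; apply: filterS => u hu.
have E : slice (fam h) 0 u = set_val x u + at_time (set_val h) 0 u *: delta_mx 0 j.
  by rewrite /slice /fam /family row_mxKl.
by rewrite E hu scale0r addr0.
Qed.

Let speed h := crossing_speed (set_val x) (fam h).

Lemma continuous_speed : continuous speed.
Proof.
have jF := jet_continuous_deltaD jet_continuous_family (horiz eu) (horiz ev).
have jG := jet_continuous_KD jet_continuous_family (horiz eu) (horiz ev).
have cF v := jet_continuous_val (jet_continuous_derive v jF).
have cG v := jet_continuous_val (jet_continuous_derive v jG).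
move=> h; pose e2 := horiz (grad (delta (set_val x))).
exact: (cvgB (cvgM (cG vert h) (cF e2 h)) (cvgM (cG e2 h) (cF vert h))).
Qed.

Definition time_deformation (h : @deformationType R) (a b eps : R) : spacetime -> R :=
  fun z => set_val h z + time_term a b eps z.

Lemma time_deformation_germ h a b eps : deformation_germ (time_deformation h a b eps).
Proof.
have [A [oA A0 sh st]] := smooth_near2 (smooth_deformation h) (smooth_near_time_term a b eps).
split; first exact: smooth_on_near oA A0 (smooth_onD oA sh st).
have [_] := set_valP h; apply: filterS => u hu.
have z0 (q r s : R) : q = 0 -> r = 0 -> q + eps * r * s = 0 by move=> -> ->; ring.
apply: z0; first exact: hu.
by rewrite row_mx_time0 time_coord_horiz.
Qed.

Definition time_family (h : @deformationType R) (a b eps : R) : @deformationType R :=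
  SigSub (mem_set (time_deformation_germ h a b eps)).

Lemma time_family0 h a b : time_family h a b 0 = h.
Proof.
apply: val_inj; apply/funext => z.
have z0 (q r s : R) : q + 0 * r * s = q by ring.
exact: z0.
Qed.

Lemma continuous_time_family h a b : continuous (time_family h a b).
Proof.
apply: continuous_to_deformation.
have H := jet_continuousM (jet_continuousM (@jet_continuous_const R spacetime)
  (jet_continuous_cst R (smooth_on_near openT I (smooth_on_coord_id openT (rshift 2 0)))))
  (jet_continuous_cst R (smooth_on_near openT I (smooth_onX openT 2 (smooth_on_horiz_form a b openT)))).
exact: (jet_continuousD (jet_continuous_cst R (smooth_deformation h)) H).
Qed.

Lemma family_time h a b eps :
  fam (time_family h a b eps) = perturb (fam h) (time_term a b eps) (delta_mx 0 j).
Proof.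
apply/funext => z.
have z0 (q : space) (r s : R) (e : space) : q + (r + s) *: e = q + r *: e + s *: e.
  by rewrite scalerDl addrA.
exact: z0.
Qed.

(** All second derivatives are multiples of the j-th basis vector; were it tangent, the whole second
    form would vanish, against [second_form_neq0]. *)
Lemma normal_monge_neq0 :
  triple ('D_eu (set_val x) 0) ('D_ev (set_val x) 0) (delta_mx 0 j) != 0.
Proof.
have [_ _ K0 rK _] := tx; have s3 := second_form_neq0 (param_smooth x) K0 rK.
have S v w : exists r : R, secD eu ev (set_val x) v w 0 =
    r * triple ('D_eu (set_val x) 0) ('D_ev (set_val x) 0) (delta_mx 0 j).
  have smx : smooth_near 0 (monge j p f) by rewrite -xE; exact: param_smooth.
  have [r Er] := monge_second_derive v w smx; exists r; rewrite -xE in Er.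
  exact: etrans (congr1 (triple _ _) Er) (triple_scale _ _ _ _).
apply/eqP => t0; have Z v w : secD eu ev (set_val x) v w 0 = 0.
  by have [r E] := S v w; apply: etrans E _; rewrite t0 mulr0.
by case: s3; rewrite Z eqxx.
Qed.

Lemma splitting_families : exists O : set (@deformationType R), [/\ open O, dense O &
  forall h, O h -> two_zero_transition (fun t => monge j p (f + at_time (set_val h) t))].
Proof.
exists [set h | speed h != 0]; split.
- rewrite (_ : [set _ | _] = speed @^-1` [set r : R | r != 0])//.
  by apply: open_comp => [h _|]; [exact: continuous_speed|exact: open_neq].
- move=> B [h Bh] oB; have [h0|h0] := EM (speed h = 0); last first.
    by exists h; split; [exact: Bh|exact/eqP].
  have [d0 rd K0 rK _] := tx; have s3 := second_form_neq0 (param_smooth x) K0 rK.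
  have /smooth_nearP[A [oA A0 sx]] := param_smooth x.
  have dd := smooth_on_diff (smooth_on_delta oA sx) A0.
  have [a [b [_ ab]]] := isotropic_choice ((regular_atP dd).1 rd) s3.
  have nB : nbhs (time_family h a b 0) B by rewrite time_family0; exact: open_nbhs_nbhs.
  have [eps eps0 Beps] := near_zero_neq (@continuous_time_family h a b) nB.
  exists (time_family h a b eps); split; first exact: Beps.
  have E : speed (time_family h a b eps) = _ := etrans
    (congr1 (crossing_speed (set_val x)) (family_time h a b eps))
    (crossing_speed_time_term (delta_mx 0 j) a b eps (param_smooth x)
      (jet_continuous_family.1 h) (slice_family0 h)).
  have n0 (r s t u v w : R) : r = s + t * (2%:R * u * v) * w -> s = 0 -> t != 0 -> u != 0 ->
      v != 0 -> w != 0 -> r != 0.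
    by move=> -> -> t0 u0 v0 w0; rewrite add0r !mulf_neq0// pnatr_eq0.
  apply: (n0 _ _ _ _ _ _ E h0 eps0 normal_monge_neq0 ab).
  by rewrite gt_eqF//; exact: grad_gt0.
- move=> h Oh.
  have -> : (fun t => monge j p (f + at_time (set_val h) t)) = slice (fam h).
    by apply/funext => t; rewrite slice_family.
  exact: (family_transition (param_smooth x) (jet_continuous_family.1 h) (slice_family0 h) tx J2 Oh).
Qed.

End SplittingFamilies.

Theorem theorem5p3 (R : realType) :
  generic_in (@G7 R)
    [set M | contact_is_two M /\ generic_families_split M].
Proof.
have two (x : @paramType R) : tangency (set_val x) -> contactJ2 (set_val x) 0 != 0 ->
    contact_is_two (surface_of x) /\ generic_families_split (surface_of x).
  move=> tx J2; have c2 := (contact_is_twoP tx).2 J2; split; first exact: c2.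
  move=> y j p f yx yE; have ty := tangency_same (esym yx) tx.
  have J2y : contactJ2 (set_val y) 0 != 0 by apply: (contact_is_twoP ty).1; rewrite yx.
  exact: splitting_families yE ty J2y.
split.
  (* On [G7] both required properties together amount to nondegeneracy: splitting of families
     follows from the nonvanishing of [contactJ2], which contact 2 already forces. *)
  exists (@nondegenerate_surfaces R); first exact: open_nondegenerate.
  apply/seteqP; split=> M; have [x <-] := surface_of_surj M.
    move=> [nd G7x]; split; last exact: G7x.
    have tx := (G7P x).1 G7x; apply: (two x tx); apply/eqP => J2.
    by have [d0 _ K0 _ J1] := tx; apply: (nd x erefl); split.
  move=> [[c2 _] G7x]; split; last exact: G7x.
  have tx := (G7P x).1 G7x; move=> y yx [_ _ _ J2].
  have ty := tangency_same (esym yx) tx.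
  by have := (contact_is_twoP ty).1; rewrite yx => /(_ c2); rewrite J2 eqxx.
move=> M; have [x <-] := surface_of_surj M => G7x.
apply: closure_surface => B nB.
have [y By [ty J2y]] := tangency_dense ((G7P x).1 G7x) nB.
by exists y; [exact: By|split; [exact: two|exact/G7P]].
Qed.
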